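(* (i) Let $T_{s,n}=((x_{|i-j|}))_{0\le i,j\le n-1}$ be the symmetric Toeplitz matrix whose input variables $\{x_j\}_{j\ge0}$ are i.i.d. real random variables with mean $0$ and variance $1$. Then the ESD of $n^{-1/2}T_{s,n}$ converges weakly almost surely to the non-random probability law on $\mathbb{R}$ which is determined by the moments of $(Z+\tilde Z)/\sqrt2$, where $Z,\tilde Z$ are the self-adjoint standard Gaussian variables described in the context. (ii) Let $H_n=((h_{i+j}))_{0\le i,j\le n-1}$ be the Hankel matrix whose input variables $\{h_j\}_{j\ge0}$ are i.i.d. real random variables with mean $0$ and variance $1$. Then the ESD of $n^{-1/2}H_n$ converges weakly almost surely to the non-random probability law on $\mathbb{R}$ which is determined by the moments of $(Y_1+Y_2)/\sqrt2$, where $Y_1,Y_2$ are the standard symmetrized Rayleigh variables described in the context.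
   Context: The ESD (empirical spectral distribution) of an $n\times n$ matrix with eigenvalues $\lambda_1,\dots,\lambda_n$ is $n^{-1}\sum_j\delta_{\lambda_j}$. An NCP (non-commutative $*$-probability space) $(\mathcal{A},\varphi)$ is a unital complex $*$-algebra with a complex linear functional $\varphi$ satisfying $\varphi(1_{\mathcal{A}})=1$. $\mathcal{M}_n$ is the $*$-algebra of $n\times n$ random matrices all of whose entries have finite moments of all orders, with $\varphi_n=n^{-1}\mathbb{E}\,\mathrm{Tr}$. Elements $a_n$ of NCPs $(\mathcal{A}_n,\varphi_n)$ converge in $*$-distribution to $a\in\mathcal{A}$ if $\varphi_n(Q(a_n))\to\varphi(Q(a))$ for every monomial $Q$ in the non-commuting indeterminates $x,x^*$. A self-adjoint variable $a$ ($a=a^*$) is standard Gaussian if its moments $\varphi(a^k)$ are those of the standard Gaussian law on $\mathbb{R}$; it is a standard symmetrized Rayleigh variable if $\varphi(a^{2m-1})=0$ and $\varphi(a^{2m})=m!$ for all $m\ge1$. Variables in (i): $Z,\tilde Z$ are self-adjoint standard Gaussian variables in an NCP such that, whenever the input variables of a symmetric Toeplitz matrix $T_{s,n}$ are independent real with mean $0$, variance $1$ and uniformly bounded moments of every order, $n^{-1/2}T_{s,n}\in(\mathcal{M}_n,\varphi_n)$ converges in $*$-distribution to $(Z+\tilde Z)/\sqrt2$. Variables in (ii): $Y_1,Y_2$ are standard symmetrized Rayleigh variables in an NCP such that, whenever the input variables of a Hankel matrix $H_n$ are independent real with mean $0$, variance $1$ and uniformly bounded moments of every order, $n^{-1/2}H_n\in(\mathcal{M}_n,\varphi_n)$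 converges in $*$-distribution to $(Y_1+Y_2)/\sqrt2$. (The existence of such variables is a result of the paper. ''Determined by the moments'' means that there is exactly one probability law on $\mathbb{R}$ with these moments.) *)

(* Defs.v *)
From HB Require Import structures.
From mathcomp Require Import all_boot all_order all_algebra.
From mathcomp Require Import sesquilinear spectral.
From mathcomp Require Import all_classical all_reals all_analysis.
From mathcomp Require Import measurable_realfun complex.

Set Implicit Arguments.
Unset Strict Implicit.
Unset Printing Implicit Defensive.

Import Order.TTheory GRing.Theory Num.Theory.
Import numFieldNormedType.Exports.

Local Open Scope classical_set_scope.
Local Open Scope ring_scope.
Local Open Scope complex_scope.

Local Notation Re := complex.Re.
Local Notation Im := complex.Im.

Record ncp (R : realType) := Ncp {
  ncp_alg :> algType R[i];
  ncp_star : ncp_alg -> ncp_alg;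
  ncp_starD : forall a b, ncp_star (a + b) = ncp_star a + ncp_star b;
  ncp_starZ : forall (c : R[i]) a, ncp_star (c *: a) = c^*%C *: ncp_star a;
  ncp_starM : forall a b, ncp_star (a * b) = ncp_star b * ncp_star a;
  ncp_starK : involutive ncp_star;
  ncp_phi : {scalar ncp_alg};
  ncp_phi1 : ncp_phi 1 = 1 }.

Arguments ncp_star {R} _ _.
Arguments ncp_phi {R} _.

Section ncp_variables.
Variable R : realType.
Implicit Type A : ncp R.

Definition self_adjoint A (a : A) := ncp_star A a = a.

(* A word in [bool] encodes a monomial in the non-commuting indeterminates
   x ([false]) and x^* ([true]). *)
Definition monomial A (Q : seq bool) (a : A) : A :=
  \prod_(b <- Q) (if b then ncp_star A a else a).

(* [R[i]^o] is [R[i]] with the topology given by the modulus. *)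
Definition cvg_star_distribution (A_ : nat -> ncp R) (a_ : forall n, A_ n)
    A (a : A) :=
  forall Q : seq bool,
    (fun n => ncp_phi (A_ n) (monomial Q (a_ n)) : R[i]^o) @ \oo -->
    (ncp_phi A (monomial Q a) : R[i]^o).

Definition standard_gaussian A (a : A) :=
  self_adjoint a /\
  forall k : nat,
    ncp_phi A (a ^+ k) = (\int[normal_prob (0 : R) 1]_x (x ^+ k))%:C.

Definition standard_symm_rayleigh A (a : A) :=
  self_adjoint a /\
  forall m : nat, (0 < m)%N ->
    ncp_phi A (a ^+ (2 * m - 1)) = 0 /\ ncp_phi A (a ^+ (2 * m)) = (m`!)%:R.

End ncp_variables.

Section finite_moments.
Context {d : measure_display} {T : measurableType d} {R : realType}.
Variable P : probability T R.
Implicit Types f g : T -> R[i].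

Definition finite_moments f :=
  [/\ measurable_fun setT (fun w => Re (f w)),
      measurable_fun setT (fun w => Im (f w)) &
      forall k : nat, (\int[P]_w (Normc.normc (f w) ^+ k)%:E < +oo)%E].

Definition complex_expectation f : R[i] :=
  (\int[P]_w Re (f w)) +i* (\int[P]_w Im (f w)).

Lemma normc_ge0 (z : R[i]) : 0 <= Normc.normc z.
Proof. by case: z => a b; exact: sqrtr_ge0. Qed.

Lemma normc_Re (z : R[i]) : `|Re z| <= Normc.normc z.
Proof. by have := normc_ge_Re z; rewrite lecR. Qed.

Lemma normc_Im (z : R[i]) : `|Im z| <= Normc.normc z.
Proof.
case: z => a b /=; rewrite -sqrtr_sqr ler_sqrt ?addr_ge0 ?sqr_ge0//.
by rewrite lerDr sqr_ge0.
Qed.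

Lemma measurable_normc f :
  measurable_fun setT (fun w => Re (f w)) ->
  measurable_fun setT (fun w => Im (f w)) ->
  measurable_fun setT (fun w => Normc.normc (f w)).
Proof.
move=> mr mi.
have -> : (fun w => Normc.normc (f w)) =
    Num.sqrt \o (fun w => Re (f w) ^+ 2 + Im (f w) ^+ 2).
  by apply/funext => w /=; case: (f w).
apply: measurableT_comp.
  by apply: continuous_measurable_fun; exact: sqrt_continuous.
by apply: measurable_funD; exact: measurable_funX.
Qed.

Lemma measurable_normcX f k :
  measurable_fun setT (fun w => Re (f w)) ->
  measurable_fun setT (fun w => Im (f w)) ->
  measurable_fun setT (fun w => (Normc.normc (f w) ^+ k)%:E).
Proof.
move=> mr mi; apply/measurable_EFinP.
by apply: measurable_funX; exact: measurable_normc.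
Qed.

Lemma finite_moments_le f g h (c : R) (a b : nat -> nat) :
  finite_moments g -> finite_moments h ->
  measurable_fun setT (fun w => Re (f w)) ->
  measurable_fun setT (fun w => Im (f w)) ->
  0 <= c ->
  (forall k w, Normc.normc (f w) ^+ k <=
     c ^+ k * (Normc.normc (g w) ^+ a k + Normc.normc (h w) ^+ b k)) ->
  finite_moments f.
Proof.
move=> [mrg mig Ig] [mrh mih Ih] mr mi c0 fgh; split=> // k.
have gh0 w : (0 <= (Normc.normc (g w) ^+ a k)%:E +
                   (Normc.normc (h w) ^+ b k)%:E)%E.
  by rewrite -EFinD lee_fin addr_ge0 ?exprn_ge0 ?normc_ge0.
have mgh : measurable_fun setT (fun w => (Normc.normc (g w) ^+ a k)%:E +
                   (Normc.normc (h w) ^+ b k)%:E)%E.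
  by apply: emeasurable_funD; exact: measurable_normcX.
apply: (@le_lt_trans _ _ (\int[P]_w ((c ^+ k)%:E *
    ((Normc.normc (g w) ^+ a k)%:E + (Normc.normc (h w) ^+ b k)%:E)))%E).
  apply: ge0_le_integral => //.
  - by move=> w _; rewrite lee_fin exprn_ge0 ?normc_ge0.
  - exact: measurable_normcX.
  - by apply: emeasurable_funM => //; exact: measurable_cst.
  - by move=> w _; rewrite -EFinD -EFinM lee_fin.
rewrite ge0_integralZl//; last by rewrite lee_fin exprn_ge0.
rewrite ge0_integralD//.
- by apply: lte_mul_pinfty; rewrite ?lee_fin ?exprn_ge0//; exact: lte_add_pinfty.
- by move=> w _; rewrite lee_fin exprn_ge0 ?normc_ge0.
- exact: measurable_normcX.
- by move=> w _; rewrite lee_fin exprn_ge0 ?normc_ge0.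
- exact: measurable_normcX.
Qed.

Lemma finite_moments_cst (c : R[i]) : finite_moments (fun=> c).
Proof.
split; [exact: measurable_cst|exact: measurable_cst|move=> k].
by rewrite integral_cst//= probability_setT mule1 ltry.
Qed.

Lemma finite_momentsD f g :
  finite_moments f -> finite_moments g -> finite_moments (fun w => f w + g w).
Proof.
move=> ff fg; have [mrf mif _] := ff; have [mrg mig _] := fg.
apply: (@finite_moments_le _ f g 2 id id) => //.
- rewrite (_ : (fun w => _) = (fun w => Re (f w) + Re (g w))).
    exact: measurable_funD.
  by apply/funext => w; case: (f w) (g w) => [? ?] [].
- rewrite (_ : (fun w => _) = (fun w => Im (f w) + Im (g w))).
    exact: measurable_funD.
  by apply/funext => w; case: (f w) (g w) => [? ?] [].
move=> k w; have := le_normcD (f w) (g w).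
set x := Normc.normc (f w); set y := Normc.normc (g w) => xy.
have x0 : 0 <= x by exact: normc_ge0.
have y0 : 0 <= y by exact: normc_ge0.
apply: (@le_trans _ _ ((2 * Num.max x y) ^+ k)).
  rewrite lerXn2r ?nnegrE ?normc_ge0 ?mulr_ge0 ?le_max ?x0//.
  apply: le_trans xy _; rewrite mulrDl !mul1r.
  by rewrite lerD// le_max lexx ?orbT.
rewrite exprMn ler_wpM2l ?exprn_ge0//.
by case: (leP x y) => _; rewrite ?lerDr ?lerDl exprn_ge0.
Qed.

Lemma finite_momentsM f g :
  finite_moments f -> finite_moments g -> finite_moments (fun w => f w * g w).
Proof.
move=> ff fg; have [mrf mif _] := ff; have [mrg mig _] := fg.
apply: (@finite_moments_le _ f g 1 (fun k => k.*2) (fun k => k.*2)) => //.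
- rewrite (_ : (fun w => _) = (fun w => Re (f w) * Re (g w) - Im (f w) * Im (g w))).
    by apply: measurable_funB; exact: measurable_funM.
  by apply/funext => w; case: (f w) (g w) => [? ?] [].
- rewrite (_ : (fun w => _) = (fun w => Re (f w) * Im (g w) + Im (f w) * Re (g w))).
    by apply: measurable_funD; exact: measurable_funM.
  by apply/funext => w; case: (f w) (g w) => [? ?] [].
move=> k w; rewrite Normc.normcM expr1n mul1r exprMn -!muln2 !exprM.
have := normc_ge0 (f w); have := normc_ge0 (g w).
move=> /(exprn_ge0 k); set y := _ ^+ k => y0 /(exprn_ge0 k); set x := _ ^+ k => x0.
case: (leP x y) => xy.
  by apply: (@le_trans _ _ (y ^+ 2)); rewrite ?lerDr ?sqr_ge0// expr2 ler_wpM2r.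
by apply: (@le_trans _ _ (x ^+ 2)); rewrite ?lerDl ?sqr_ge0// expr2 ler_wpM2l// ltW.
Qed.

Lemma finite_moments_conj f :
  finite_moments f -> finite_moments (fun w => (f w)^*%C).
Proof.
move=> [mr mi If]; split.
- rewrite (_ : (fun w => _) = (fun w => Re (f w)))//.
  by apply/funext => w; case: (f w).
- rewrite (_ : (fun w => _) = (fun w => - Im (f w))); last first.
    by apply/funext => w; case: (f w).
  by apply: measurableT_comp => //.
- move=> k; rewrite (eq_integral (fun w => (Normc.normc (f w) ^+ k)%:E))// => w _.
  by case: (f w) => a b /=; rewrite sqrrN.
Qed.

Lemma finite_moments_sum (I : Type) (s : seq I) (F : I -> T -> R[i]) :
  (forall i, finite_moments (F i)) ->
  finite_moments (fun w => \sum_(i <- s) F i w).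
Proof.
move=> FF; elim: s => [|i s IH].
  rewrite (_ : (fun w => _) = (fun=> 0)); first exact: finite_moments_cst.
  by apply/funext => w; rewrite big_nil.
rewrite (_ : (fun w => _) = (fun w => F i w + \sum_(i <- s) F i w)).
  exact: finite_momentsD.
by apply/funext => w; rewrite big_cons.
Qed.

Lemma finite_moments_Re f : finite_moments f ->
  P.-integrable setT (fun w => (Re (f w))%:E).
Proof.
move=> [mr mi /(_ 1%N) If]; apply/integrableP; split; first exact/measurable_EFinP.
apply: le_lt_trans If; apply: ge0_le_integral => //=.
- by apply/measurable_EFinP; exact: measurableT_comp.
- exact: measurable_normcX.
- by move=> w _; rewrite lee_fin expr1 normc_Re.
Qed.

Lemma finite_moments_Im f : finite_moments f ->
  P.-integrable setT (fun w => (Im (f w))%:E).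
Proof.
move=> [mr mi /(_ 1%N) If]; apply/integrableP; split; first exact/measurable_EFinP.
apply: le_lt_trans If; apply: ge0_le_integral => //=.
- by apply/measurable_EFinP; exact: measurableT_comp.
- exact: measurable_normcX.
- by move=> w _; rewrite lee_fin expr1 normc_Im.
Qed.

Lemma complex_expectation_linear (c : R[i]) f g :
  finite_moments f -> finite_moments g ->
  complex_expectation (fun w => c * f w + g w) =
  c * complex_expectation f + complex_expectation g.
Proof.
move=> ff fg.
have := finite_moments_Re ff; have := finite_moments_Im ff.
have := finite_moments_Re fg; have := finite_moments_Im fg.
move=> ig rg if_ rf; case: c => a b; rewrite /complex_expectation.
have iZ (k : R) (h : T -> R) : P.-integrable setT (EFin \o h) ->
    P.-integrable setT (EFin \o (fun w => k * h w)).
  by move=> ih; exact: (integrableZl measurableT k ih).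
have -> : (fun w => Re ((a +i* b) * f w + g w)) =
    (fun w => (a * Re (f w) - b * Im (f w)) + Re (g w)).
  by apply/funext => w; case: (f w) (g w) => [? ?] [].
have -> : (fun w => Im ((a +i* b) * f w + g w)) =
    (fun w => (a * Im (f w) + b * Re (f w)) + Im (g w)).
  by apply/funext => w; case: (f w) (g w) => [? ?] [].
have i1 := iZ a _ rf; have i2 := iZ b _ if_.
have i3 := iZ a _ if_; have i4 := iZ b _ rf.
rewrite RintegralD//; last exact: (integrableB measurableT i1 i2).
rewrite RintegralB// RintegralD//; last exact: (integrableD measurableT i3 i4).
by rewrite RintegralD// !RintegralZl.
Qed.

End finite_moments.

Section random_matrices.
Context {d : measure_display} {T : measurableType d} {R : realType}.
Variables (P : probability T R) (n : nat).

(* Matrices of size [n.+1]: an n x n matrix algebra is unital, in the sense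
   [1 != 0], only for positive n. *)
Local Notation mx := 'M[R[i]]_n.+1.

Definition finite_moments_mx : {pred T -> mx} :=
  fun M => `[< forall i j, finite_moments P (fun w => M w i j) >].

Lemma finite_moments_mxP (M : T -> mx) :
  reflect (forall i j, finite_moments P (fun w => M w i j))
          (M \in finite_moments_mx).
Proof. exact: asboolP. Qed.

Lemma finite_moments_mx_zmod : zmod_closed finite_moments_mx.
Proof.
split=> [|M N /finite_moments_mxP fM /finite_moments_mxP fN].
  apply/finite_moments_mxP => i j.
  rewrite (_ : (fun w => _) = (fun=> 0)); first exact: finite_moments_cst.
  by apply/funext => w; rewrite mxE.
apply/finite_moments_mxP => i j.
rewrite (_ : (fun w => _) = (fun w => M w i j + (- 1) * N w i j)).
  apply: finite_momentsD => //; apply: finite_momentsM => //.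
  exact: finite_moments_cst.
by apply/funext => w; rewrite !mxE mulN1r.
Qed.

HB.instance Definition _ :=
  GRing.isZmodClosed.Build (T -> mx) finite_moments_mx finite_moments_mx_zmod.

Lemma finite_moments_mx_mul : mulr_closed finite_moments_mx.
Proof.
split=> [|M N /finite_moments_mxP fM /finite_moments_mxP fN].
  apply/finite_moments_mxP => i j; exact: finite_moments_cst.
apply/finite_moments_mxP => i j.
rewrite (_ : (fun w => _) = (fun w => \sum_k M w i k * N w k j)).
  by apply: finite_moments_sum => k; exact: finite_momentsM.
by apply/funext => w; rewrite !mxE.
Qed.

HB.instance Definition _ :=
  GRing.isMulClosed.Build (T -> mx) finite_moments_mx finite_moments_mx_mul.

Lemma finite_moments_mx_scale : GRing.scaler_closed finite_moments_mx.
Proof.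
move=> c M /finite_moments_mxP fM; apply/finite_moments_mxP => i j.
rewrite (_ : (fun w => _) = (fun w => c * M w i j)).
  by apply: finite_momentsM => //; exact: finite_moments_cst.
by apply/funext => w; rewrite !mxE.
Qed.

HB.instance Definition _ :=
  GRing.isScaleClosed.Build R[i] (T -> mx) finite_moments_mx
    finite_moments_mx_scale.

Definition random_mx := {M : T -> mx | M \in finite_moments_mx}.

HB.instance Definition _ := SubChoice.on random_mx.
HB.instance Definition _ := [SubChoice_isSubZmodule of random_mx by <:].
HB.instance Definition _ := [SubZmodule_isSubNzRing of random_mx by <:].
HB.instance Definition _ := [SubZmodule_isSubLmodule of random_mx by <:].

Lemma random_mx_scalerAl (c : R[i]) (M N : random_mx) : c *: (M * N) = c *: M * N.
Proof. apply/val_inj/funext => w; exact: (scalerAl c (val M w) (val N w)). Qed.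

HB.instance Definition _ :=
  GRing.LSemiModule_isLSemiAlgebra.Build R[i] random_mx random_mx_scalerAl.

Lemma random_mx_scalerAr (c : R[i]) (M N : random_mx) : c *: (M * N) = M * (c *: N).
Proof. apply/val_inj/funext => w; exact: (scalerAr c (val M w) (val N w)). Qed.

HB.instance Definition _ :=
  GRing.LSemiAlgebra_isSemiAlgebra.Build R[i] random_mx random_mx_scalerAr.

Lemma random_mx_star_subproof (M : random_mx) :
  (fun w => map_mx (@conjc R) (val M w)^T) \in finite_moments_mx.
Proof.
case: M => M /= /finite_moments_mxP fM; apply/finite_moments_mxP => i j.
rewrite (_ : (fun w => _) = (fun w => (M w j i)^*%C)).
  exact: finite_moments_conj.
by apply/funext => w; rewrite !mxE.
Qed.

Definition random_mx_star (M : random_mx) : random_mx :=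
  exist (fun N => N \in finite_moments_mx) _ (random_mx_star_subproof M).

Lemma random_mx_starD (M N : random_mx) :
  random_mx_star (M + N) = random_mx_star M + random_mx_star N.
Proof.
apply/val_inj/funext => w; apply/matrixP => i j.
by rewrite /= !mxE rmorphD.
Qed.

Lemma random_mx_starZ (c : R[i]) (M : random_mx) :
  random_mx_star (c *: M) = c^*%C *: random_mx_star M.
Proof.
apply/val_inj/funext => w; apply/matrixP => i j.
by rewrite /= !mxE rmorphM.
Qed.

Lemma random_mx_starM (M N : random_mx) :
  random_mx_star (M * N) = random_mx_star N * random_mx_star M.
Proof.
apply/val_inj/funext => w; apply/matrixP => i j.
rewrite /= !mxE rmorph_sum; apply: eq_bigr => k _.
by rewrite !mxE rmorphM mulrC.
Qed.

Lemma random_mx_starK : involutive random_mx_star.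
Proof.
move=> M; apply/val_inj/funext => w; apply/matrixP => i j.
by rewrite /= !mxE conjcK.
Qed.

Definition random_mx_phi (M : random_mx) : R[i] :=
  (n.+1%:R)^-1 * complex_expectation P (fun w => \tr (val M w)).

Lemma random_mx_phi_linear : scalar random_mx_phi.
Proof.
have ft (M : random_mx) : finite_moments P (fun w => \tr (val M w)).
  case: M => M /= /finite_moments_mxP fM.
  by apply: finite_moments_sum => i; exact: fM.
move=> c M N; rewrite /random_mx_phi.
rewrite (_ : (fun w => \tr _) =
    (fun w => c * \tr (val M w) + \tr (val N w))).
  by rewrite complex_expectation_linear// mulrDr mulrCA.
by apply/funext => w; rewrite /= mxtraceD mxtraceZ.
Qed.

HB.instance Definition _ :=
  GRing.isLinear.Build R[i] random_mx R[i] *%R random_mx_phi random_mx_phi_linear.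

Lemma random_mx_phi1 : random_mx_phi 1 = 1.
Proof.
rewrite /random_mx_phi (_ : (fun w => \tr _) = (fun=> (n.+1%:R : R)%:C)).
  rewrite /complex_expectation /= !Rintegral_cst//= probability_setT /=.
  by rewrite mul0r mulr1 -[_ +i* 0]/(_%:C) rmorph_nat mulVf ?pnatr_eq0.
by apply/funext => w; rewrite /= mxtrace1 rmorph_nat.
Qed.

Definition random_mx_ncp : ncp R :=
  Ncp random_mx_starD random_mx_starZ random_mx_starM random_mx_starK
    (ncp_phi := random_mx_phi) random_mx_phi1.

End random_matrices.

Arguments finite_moments_mx {d T R} P n _.

Section patterned_matrices.
Variable V : Type.
Implicit Types (x : nat -> V) (n : nat).

Definition symm_toeplitz x n : 'M[V]_n :=
  \matrix_(i < n, j < n) x `|i%:Z - j%:Z|%N.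

Definition hankel x n : 'M[V]_n := \matrix_(i < n, j < n) x (i + j)%N.

End patterned_matrices.

Definition normalized (R : realType) n (M : 'M[R]_n) : 'M[R]_n :=
  (Num.sqrt n%:R)^-1 *: M.

Section input_variables.
Context {d : measure_display} {T : measurableType d} {R : realType}.
Variable P : probability T R.
Implicit Type x : nat -> {RV P >-> R}.

Definition mutually_independent x :=
  forall (J : seq nat) (B : nat -> set R), uniq J ->
    (forall j, measurable (B j)) ->
    P (\bigcap_(j in [set` J]) (x j @^-1` B j)) =
    (\prod_(j <- J) P (x j @^-1` B j))%E.

Definition identically_distributed x :=
  forall (i j : nat) (B : set R), measurable B ->
    distribution P (x i) B = distribution P (x j) B.

Definition standardized x :=
  forall j : nat, ('E_P[x j] = 0)%E /\ ('V_P[x j] = 1)%E.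

Definition uniformly_bounded_moments x :=
  forall k : nat, exists C : R, forall j : nat,
    ('E_P[fun w => (`|x j w| ^+ k)%R] <= C%:E)%E.

Lemma real_finite_moments x (c : R) j : uniformly_bounded_moments x ->
  finite_moments P (fun w => (c * x j w)%:C).
Proof.
move=> bx; rewrite (_ : (fun w => _) = (fun w => c%:C * (x j w)%:C)).
  apply: finite_momentsM; first exact: finite_moments_cst.
  split => [||k]; [exact: measurable_funPT|exact: measurable_cst|].
  have [C /(_ j)] := bx k; rewrite unlock => xC.
  rewrite (eq_integral (fun w => (`|x j w| ^+ k)%:E)).
    by apply: le_lt_trans xC _; exact: ltry.
  by move=> w _ /=; rewrite expr0n addr0 sqrtr_sqr.
by apply/funext => w; rewrite rmorphM.
Qed.

Lemma toeplitz_subproof x (bx : uniformly_bounded_moments x) n :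
  (fun w => map_mx (real_complex R) (normalized (symm_toeplitz (x^~ w) n.+1)))
    \in finite_moments_mx P n.
Proof.
apply/finite_moments_mxP => i j; set k := `|i%:Z - j%:Z|%N.
rewrite (_ : (fun w => _) = (fun w => ((Num.sqrt n.+1%:R)^-1 * x k w)%:C)).
  exact: real_finite_moments.
by apply/funext => w; rewrite !mxE.
Qed.

Definition toeplitz_elt x (bx : uniformly_bounded_moments x) n :
  random_mx_ncp P n :=
  exist (fun N => N \in finite_moments_mx P n) _ (toeplitz_subproof bx n).

Lemma hankel_subproof x (bx : uniformly_bounded_moments x) n :
  (fun w => map_mx (real_complex R) (normalized (hankel (x^~ w) n.+1)))
    \in finite_moments_mx P n.
Proof.
apply/finite_moments_mxP => i j.
rewrite (_ : (fun w => _) = (fun w => ((Num.sqrt n.+1%:R)^-1 * x (i + j)%N w)%:C)).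
  exact: real_finite_moments.
by apply/funext => w; rewrite !mxE.
Qed.

Definition hankel_elt x (bx : uniformly_bounded_moments x) n :
  random_mx_ncp P n :=
  exist (fun N => N \in finite_moments_mx P n) _ (hankel_subproof bx n).

End input_variables.

Section limits.
Variables (R : realType) (A : ncp R).

Definition toeplitz_limit (a : A) :=
  forall (d : measure_display) (T : measurableType d) (P : probability T R)
    (x : nat -> {RV P >-> R}) (bx : uniformly_bounded_moments x),
    mutually_independent x -> standardized x ->
    cvg_star_distribution (toeplitz_elt bx) a.

Definition hankel_limit (a : A) :=
  forall (d : measure_display) (T : measurableType d) (P : probability T R)
    (h : nat -> {RV P >-> R}) (bh : uniformly_bounded_moments h),
    mutually_independent h -> standardized h ->
    cvg_star_distribution (hankel_elt bh) a.

Definition normalized_sum (a b : A) : A := ((Num.sqrt 2)^-1)%:C *: (a + b).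

End limits.

Section laws.
Variable R : realType.
Implicit Type mu : probability (measurableTypeR R) R.

Definition has_moments mu (m : nat -> R[i]) :=
  forall k : nat,
    mu.-integrable setT (fun x : R => (x ^+ k)%:E) /\
    (\int[mu]_x (x ^+ k))%:C = m k.

Definition determined_by_moments mu (m : nat -> R[i]) :=
  has_moments mu m /\
  forall nu : probability (measurableTypeR R) R, has_moments nu m ->
    forall B : set (measurableTypeR R), measurable B -> nu B = mu B.

Definition weak_cvg (mu_ : nat -> probability (measurableTypeR R) R) mu :=
  forall f : R -> R, continuous f -> (exists C : R, forall x, `|f x| <= C) ->
    (fun n => \int[mu_ n]_x f x) @ \oo --> \int[mu]_x f x.

End laws.

Section esd.
Variables (R : realType).

Definition complex_eigenvalues n (M : 'M[R[i]]_n) : seq R[i] :=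
  projT1 (closed_field_poly_normal (char_poly M)).

(* Meaningful for matrices with a real spectrum, see [char_poly_symmetric]. *)
Definition eigenvalues n (M : 'M[R]_n) : seq R :=
  [seq Re z | z <- complex_eigenvalues (map_mx (real_complex R) M)].

Lemma complex_eigenvaluesP n (M : 'M[R[i]]_n) :
  char_poly M = \prod_(z <- complex_eigenvalues M) ('X - z%:P).
Proof.
rewrite /complex_eigenvalues; case: closed_field_poly_normal => s /= {1}->.
by rewrite (monicP (char_poly_monic M)) scale1r.
Qed.

Lemma size_eigenvalues n (M : 'M[R]_n) : size (eigenvalues M) = n.
Proof.
rewrite size_map; apply: succn_inj.
by rewrite -(size_prod_XsubC _ id) -complex_eigenvaluesP size_char_poly.
Qed.

Lemma complex_eigenvalues_symmetric n (M : 'M[R]_n) z : M^T = M ->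
  z \in complex_eigenvalues (map_mx (real_complex R) M) -> z = (Re z)%:C.
Proof.
move=> Msym; set C := map_mx _ M => zM.
have : eigenvalue C z.
  by rewrite eigenvalue_root_char complex_eigenvaluesP root_prod_XsubC.
have Cherm : C \is hermsymmx.
  apply: realsym_hermsym.
    apply/is_hermitianmxP; rewrite expr0 scale1r.
    by apply/matrixP => i j; rewrite !mxE -[in LHS]Msym mxE.
  by apply/mxOverP => i j; rewrite mxE complex_real.
move=> /eigenvalueP[v vC v0].
have /orthomx_spectralP CE := hermitian_normalmx Cherm.
have /mxOverP Dreal := hermitian_spectral_diag_real Cherm.
set Q := spectralmx C in CE; set D := spectral_diag C in CE Dreal.
pose u := v *m invmx Q.
have Qu : Q \in unitmx by exact: spectral_unit.
have uD : u *m diag_mx D = z *: u.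
  by rewrite /u scalemxAl -vC CE !mulmxA mulmxK.
have [j uj] : exists j, u 0 j != 0.
  apply/existsP; apply: contraR v0 => /existsPn u0.
  suff u00 : u = 0 by rewrite -(mulmxKV Qu v) -/u u00 mul0mx.
  by apply/rowP => j; have := u0 j; rewrite negbK [RHS]mxE => /eqP.
clearbody u.
have := congr1 (fun w : 'rV_n => w 0 j) uD.
rewrite mul_mx_diag !mxE mulrC => /(mulIf uj) <-.
by rewrite RRe_real.
Qed.

Lemma char_poly_symmetric n (M : 'M[R]_n) : M^T = M ->
  char_poly M = \prod_(l <- eigenvalues M) ('X - l%:P).
Proof.
move=> Msym; apply: (map_poly_inj (real_complex R)).
rewrite map_char_poly complex_eigenvaluesP rmorph_prod /= big_map.
rewrite big_seq [RHS]big_seq; apply: eq_bigr => z zM.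
rewrite rmorphB /= map_polyX map_polyC /=.
by rewrite -(complex_eigenvalues_symmetric Msym zM).
Qed.

Definition esd n (M : 'M[R]_n.+1) : set (measurableTypeR R) -> \bar R :=
  mscale (n.+1%:R^-1)%:nng
    (msum (fun j => @dirac _ (measurableTypeR R) (nth 0 (eigenvalues M) j) R)
      n.+1).

HB.instance Definition _ n (M : 'M[R]_n.+1) := Measure.on (esd M).

Lemma esd_setT n (M : 'M[R]_n.+1) : esd M setT = 1%E.
Proof.
rewrite /esd /mscale /= /msum.
rewrite (eq_bigr (fun=> (1 : R)%:E)); last first.
  by move=> i _; exact: diracT.
by rewrite sumEFin sumr_const card_ord -EFinM mulVf ?pnatr_eq0.
Qed.

HB.instance Definition _ n (M : 'M[R]_n.+1) :=
  Measure_isProbability.Build _ _ _ (esd M) (esd_setT M).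

End esd.

(* Main.v *)
From HB Require Import structures.
Require Import Defs.
From mathcomp Require Import all_boot all_order all_algebra.
From mathcomp Require Import sesquilinear spectral.
From mathcomp Require Import all_classical all_reals all_analysis.
From mathcomp Require Import measurable_realfun complex.
From mathcomp Require Import ring lra zify.

(** Symmetric Toeplitz and Hankel matrices are link matrices: their entry
(i, j) is the input of index L i j, for a symmetric function L that takes each
value at most twice in a column. The whole argument is made for such matrices.

The hypothesis on the limit variable gives the limits m_k of the expected
moments of the spectral distributions, for independent standardized inputs with
bounded moments. It remains to find the law, to pass from expectations to almost
sure statements, and to remove the assumption on the moments.

The law. Since the m_k are the same for all inputs, they may be computed with
random signs, realized as binary digits on the unit interval (rademacher). The
trace of a power is a sum over closed words, and a word contributes only if each
edge value occurs an even number of times; counting these words gives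
m_(2k) <= (2k)! / k! (sign_trace_growth). With this growth, the Taylor
expansion of the cosine shows that a law with moments m_k is the only one
(moments_unique), and that convergence of moments to those of this law implies
convergence of the expectations of cosines (cvg_cos_moments). Existence
(moment_problem) follows from one realization of the matrices with converging
moments: the quantile functions of the eigenvalues have a limit along an
ultrafilter, and the law of this limit has moments m_k.

Almost sure convergence for finite-valued inputs. The variance of the trace is
a sum over pairs of words. A pair contributes only if the two words share an
edge value and no value occurs once, which costs one free letter. Hence the
variance of a normalized moment of a matrix of size n is of order 1 / n
(trace_variance), which is summable along the squares n = (j + 1)^2
(ae_link_moments).

General inputs. An input x is approximated by finite-valued standardized
transforms g(x), with E (x - g(x))^2 arbitrarily small
(standardized_approximation). By an argument of Hoffman and Wielandt, the
averages of a Lipschitz function over the spectra of two symmetric matrices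
differ by at most a function of their Frobenius distance (trace_comparison). For
the matrices with inputs x and g(x), this distance is controlled almost surely
by the upper half of the strong law of large numbers, which only requires second
moments (lln_upper). The same comparison, after completion by zero rows and
columns, relates an arbitrary size to the largest square below it. So the
averages of cosines converge for almost every realization; as the second
moments stay bounded, this implies weak convergence (weak_cvg_cos,
link_weak_cvg, iid_weak_cvg). *)

Set Implicit Arguments.
Unset Strict Implicit.
Unset Printing Implicit Defensive.

Import Order.TTheory GRing.Theory Num.Theory.
Import numFieldNormedType.Exports.

Local Open Scope classical_set_scope.
Local Open Scope ring_scope.


(** * Expectations of real functions *)

Section expectations.
Context {d : measure_display} {T : measurableType d} {R : realType}.
Variable P : probability T R.
Implicit Types (f g : T -> R) (c : R).

(** Integrability with respect to a probability, for functions with real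
values: with [Ex] it keeps the computations of expectations inside the real
numbers. *)
Definition integ f := P.-integrable setT (EFin \o f).
Definition Ex f : R := \int[P]_w f w.

Lemma integ_meas f : integ f -> measurable_fun setT f.
Proof. by move=> /integrableP[/measurable_EFinP]. Qed.

Lemma integ_cst c : integ (fun=> c).
Proof. exact: finite_measure_integrable_cst. Qed.

Lemma integD f g : integ f -> integ g -> integ (fun w => f w + g w).
Proof. by move=> h k; exact: (integrableD measurableT h k). Qed.

Lemma integB f g : integ f -> integ g -> integ (fun w => f w - g w).
Proof. by move=> h k; exact: (integrableB measurableT h k). Qed.

Lemma integZ c f : integ f -> integ (fun w => c * f w).
Proof. by move=> h; exact: (integrableZl measurableT c h). Qed.

Lemma integ_sum (I : Type) (s : seq I) (Q : pred I) (F : I -> T -> R) :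
  (forall i, Q i -> integ (F i)) -> integ (fun w => \sum_(i <- s | Q i) F i w).
Proof.
move=> iF; elim: s => [|i s IH].
  rewrite (_ : (fun w => _) = (fun=> 0)); first exact: integ_cst.
  by apply/funext => w; rewrite big_nil.
have [Qi|Qi] := boolP (Q i).
  rewrite (_ : (fun w => _) = (fun w => F i w + \sum_(i <- s | Q i) F i w)).
    by apply: integD => //; exact: iF.
  by apply/funext => w; rewrite big_cons Qi.
rewrite (_ : (fun w => _) = (fun w => \sum_(i <- s | Q i) F i w))//.
by apply/funext => w; rewrite big_cons (negbTE Qi).
Qed.

Lemma integ_le f g : measurable_fun setT f -> integ g ->
  (forall w, `|f w| <= g w) -> integ f.
Proof.
move=> mf ig fg; apply: (le_integrable measurableT _ _ ig).
  exact/measurable_EFinP.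
by move=> w _ /=; rewrite lee_fin (le_trans (fg w))// ler_norm.
Qed.

Lemma integ_bounded f c : measurable_fun setT f -> (forall w, `|f w| <= c) ->
  integ f.
Proof. by move=> mf fc; apply: (integ_le mf (integ_cst c)). Qed.

Lemma integ_norm f : integ f -> integ (fun w => `|f w|).
Proof. by move=> h; apply: integrable_norm. Qed.

Lemma Ex_cst c : Ex (fun=> c) = c.
Proof. by rewrite /Ex Rintegral_cst//= probability_setT /= mulr1. Qed.

Lemma ExD f g : integ f -> integ g -> Ex (fun w => f w + g w) = Ex f + Ex g.
Proof. by move=> ? ?; apply: RintegralD. Qed.

Lemma ExB f g : integ f -> integ g -> Ex (fun w => f w - g w) = Ex f - Ex g.
Proof. by move=> ? ?; apply: RintegralB. Qed.

Lemma ExZ c f : integ f -> Ex (fun w => c * f w) = c * Ex f.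
Proof. by move=> ?; apply: RintegralZl. Qed.

Lemma eq_Ex f g : f =1 g -> Ex f = Ex g.
Proof. by move=> fg; congr Ex; apply/funext. Qed.

Lemma Ex_sum (I : Type) (s : seq I) (Q : pred I) (F : I -> T -> R) :
  (forall i, Q i -> integ (F i)) ->
  Ex (fun w => \sum_(i <- s | Q i) F i w) = \sum_(i <- s | Q i) Ex (F i).
Proof.
move=> iF; elim: s => [|i s IH].
  by rewrite big_nil -[RHS](Ex_cst 0); apply: eq_Ex => w; rewrite big_nil.
rewrite big_cons; have [Qi|Qi] := boolP (Q i); last first.
  by rewrite -IH; apply: eq_Ex => w; rewrite big_cons (negbTE Qi).
rewrite -IH -ExD ?(iF i Qi)//; last exact: integ_sum.
by apply: eq_Ex => w; rewrite big_cons Qi.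
Qed.

Lemma Ex_le f g : integ f -> integ g -> (forall w, f w <= g w) -> Ex f <= Ex g.
Proof. by move=> ? ? fg; apply: le_Rintegral. Qed.

Lemma Ex_ge0 f : (forall w, 0 <= f w) -> 0 <= Ex f.
Proof. by move=> f0; apply: Rintegral_ge0. Qed.

Lemma Ex_norm_le f g : integ f -> integ g -> (forall w, `|f w| <= g w) ->
  `|Ex f| <= Ex g.
Proof.
move=> iF iG fg; apply: le_trans (le_normr_Rintegral measurableT iF) _.
by apply: Ex_le => //; exact: integ_norm.
Qed.

Lemma Ex_bounded f c : measurable_fun setT f -> (forall w, `|f w| <= c) ->
  `|Ex f| <= c.
Proof.
move=> mf fc; rewrite -[leRHS](Ex_cst c); apply: Ex_norm_le => //.
- exact: integ_bounded fc.
- exact: integ_cst.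
Qed.

Lemma ExE f : integ f -> (\int[P]_w (f w)%:E = (Ex f)%:E)%E.
Proof.
by move=> h; rewrite /Ex /Rintegral fineK//; exact: (integrable_fin_num measurableT).
Qed.

Lemma Ex_dominated (F : nat -> T -> R) f g :
  (forall n, measurable_fun setT (F n)) -> (forall w, F n w @[n --> \oo] --> f w) ->
  (forall n w, `|F n w| <= g w) -> integ g ->
  integ f /\ Ex (F n) @[n --> \oo] --> Ex f.
Proof.
move=> mF Ff Fg ig.
have mf : measurable_fun setT f.
  by apply: (@measurable_fun_cvg _ _ _ setT F f) => // w _; exact: Ff.
have [] := @dominated_convergence _ _ _ P setT measurableT
  (fun n => EFin \o F n) (EFin \o f) (EFin \o g).
- by move=> n; exact/measurable_EFinP.
- exact/measurable_EFinP.
- by apply: aeW => w _; apply: cvg_EFin; [exact: nearW|exact: Ff].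
- exact: ig.
- by apply: aeW => w n _ /=; rewrite lee_fin.
move=> jf _ cF; split=> //.
apply: fine_cvg; rewrite /Rintegral fineK//.
exact: (integrable_fin_num measurableT).
Qed.

(** Monotone convergence. The bound on the expectations is what makes the
limit integrable. *)
Lemma integ_monotone_limit (F : nat -> T -> R) f c :
  (forall n, integ (F n)) -> (forall n w, 0 <= F n w) ->
  (forall w, {homo F^~ w : m n / (m <= n)%N >-> m <= n}) ->
  (forall w, F n w @[n --> \oo] --> f w) -> (forall n, Ex (F n) <= c) ->
  integ f /\ Ex f <= c.
Proof.
move=> iF F0 Fm Ff Fc.
have f0 w : 0 <= f w.
  by apply: (cvgr_to_ge (Ff w)); apply: nearW => n.
have mf : measurable_fun setT f.
  apply: (@measurable_fun_cvg _ _ _ setT F f) => [n|w _]; last exact: Ff.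
  exact: integ_meas.
have := @cvg_monotone_convergence _ _ _ P setT measurableT (fun n => EFin \o F n).
have mF n : measurable_fun setT (EFin \o F n).
  by apply/measurable_EFinP; exact: integ_meas.
move=> /(_ mF) /(_ (fun n w _ => F0 n w)).
have nF w : setT w -> nondecreasing_seq (fun n => (EFin \o F n) w).
  by move=> _ m n mn; rewrite lee_fin; exact: Fm.
move=> /(_ nF).
have -> : (fun w => limn (fun n => (EFin \o F n) w)) = EFin \o f.
  apply/funext => w; apply/cvg_lim => //.
  by apply: cvg_EFin; [exact: nearW|exact: Ff].
move=> cI; have le_c : (\int[P]_w (EFin \o f) w <= c%:E)%E.
  apply: (cvge_to_le cI); apply: nearW => n.
  by rewrite (ExE (iF n)) lee_fin.
have jf : integ f.
  apply/integrableP; split; first exact/measurable_EFinP.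
  rewrite (eq_integral (EFin \o f)); first exact: le_lt_trans le_c (ltry _).
  by move=> w _ /=; rewrite ger0_norm.
by split=> //; rewrite -lee_fin -(ExE jf).
Qed.

End expectations.

(** * Approximation by polynomials in a sine *)

Section bernstein.
Variable R : realType.
Implicit Types (y c a b : R) (h : nat -> R).

(** De Casteljau recursion for the Bernstein polynomial of the values [h 0],
..., [h n]. The recursion replaces the binomial sums: the mean and the
variance of the binomial law come out by induction, see [bernstein_square]. *)
Fixpoint bernstein n h : {poly R} :=
  if n is m.+1 then
    (1 - 'X) * bernstein m h + 'X * bernstein m (fun k => h k.+1)
  else (h 0)%:P.

Lemma bernsteinS n h y : (bernstein n.+1 h).[y] =
  (1 - y) * (bernstein n h).[y] + y * (bernstein n (fun k => h k.+1)).[y].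
Proof. by rewrite /= !hornerE. Qed.

Lemma bernstein_cst n c y : (bernstein n (fun=> c)).[y] = c.
Proof.
elim: n => [|n IH]; first by rewrite /= hornerC.
by rewrite bernsteinS IH; ring.
Qed.

Lemma bernstein_lin n a b h1 h2 y :
  (bernstein n (fun k => a * h1 k + b * h2 k)).[y] =
  a * (bernstein n h1).[y] + b * (bernstein n h2).[y].
Proof.
elim: n h1 h2 => [|n IH] h1 h2; first by rewrite /= !hornerC.
by rewrite !bernsteinS !IH; ring.
Qed.

Lemma bernstein_le n h1 h2 y : 0 <= y <= 1 -> (forall k, h1 k <= h2 k) ->
  (bernstein n h1).[y] <= (bernstein n h2).[y].
Proof.
move=> /andP[y0 y1]; elim: n h1 h2 => [|n IH] h1 h2 h12.
  by rewrite /= !hornerC.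
rewrite !bernsteinS; apply: lerD; apply: ler_wpM2l; rewrite ?subr_ge0//.
- exact: IH.
- by apply: IH.
Qed.

(** This is the second moment of a binomial variable of parameters [n] and [y]
about [c]: the variance plus the square of the bias. The induction needs an
arbitrary [c] because the shift of the values moves it to [c - 1]. *)
Lemma bernstein_square n c y :
  (bernstein n (fun k => (k%:R - c) ^+ 2)).[y] =
  n%:R * y * (1 - y) + (n%:R * y - c) ^+ 2.
Proof.
elim: n c => [|n IH] c; first by rewrite /= hornerC; ring.
rewrite bernsteinS IH (_ : (fun k => _) = (fun k => (k%:R - (c - 1)) ^+ 2)).
  by rewrite IH -(natr1 n); ring.
by apply/funext => k; rewrite -natr1; ring.
Qed.

(** Chebyshev form of the theorem of Weierstrass: an error that grows like the
square of the distance to [n * y] is averaged into the binomial variance,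
which is at most [n]. *)
Lemma bernstein_approx n h (v e D : R) y : 0 <= y <= 1 -> 0 <= D ->
  (forall k, `|h k - v| <= e + D * (k%:R - n%:R * y) ^+ 2) ->
  `|(bernstein n h).[y] - v| <= e + D * n%:R.
Proof.
move=> y01 D0 hv; have /andP[y0 y1] := y01.
have var_le : D * (n%:R * y * (1 - y) + (n%:R * y - n%:R * y) ^+ 2) <= D * n%:R.
  by apply: ler_wpM2l => //; have : (0 : R) <= n%:R by []; nra.
have up : (bernstein n h).[y] <= v + e + D * n%:R.
  apply: le_trans (_ : (bernstein n (fun k =>
    1 * (v + e) + D * (k%:R - n%:R * y) ^+ 2)).[y] <= _).
    apply: bernstein_le => // k.
    by have := hv k; rewrite ler_norml => /andP[_]; lra.
  rewrite bernstein_lin bernstein_cst bernstein_square; lra.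
have lo : v - e - D * n%:R <= (bernstein n h).[y].
  apply: le_trans (_ : _ <= (bernstein n (fun k =>
    1 * (v - e) + (- D) * (k%:R - n%:R * y) ^+ 2)).[y]) _.
    rewrite bernstein_lin bernstein_cst bernstein_square; lra.
  apply: bernstein_le => // k.
  by have := hv k; rewrite ler_norml => /andP[+ _]; lra.
rewrite ler_norml; apply/andP; split; lra.
Qed.

Lemma bernstein_bound n h (M : R) y : 0 <= y <= 1 ->
  (forall k, `|h k| <= M) -> `|(bernstein n h).[y]| <= M.
Proof.
move=> y01 hM; rewrite ler_norml; apply/andP; split.
  rewrite -(bernstein_cst n (- M) y); apply: bernstein_le => // k.
  by have := hM k; rewrite ler_norml => /andP[].
rewrite -[leRHS](bernstein_cst n M y); apply: bernstein_le => // k.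
by have := hM k; rewrite ler_norml => /andP[].
Qed.

Lemma uniform_continuity01 (g : R -> R) (e : R) : continuous g -> 0 < e ->
  exists2 dl : R, 0 < dl & forall y z, 0 <= y <= 1 -> `|z - y| < dl ->
    `|g z - g y| <= e.
Proof.
move=> cg e0.
(* Uniform continuity on [[0, 1]], by compactness in the near-covering form,
the covering parameter being the modulus [dl]. *)
have := @segment_compact R 0 1 => /compact_near_coveringP.
move=> /(_ R (0:R)^'+ (fun dl y => forall z, `|z - y| < dl -> `|g z - g y| <= e)).
case.
  move=> y0 _; have /cvgr_dist_lt /(_ (e / 2)) := cg y0.
  rewrite divr_gt0// => /(_ isT) [r /= r0 hr].
  exists (ball y0 (r / 2), [set dl | 0 < dl < r / 2]) => /=.
    split; first by apply: nbhsx_ballx; rewrite divr_gt0.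
    exists (r / 2) => /=; first by rewrite divr_gt0.
    move=> t /=; rewrite sub0r normrN => tr t0; rewrite t0/=.
    by rewrite (le_lt_trans _ tr)// ler_norm.
  move=> [y dl] /= [y0y /andP[_ dlr]] z zy.
  have h1 := hr y; have h2 := hr z.
  have y0y' : `|y0 - y| < r / 2 by exact: y0y.
  have {}h1 : `|g y0 - g y| < e / 2 by apply: h1 => /=; lra.
  have {}h2 : `|g y0 - g z| < e / 2.
    apply: h2 => /=; rewrite (_ : y0 - z = (y0 - y) - (z - y)); last by ring.
    by apply: le_lt_trans (ler_normB _ _) _; lra.
  rewrite (_ : g z - g y = (g y0 - g y) - (g y0 - g z)); last by ring.
  by apply: le_trans (ler_normB _ _) _; lra.
move=> r /= r0 hr; exists (r / 2); first by rewrite divr_gt0.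
move=> y z y01 zy; have r20 : 0 < r / 2 by rewrite divr_gt0.
have := hr (r / 2); rewrite /ball_ /= sub0r normrN ger0_norm ?(ltW r20)//.
by apply=> //; rewrite ?in_itv//=; lra.
Qed.

(** A bounded continuous function becomes, on [[-L, L]], a continuous function
of [sin (c * x)] once [c] is so small that [c * x] stays where the sine is
injective; the theorem of Weierstrass then applies in the variable [(1 + sin
(c * x)) / 2] of [[0, 1]]. Outside the window both sides are bounded by [M],
and [x ^+ 2 / L ^+ 2] exceeds 1 there, so that a second moment controls the
error. *)
Lemma trig_approx (f : R -> R) (M L e : R) : continuous f ->
  (forall x, `|f x| <= M) -> 0 < L -> 0 < e ->
  exists (p : {poly R}) (c : R), forall x,
    `|f x - p.[sin (c * x)]| <= e + 2 * M * (x ^+ 2 / L ^+ 2).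
Proof.
move=> cf fM L0 e0.
have M0 : 0 <= M by apply: le_trans (fM 0).
have half : -1 < (2^-1 : R) < 1 by lra.
have a0 : 0 < asin (2^-1 : R).
  rewrite ltNge; apply/negP => a0.
  have : sin (asin (2^-1 : R)) <= 0.
    rewrite -oppr_ge0 -sinN; apply: sin_ge0_pi; rewrite oppr_ge0 a0/=.
    have := @asin_geNpi2 R 2^-1; rewrite (_ : -1 <= 2^-1 <= (1:R)); last lra.
    by move=> /(_ isT); have := pi_gt0 R; lra.
  by rewrite asinK ?in_itv/=; lra.
(* With this frequency [c * x] stays in [[- asin (1/2), asin (1/2)]] for [x]
in the window, so that [sin (c * x)] ranges in [[-1/2, 1/2]], the interval to
which [clip] restricts the argument of [asin]. *)
pose c := asin (2^-1 : R) / L.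
pose clip (y : R) := Num.max (- 2^-1) (Num.min 2^-1 (2 * y - 1)).
have clipP y : -1 < clip y < 1.
  have h1 : -1 < - (2^-1 : R) by lra.
  have h2 : - (2^-1 : R) < 1 by lra.
  have h3 : (2^-1 : R) < 1 by lra.
  by rewrite /clip lt_max gt_max gt_min h1 h2 h3.
pose g y := f (asin (clip y) / c).
have cg : continuous g.
  move=> y; apply: (@continuous_comp _ _ _ (fun y => asin (clip y) / c)); last exact: cf.
  apply: cvgM; last exact: cvg_cst.
  apply: (@continuous_comp _ _ _ clip); last exact: continuous_asin.
  apply: continuous_max; first exact: cvg_cst.
  apply: continuous_min; first exact: cvg_cst.
  apply: cvgB; last exact: cvg_cst.
  by apply: cvgM; [exact: cvg_cst|exact: cvg_id].
have c0 : 0 < c by rewrite divr_gt0.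
have gf x : `|x| <= L -> g ((1 + sin (c * x)) / 2) = f x.
  move=> xL; have cx : `|c * x| <= asin 2^-1.
    rewrite normrM (gtr0_norm c0) /c -mulrA ler_piMr ?(ltW a0)//.
    by rewrite mulrC ler_pdivrMr// mul1r.
  have apih : asin (2^-1 : R) <= pi / 2 by apply: asin_lepi2; lra.
  have cxi : c * x \in `[(- (pi / 2)), pi / 2].
    by move: cx; rewrite ler_norml in_itv/= => /andP[? ?]; apply/andP; split; lra.
  have smono (u v : R) : u \in `[(- (pi / 2)), pi / 2] ->
     v \in `[(- (pi / 2)), pi / 2] -> u <= v -> sin u <= sin v.
    by move=> ui vi; rewrite !le_eqVlt => /predU1P[->|uv]; rewrite ?eqxx// ltr_sin// uv orbT.
  have ai : asin (2^-1 : R) \in `[(- (pi / 2)), pi / 2].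
    by rewrite in_itv/= apih andbT; have := pi_gt0 R; lra.
  have aNi : - asin (2^-1 : R) \in `[(- (pi / 2)), pi / 2].
    by rewrite in_itv/= lerN2 apih /=; have := pi_gt0 R; lra.
  move: cx; rewrite ler_norml => /andP[cx1 cx2].
  have s1 := smono _ _ aNi cxi cx1; have s2 := smono _ _ cxi ai cx2.
  rewrite sinN !asinK ?in_itv/= in s1 s2; try lra.
  rewrite /g (_ : clip _ = sin (c * x)).
    by rewrite sinK// mulrC mulKf// gt_eqF.
  rewrite /clip (_ : 2 * _ - 1 = sin (c * x)); last by field.
  by rewrite min_r// max_r.
have [dl dl0 hdl] := uniform_continuity01 cg (divr_gt0 e0 (ltr0Sn R 1)).
have [N N0 n_gt] : exists2 N : nat, 0 < N%:R :> R & 2 * M / dl ^+ 2 / (e / 2) < N%:R.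
  exists (Num.truncn (2 * M / dl ^+ 2 / (e / 2))).+1; first by rewrite ltr0n.
  exact: truncnS_gt.
(* Beyond the distance [dl] the crude bound [2 * M] is below this multiple of
the squared distance. *)
pose D : R := 2 * M / (dl ^+ 2 * N%:R ^+ 2).
have D0 : 0 <= D.
  by apply: divr_ge0; [exact: mulr_ge0|apply: mulr_ge0; exact: sqr_ge0].
pose h k := g (k%:R / N%:R).
exists ((bernstein N h) \Po ((1 + 'X) * (2^-1)%:P)), c => x.
set y := (1 + sin (c * x)) / 2.
rewrite horner_comp (_ : (_ * _).[_] = y); last by rewrite !hornerE.
have y01 : 0 <= y <= 1.
  by rewrite /y; have := sin_geN1 (c * x); have := sin_le1 (c * x); lra.
have [xL|xL] := leP `|x| L.
  apply: (@le_trans _ _ e); last first.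
    by rewrite lerDl; apply: mulr_ge0; [exact: mulr_ge0|apply: divr_ge0; exact: sqr_ge0].
  rewrite -(gf x xL) -/y distrC.
  apply: le_trans (@bernstein_approx N h (g y) (e / 2) D y y01 D0 _) _.
    move=> k; have [kd|kd] := ltP `|k%:R / N%:R - y| dl.
      by apply: le_trans (hdl _ _ y01 kd) _; rewrite lerDl mulr_ge0// sqr_ge0.
    apply: (@le_trans _ _ (2 * M)).
      apply: le_trans (ler_normB _ _) _.
      by have := fM (asin (clip (k%:R / N%:R)) / c); have := fM (asin (clip y) / c);
         rewrite /h /g; lra.
    rewrite (_ : D * _ = 2 * M * ((k%:R / N%:R - y) ^+ 2 / dl ^+ 2)); last first.
      by rewrite /D; field; rewrite !gt_eqF.
    apply: (@le_trans _ _ (2 * M * ((k%:R / N%:R - y) ^+ 2 / dl ^+ 2))); last first.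
      by rewrite lerDr divr_ge0// ltW.
    rewrite ler_peMr ?mulr_ge0// ler_pdivlMr ?exprn_gt0// mul1r.
    by rewrite -(real_normK (num_real (_ - y))) lerXn2r ?nnegrE ?(ltW dl0).
  move: n_gt; rewrite ltr_pdivrMr ?divr_gt0// => n_gt.
  rewrite (_ : D * N%:R = 2 * M / dl ^+ 2 / N%:R); last first.
    by rewrite /D; field; rewrite !gt_eqF.
  suff : 2 * M / dl ^+ 2 / N%:R <= e / 2 by lra.
  by rewrite ler_pdivrMr// [leRHS]mulrC ltW.
apply: (@le_trans _ _ (2 * M)).
  apply: le_trans (ler_normB _ _) _.
  have h1 := fM x.
  have h2 : `|(bernstein N h).[y]| <= M.
    by apply: bernstein_bound => // k; rewrite /h /g.
  lra.
apply: (@le_trans _ _ (2 * M * (x ^+ 2 / L ^+ 2))); last by rewrite lerDr ltW.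
rewrite ler_peMr ?mulr_ge0// ler_pdivlMr ?exprn_gt0// mul1r.
by rewrite -(real_normK (num_real x)) lerXn2r ?nnegrE ?(ltW L0) ?(ltW xL).
Qed.

End bernstein.

(** * Weak convergence through cosines and moments *)

Section cosine_taylor.
Variable R : realType.

(** Mean value theorem for [C / m.+1 * t ^+ m.+1 - s * G t], which is
nondecreasing for both signs [s]. *)
Lemma antiderivative_bound_pos (G dG : R -> R) (C : R) m :
  (forall t : R, is_derive t 1 G (dG t)) -> G 0 = 0 ->
  (forall t, `|dG t| <= C * `|t| ^+ m) ->
  forall x, 0 <= x -> `|G x| <= C * x ^+ m.+1 / m.+1%:R.
Proof.
move=> dGE G0 dGb x x0.
have key (s : R) : s = 1 \/ s = -1 -> s * G x <= C * x ^+ m.+1 / m.+1%:R.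
  move=> s1; pose h := fun t : R => C / m.+1%:R * t ^+ m.+1 - s * G t.
  pose dh := fun t : R => C * t ^+ m - s * dG t.
  have hd (t : R) : is_derive t 1 h (dh t).
    pose p : {poly R} := (C / m.+1%:R)%:P * 'X^(m.+1).
    have dp : is_derive t 1 (horner p) (C * t ^+ m).
      suff -> : C * t ^+ m = p^`().[t] by exact: is_derive_poly.
      rewrite /p derivM derivC mul0r add0r derivXn !hornerE hornerMn !hornerE.
      rewrite -(mulr_natr (t ^+ _)) -pred_Sn; field.
      by rewrite nat1r pnatr_eq0.
    have -> : h = horner p - (s \*: G).
      by apply/funext => u; rewrite /h /p !fctE !hornerE.
    exact: (is_deriveB dp (is_deriveZ s (dGE t))).
  have ch : {within `[0, x], continuous h}.
    by apply: derivable_within_continuous => t _; have dht := hd t; exact: ex_derive.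
  have [c cx hc] := @MVT_segment R h dh 0 x x0 (fun t _ => hd t) ch.
  have : 0 <= h x - h 0.
    rewrite hc subr0 mulr_ge0// /dh; move: cx; rewrite in_itv/= => /andP[c0 _].
    have := dGb c; rewrite (ger0_norm c0) ler_norml => /andP[? ?].
    by case: s1 => ->; lra.
  by rewrite /h G0 expr0n !mulr0 !subr0 subr_ge0 mulrAC.
have := key 1 (or_introl erefl); have := key (-1) (or_intror erefl).
by rewrite mul1r mulN1r ler_norml lerNl => -> ->.
Qed.

Lemma antiderivative_bound (G dG : R -> R) (C : R) m :
  (forall t : R, is_derive t 1 G (dG t)) -> G 0 = 0 ->
  (forall t, `|dG t| <= C * `|t| ^+ m) ->
  forall x, `|G x| <= C * `|x| ^+ m.+1 / m.+1%:R.
Proof.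
move=> dGE G0 dGb x; have [x0|x0] := leP 0 x.
  by rewrite (ger0_norm x0); exact: antiderivative_bound_pos dGb _ x0.
rewrite -{1}(opprK x).
have dN (t : R) : is_derive t 1 (fun t => G (- t)) (- dG (- t)).
  have dg := dGE (- t).
  have dn : is_derive t 1 (fun t : R => - t) (-1).
    by apply: is_derive_eq.
  have := @is_derive1_comp R G (fun t : R => - t) t (dG (- t)) (-1) dg dn.
  by rewrite mulrN1.
rewrite (ltr0_norm x0).
apply: (@antiderivative_bound_pos (fun t => G (- t)) _ C m dN).
- by rewrite oppr0.
- by move=> t; rewrite normrN -(normrN t).
- by rewrite oppr_ge0 ltW.
Qed.

Definition antideriv (p : {poly R}) : {poly R} :=
  \poly_(i < (size p).+1) (p`_i.-1 / i%:R).

Lemma antiderivK p : (antideriv p)^`() = p.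
Proof.
apply/polyP => i; rewrite coef_deriv coef_poly ltnS.
have [ip|pi] := ltnP i (size p); last by rewrite nth_default// mul0rn.
by rewrite -pred_Sn -[LHS]mulr_natr divfK// pnatr_eq0.
Qed.

Lemma antideriv0 p : (antideriv p).[0] = 0.
Proof. by rewrite horner_coef0 coef_poly /= invr0 mulr0. Qed.

(** By induction on the order with a shifted phase: the derivative of [cos (a
* x + b)] is [a * cos (a * x + (b + pi / 2))], so the polynomial of the next
order is an antiderivative of the previous one. *)
Lemma cos_taylor (a b : R) m : exists p : {poly R}, forall x,
  `|cos (a * x + b) - p.[x]| <= `|a| ^+ m / m`!%:R * `|x| ^+ m.
Proof.
elim: m b => [|m IH] b.
  exists 0 => x; rewrite horner0 subr0 !expr0 fact0 divr1 mulr1.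
  exact: cos_max.
have [p hp] := IH (b + pi / 2).
exists ((cos b)%:P + a%:P * antideriv p) => x; rewrite !hornerE.
pose G t := cos (a * t + b) - (cos b + a * (antideriv p).[t]).
pose dG t := a * (cos (a * t + (b + pi / 2)) - p.[t]).
have hd (t : R) : is_derive t 1 G (dG t).
  have d1 : is_derive t 1 (fun t : R => a * t + b) a.
    by apply: is_derive_eq; rewrite /GRing.scale /=; ring.
  have d2 := @is_derive1_comp R cos (fun t : R => a * t + b) t _ _
     (is_derive_cos (a * t + b)) d1.
  have d3 : is_derive t 1 (horner (antideriv p)) p.[t].
    by rewrite -{2}(antiderivK p); apply: is_derive_poly.
  have -> : dG t = - sin (a * t + b) * a - (0 + a * p.[t]).
    by rewrite /dG addrA cosDpihalf; ring.
  rewrite /G; apply: is_derive_eq.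
  by rewrite /GRing.scale /=; ring.
have := @antiderivative_bound G dG (`|a| * (`|a| ^+ m / m`!%:R)) m hd.
have G0 : G 0 = 0 by rewrite /G mulr0 add0r antideriv0 mulr0 addr0 subrr.
move=> /(_ G0); have dGb t : `|dG t| <= `|a| * (`|a| ^+ m / m`!%:R) * `|t| ^+ m.
  by rewrite /dG normrM -mulrA ler_wpM2l.
move=> /(_ dGb) /(_ x) /le_trans; apply; rewrite le_eqVlt; apply/predU1P; left.
  rewrite factS natrM !exprS; field.
  by rewrite !pnatr_eq0 -lt0n fact_gt0 nat1r pnatr_eq0.
Qed.

End cosine_taylor.

Section weak_convergence.
Variable R : realType.
Local Notation law := (probability (measurableTypeR R) R).
Implicit Types (mus : nat -> law) (mu nu : law) (f g : R -> R).

Lemma continuous_measurableR f : continuous f ->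
  measurable_fun (setT : set (measurableTypeR R)) (f : measurableTypeR R -> R).
Proof. by move=> cf; exact: continuous_measurable_fun. Qed.

Lemma measurable_powR_nat k :
  measurable_fun (setT : set (measurableTypeR R)) (fun x : R => x ^+ k).
Proof. by apply: continuous_measurableR; exact: exprn_continuous. Qed.

Lemma cvg_ExD mus mu (a b : R) f g :
  (forall n, integ (mus n) f) -> (forall n, integ (mus n) g) ->
  integ mu f -> integ mu g ->
  Ex (mus n) f @[n --> \oo] --> Ex mu f ->
  Ex (mus n) g @[n --> \oo] --> Ex mu g ->
  Ex (mus n) (fun x => a * f x + b * g x) @[n --> \oo] -->
  Ex mu (fun x => a * f x + b * g x).
Proof.
move=> if_ ig_ if0 ig0 cf cg.
rewrite ExD ?ExZ//; [|exact: integZ|exact: integZ].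
rewrite (_ : (fun n => _) = (fun n => a * Ex (mus n) f + b * Ex (mus n) g)).
  by apply: cvgD; apply: cvgM => //; exact: cvg_cst.
by apply/funext => n; rewrite ExD ?ExZ//; exact: integZ.
Qed.

Lemma cvg_Ex_poly mus mu (g : R -> R) :
  (forall n k, integ (mus n) (fun x => g x ^+ k)) ->
  (forall k, integ mu (fun x => g x ^+ k)) ->
  (forall k, Ex (mus n) (fun x => g x ^+ k) @[n --> \oo] -->
             Ex mu (fun x => g x ^+ k)) ->
  forall p : {poly R}, Ex (mus n) (fun x => p.[g x]) @[n --> \oo] -->
             Ex mu (fun x => p.[g x]).
Proof.
move=> i_ i0 cg p.
have E nu : (forall k, integ nu (fun x => g x ^+ k)) ->
    Ex nu (fun x => p.[g x]) = \sum_(i < size p) p`_i * Ex nu (fun x => g x ^+ i).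
  move=> inu; rewrite (@eq_Ex _ _ _ nu _ (fun x => \sum_(i < size p) p`_i * g x ^+ i)).
    rewrite Ex_sum; last by move=> i _; exact: integZ.
    by apply: eq_bigr => i _; rewrite ExZ.
  by move=> x; rewrite horner_coef.
rewrite E// (_ : (fun n => _) =
   (fun n => \sum_(i < size p) p`_i * Ex (mus n) (fun x => g x ^+ i))).
  apply: cvg_big => [|i _]; first exact: add_continuous.
  by apply: cvgM => //; exact: cvg_cst.
by apply/funext => n; rewrite E.
Qed.

Lemma measurable_cos_affine (a b : R) :
  measurable_fun (setT : set (measurableTypeR R)) (fun x => cos (a * x + b)).
Proof.
apply: continuous_measurableR => x.
apply: (@continuous_comp _ _ _ (fun x => a * x + b)); last exact: continuous_cos.
apply: cvgD; last exact: cvg_cst.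
by apply: cvgM; [exact: cvg_cst|exact: cvg_id].
Qed.

Lemma measurable_sin_linear (c : R) :
  measurable_fun (setT : set (measurableTypeR R)) (fun x => sin (c * x)).
Proof.
have -> : (fun x : R => sin (c * x)) = (fun x => cos (c * x + - (pi / 2))).
  by apply/funext => x; rewrite cosBpihalf.
exact: measurable_cos_affine.
Qed.

Lemma integ_cos_sin (nu : law) (a b c : R) k :
  integ nu (fun x => cos (a * x + b) * sin (c * x) ^+ k).
Proof.
apply: (@integ_bounded _ _ _ _ _ 1).
  apply: measurable_funM; first exact: measurable_cos_affine.
  by apply: measurable_funX; exact: measurable_sin_linear.
move=> x; rewrite normrM -[leRHS]mulr1; apply: ler_pM => //.
  exact: cos_max.
by rewrite normrX exprn_ile1// sin_max.
Qed.

(** Convergence of characteristic functions, in real form: the real and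
imaginary parts correspond to the phases [b = 0] and [b = - pi / 2]. *)
Definition cvg_cos mus mu := forall a b : R,
  Ex (mus n) (fun x => cos (a * x + b)) @[n --> \oo] -->
  Ex mu (fun x => cos (a * x + b)).

(** Product formulas turn a factor [sin (c * x)] into two cosines with other
frequencies, so the statement for all frequencies is stable under
multiplication by a sine. *)
Lemma cvg_cos_sinX mus mu : cvg_cos mus mu -> forall k (a b c : R),
  Ex (mus n) (fun x => cos (a * x + b) * sin (c * x) ^+ k) @[n --> \oo] -->
  Ex mu (fun x => cos (a * x + b) * sin (c * x) ^+ k).
Proof.
move=> cc; elim=> [|k IH] a b c.
  rewrite (_ : (fun x => _) = (fun x => cos (a * x + b))).
    exact: cc.
  by apply/funext => x; rewrite expr0 mulr1.
have E : (fun x => cos (a * x + b) * sin (c * x) ^+ k.+1) =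
  (fun x => 2^-1 * (cos ((a + c) * x + (b - pi / 2)) * sin (c * x) ^+ k)
        + (- 2^-1) * (cos ((a - c) * x + (b - pi / 2)) * sin (c * x) ^+ k)).
  apply/funext => x; rewrite !addrA !cosBpihalf exprS.
  rewrite (_ : (a + c) * x + b = (a * x + b) + c * x); last by ring.
  rewrite (_ : (a - c) * x + b = (a * x + b) - c * x); last by ring.
  by rewrite sinD sinB; field.
rewrite E; apply: cvg_ExD => //; move=> *; exact: integ_cos_sin.
Qed.

Lemma cvg_cos_trigpoly mus mu : cvg_cos mus mu -> forall (p : {poly R}) c,
  Ex (mus n) (fun x => p.[sin (c * x)]) @[n --> \oo] -->
  Ex mu (fun x => p.[sin (c * x)]).
Proof.
move=> cc p c.
have E k : (fun x => sin (c * x) ^+ k) =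
     (fun x => cos (0 * x + 0) * sin (c * x) ^+ k).
  by apply/funext => x; rewrite mul0r addr0 cos0 mul1r.
apply: cvg_Ex_poly => *; rewrite E; try exact: integ_cos_sin.
exact: cvg_cos_sinX.
Qed.

(** Continuity theorem: cosines control the polynomials in [sin (c * x)],
these approximate a bounded continuous function up to a multiple of [x ^+ 2],
and the second moments are bounded. *)
Lemma weak_cvg_cos mus mu (C : R) : cvg_cos mus mu ->
  (\forall n \near \oo, integ (mus n) (fun x => x ^+ 2) /\
                        Ex (mus n) (fun x => x ^+ 2) <= C) ->
  integ mu (fun x => x ^+ 2) -> weak_cvg mus mu.
Proof.
move=> cc bnd i2 f cf [M0 fM0].
pose M : R := `|M0| + 1; have M_gt0 : 0 < M by rewrite ltr_wpDl.
have fM x : `|f x| <= M.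
  by rewrite (le_trans (fM0 x))// /M (le_trans (ler_norm _))// lerDl.
pose C' := `|C| + `|Ex mu (fun x => x ^+ 2)|.
have C'0 : 0 <= C' by rewrite addr_ge0.
apply/cvgrPdist_lt => eps eps0; pose e := eps / 6.
have e0 : 0 < e by rewrite divr_gt0.
(* The window is so large that the tail term [2 * M * C' / L ^+ 2] is at most
[e]. *)
pose L := 1 + 2 * M * C' / e.
have MC : 0 <= 2 * M * C' / e by rewrite divr_ge0 ?(ltW e0)// !mulr_ge0// ltW.
have L1 : 1 <= L by rewrite lerDl.
have L0 : 0 < L by lra.
have [p [c fp]] := trig_approx cf fM L0 e0.
have tail (nu : law) : integ nu (fun x => x ^+ 2) ->
    Ex nu (fun x => x ^+ 2) <= C' ->
    `|Ex nu f - Ex nu (fun x => p.[sin (c * x)])| <= 2 * e.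
  move=> iX XC.
  have mf := continuous_measurableR cf.
  have jf : integ nu f by exact: integ_bounded mf fM.
  have jp : integ nu (fun x => p.[sin (c * x)]).
    rewrite (_ : (fun x => _) = (fun x => \sum_(i < size p) p`_i * sin (c * x) ^+ i)).
      apply: integ_sum => i _; apply: integZ.
      apply: (@integ_bounded _ _ _ _ _ 1).
        by apply: measurable_funX; exact: measurable_sin_linear.
      by move=> x; rewrite normrX exprn_ile1// sin_max.
    by apply/funext => x; rewrite horner_coef.
  have jX : integ nu (fun x => e + 2 * M / L ^+ 2 * x ^+ 2).
    by apply: integD; [exact: integ_cst|exact: integZ].
  rewrite -ExB//; apply: (@le_trans _ _ (Ex nu (fun x => e + 2 * M / L ^+ 2 * x ^+ 2))).
    apply: Ex_norm_le => //; first exact: integB.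
    move=> x; have -> : 2 * M / L ^+ 2 * x ^+ 2 = 2 * M * (x ^+ 2 / L ^+ 2).
      by ring.
    exact: fp.
  rewrite ExD ?ExZ//; try exact: integ_cst; try exact: integZ.
  rewrite Ex_cst (_ : 2 * e = e + e); last by ring.
  rewrite lerD2l; apply: (@le_trans _ _ (2 * M / L ^+ 2 * C')).
    by apply: ler_wpM2l => //; rewrite divr_ge0 ?sqr_ge0// mulr_ge0// ltW.
  rewrite mulrAC ler_pdivrMr ?exprn_gt0// -ler_pdivrMl//.
  apply: (@le_trans _ _ L); first by rewrite /L mulrC lerDr.
  by rewrite expr2 ler_peMr// ltW.
have cp := @cvg_cos_trigpoly mus mu cc p c.
move/cvgrPdist_lt : cp => /(_ _ e0) near_p.
near=> n.
have [inX XC] : integ (mus n) (fun x => x ^+ 2) /\ Ex (mus n) (fun x => x ^+ 2) <= C.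
  by near: n.
have t1 := tail (mus n) inX.
have t2 := tail mu i2.
have CC' : C <= C' by rewrite /C' (le_trans (ler_norm _))// lerDl.
have {}t1 := t1 (le_trans XC CC').
have {}t2 : `|Ex mu f - Ex mu (fun x => p.[sin (c * x)])| <= 2 * e.
  by apply: t2; rewrite /C' (le_trans (ler_norm _))// lerDr.
have t3 : `|Ex mu (fun x => p.[sin (c * x)]) - Ex (mus n) (fun x => p.[sin (c * x)])| < e.
  by near: n.
rewrite -/(Ex _ _) -/(Ex _ _).
move: t1 t2 t3; rewrite /e !ltr_norml !ler_norml => /andP[? ?] /andP[? ?] /andP[? ?].
by apply/andP; split; lra.
Unshelve. all: by end_near. Qed.

(** Taylor expansion of the cosine at order [2 * k]. The remainder has mean at
most [a ^+ (2 * k) / (2 * k)!] times the moment of order [2 * k], hence at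
most [(a ^+ 2) ^+ k / k!], the general term of a convergent series: this is
where the growth of the moments is used. *)
Lemma cvg_cos_moments mus mu :
  (forall n k, integ (mus n) (fun x => x ^+ k)) ->
  (forall k, integ mu (fun x => x ^+ k)) ->
  (forall k, Ex (mus n) (fun x => x ^+ k) @[n --> \oo] --> Ex mu (fun x => x ^+ k)) ->
  (forall k, Ex mu (fun x => x ^+ (2 * k)) <= (2 * k)`!%:R / k`!%:R) ->
  cvg_cos mus mu.
Proof.
move=> i_ i0 cm growth a b; apply/cvgrPdist_lt => e e0.
have [k ak] : exists k : nat, (a ^+ 2) ^+ k / k`!%:R < e / 4.
  have := cvg_series_cvg_0 (is_cvg_series_exp_coeff (a ^+ 2)).
  move=> /cvgrPdist_lt /(_ (e / 4)); rewrite divr_gt0// => /(_ isT) [N _ hN].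
  exists N; have := hN N (leqnn N).
  rewrite sub0r normrN /exp_coeff/=.
  by apply: le_lt_trans; exact: ler_norm.
pose K : R := (a ^+ 2) ^+ k / (2 * k)`!%:R.
have K0 : 0 <= K by rewrite divr_ge0// exprn_ge0// sqr_ge0.
have [p hp] := cos_taylor a b (2 * k).
have {}hp x : `|cos (a * x + b) - p.[x]| <= K * x ^+ (2 * k).
  apply: le_trans (hp x) _; rewrite /K !exprM !real_normK ?num_real//.
have tail (nu : law) : (forall k, integ nu (fun x => x ^+ k)) ->
    `|Ex nu (fun x => cos (a * x + b)) - Ex nu (fun x => p.[x])| <=
    K * Ex nu (fun x => x ^+ (2 * k)).
  move=> inu.
  have jc : integ nu (fun x => cos (a * x + b)).
    apply: (@integ_bounded _ _ _ _ _ 1); first exact: measurable_cos_affine.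
    by move=> x; exact: cos_max.
  have jp : integ nu (fun x => p.[x]).
    rewrite (_ : (fun x => _) = (fun x => \sum_(i < size p) p`_i * x ^+ i)).
      by apply: integ_sum => i _; exact: integZ.
    by apply/funext => x; rewrite horner_coef.
  rewrite -ExB// -ExZ//; apply: Ex_norm_le => //; first exact: integB.
  exact: integZ.
have Kg : K * ((2 * k)`!%:R / k`!%:R) < e / 4.
  suff -> : K * ((2 * k)`!%:R / k`!%:R) = (a ^+ 2) ^+ k / k`!%:R by [].
  by rewrite /K; field; rewrite !pnatr_eq0 -!lt0n !fact_gt0.
have t2 : K * Ex mu (fun x => x ^+ (2 * k)) < e / 4.
  by apply: le_lt_trans Kg; exact: ler_wpM2l.
have cp := @cvg_Ex_poly mus mu id i_ i0 cm p.
have cK : K * Ex (mus n) (fun x => x ^+ (2 * k)) @[n --> \oo] -->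
     K * Ex mu (fun x => x ^+ (2 * k)).
  by apply: cvgM; [exact: cvg_cst|exact: cm].
have e4 : 0 < e / 4 by rewrite divr_gt0.
move/cvgrPdist_lt : cp => /(_ _ e4) near_p.
have near_K : \forall n \near \oo, K * Ex (mus n) (fun x => x ^+ (2 * k)) < e / 4.
  exact: (cvgr_lt _ cK).
near=> n.
have h1 := tail _ (i_ n); have h2 := tail _ i0.
have h3 : `|Ex mu (fun x => p.[x]) - Ex (mus n) (fun x => p.[x])| < e / 4 by near: n.
have h4 : K * Ex (mus n) (fun x => x ^+ (2 * k)) < e / 4 by near: n.
move: h1 h2 h3 h4; rewrite !ltr_norml !ler_norml => /andP[? ?] /andP[? ?] /andP[? ?] ?.
by apply/andP; split; lra.
Unshelve. all: by end_near. Qed.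

End weak_convergence.

(** * Uniqueness in the moment problem *)

Section uniqueness.
Variable R : realType.
Local Notation law := (probability (measurableTypeR R) R).

(** Continuous functions that increase to the indicator of an open ray. *)
Definition ramp (a : R) (k : nat) (x : R) := Num.min 1 (Num.max 0 (k%:R * (x - a))).

Lemma ramp01 a k x : 0 <= ramp a k x <= 1.
Proof. by rewrite /ramp le_min ler01 le_max lexx /= ge_min lexx. Qed.

Lemma continuous_ramp a k : continuous (ramp a k).
Proof.
move=> x; have : {for x, continuous (ramp a k)}; last by []; rewrite /ramp;
  apply: continuous_min; first exact: cvg_cst.
apply: continuous_max; first exact: cvg_cst.
apply: cvgM; first exact: cvg_cst.
by apply: cvgB; [exact: cvg_id|exact: cvg_cst].
Qed.

Lemma cvg_ramp a x : ramp a k x @[k --> \oo] --> (\1_`]a, +oo[ x : R).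
Proof.
have [ax|xa] := ltP a x; last first.
  rewrite indicE memNset; last by rewrite /= in_itv/= andbT; apply/negP; rewrite -leNgt.
  rewrite (_ : (fun k => _) = (fun=> 0)); first exact: cvg_cst.
  apply/funext => k; rewrite /ramp max_l ?min_r//.
  by rewrite mulr_ge0_le0// subr_le0.
rewrite indicE mem_set; last by rewrite /= in_itv/= ax.
apply: cvg_near_cst; exists (Num.truncn (x - a)^-1).+1 => // k /= kn.
rewrite /ramp min_l// le_max; apply/orP; right.
rewrite -ler_pdivrMr ?subr_gt0// div1r.
apply: (@le_trans _ _ (Num.truncn (x - a)^-1).+1%:R); last by rewrite ler_nat.
by apply/ltW; exact: truncnS_gt.
Qed.

(** Ramps give the same mass to open rays, and open rays form a pi-system that
generates the Borel sets. *)
Lemma law_eq_continuous (mu nu : law) :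
  (forall f : R -> R, continuous f -> (forall x, `|f x| <= 1) -> Ex nu f = Ex mu f) ->
  forall B, measurable B -> nu B = mu B.
Proof.
move=> E B mB.
have Eray a : nu `]a, +oo[%classic = mu `]a, +oo[%classic.
  have cvg_ray (la : law) : Ex la (ramp a k) @[k --> \oo] --> fine (la `]a, +oo[%classic).
    have [|||| _] := @Ex_dominated _ _ _ la (ramp a) (\1_`]a, +oo[) (fun=> 1).
    - by move=> n; apply: continuous_measurableR; exact: continuous_ramp.
    - by move=> x; exact: cvg_ramp.
    - by move=> n x; have /andP[r0 r1] := ramp01 a n x; rewrite ger0_norm.
    - exact: integ_cst.
    suff -> : Ex la \1_`]a, +oo[ = fine (la `]a, +oo[%classic) by [].
    by rewrite /Ex /Rintegral integral_indic// setIT.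
  have h := cvg_ray nu; have h' := cvg_ray mu.
  have EE : (fun k => Ex nu (ramp a k)) = (fun k => Ex mu (ramp a k)).
    apply/funext => k; apply: E; first exact: continuous_ramp.
    by move=> x; have /andP[r0 r1] := ramp01 a k x; rewrite ger0_norm.
  rewrite EE in h.
  have e : fine (nu `]a, +oo[%classic) = fine (mu `]a, +oo[%classic).
    by apply: (cvg_unique _ h h'); exact: Rhausdorff.
  by rewrite -[LHS]fineK ?fin_num_measure// e fineK ?fin_num_measure.
apply: (@measure_unique _ R (measurableTypeR R) (@RGenOInfty.G R) (fun n => `](- n%:R), +oo[%classic)) => //.
- by rewrite RGenOInfty.measurableE.
- move=> _ _ [a ->] [b ->]; exists (Num.max a b).
  rewrite predeqE => x /=; rewrite !in_itv/= !andbT gt_max.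
  by split=> [[-> ->]//|/andP[]].
- by move=> n; exists (- n%:R).
- rewrite -subTset => x _; exists (Num.truncn `|x|).+1 => //=.
  rewrite in_itv/= andbT ltrNl; apply: le_lt_trans (truncnS_gt _).
  by rewrite -normrN ler_norm.
- by move=> _ [a ->]; exact: Eray.
- by move=> n; rewrite -ge0_fin_numE// fin_num_measure.
Qed.

(** The constant sequence [nu] has moments that converge to those of [mu],
hence converges weakly to [mu]. *)
Lemma moments_unique (mu nu : law) :
  (forall k, integ mu (fun x => x ^+ k)) -> (forall k, integ nu (fun x => x ^+ k)) ->
  (forall k, Ex nu (fun x => x ^+ k) = Ex mu (fun x => x ^+ k)) ->
  (forall k, Ex mu (fun x => x ^+ (2 * k)) <= (2 * k)`!%:R / k`!%:R) ->
  forall B, measurable B -> nu B = mu B.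
Proof.
move=> imu inu E growth; apply: law_eq_continuous => f cf f1.
have cc : cvg_cos (fun=> nu) mu.
  apply: cvg_cos_moments => // k.
  by rewrite (_ : (fun n => _) = fun=> Ex mu (fun x => x ^+ k));
     [exact: cvg_cst|apply/funext].
have nb : \forall n \near \oo, integ ((fun=> nu) n) (fun x => x ^+ 2) /\
    Ex ((fun=> nu) n) (fun x => x ^+ 2) <= Ex nu (fun x => x ^+ 2).
  by apply: nearW => _; split.
have h := weak_cvg_cos cc nb (imu 2%N) cf (ex_intro _ 1 f1).
by apply: (cvg_unique _ (cvg_cst _) h); exact: Rhausdorff.
Qed.

End uniqueness.

(** * Riemann sums on the unit interval *)

Section monotone_riemann.
Variable R : realType.
Local Notation V := (measurableTypeR R).
Definition U01 : probability V R := uniform_prob (@ltr01 R).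

Lemma uniform_itv (a b : R) : 0 <= a -> a <= b -> b <= 1 ->
  U01 `[a, b[%classic = (b - a)%:E.
Proof.
move=> a0 ab b1; rewrite /U01 /= /uniform_prob integral_uniform_pdf.
rewrite (eq_integral (fun=> 1%E)).
  rewrite integral_cst//=; last by apply: measurableI.
  rewrite mul1e (_ : _ `&` _ = `[a, b[%classic).
    by rewrite lebesgue_measure_itv/= lte_fin; case: ltP => //; 
      case: (ltgtP a b) ab => // -> _; rewrite subrr.
  rewrite predeqE => x /=; rewrite !in_itv/=; split=> [[]//|/andP[ax xb]].
  by rewrite ax xb; split=> //; apply/andP; split; lra.
move=> x; rewrite inE /= !in_itv/= => -[_ x01].
by rewrite /uniform_pdf x01 subr0 invr1.
Qed.

Lemma monotone_measurable (h : R -> R) :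
  {in `]0, 1[ &, {homo h : x y / x <= y}} -> measurable_fun (`]0, 1[%classic : set V) (h : V -> R).
Proof.
move=> hh; apply: (measurability (@RGenCInfty.G R)) => [|/= _ [_] [r] -> <-].
  exact: RGenCInfty.measurableE.
 apply: is_interval_measurable.
move=> x y /= [x01 hx] [y01 hy] z /andP[xz zy].
have z01 : z \in `]0, 1[.
  by move: x01 y01; rewrite !in_itv/= => /andP[x0 _] /andP[_ y1]; apply/andP; split; lra.
split=> //; move: hx; rewrite !in_itv/= !andbT => hx.
exact: le_trans hx (hh _ _ x01 z01 xz).
Qed.

(** Quantile functions are monotone on the open unit interval only; the
extension by 0 turns them into total measurable functions. *)
Definition on01 (h : R -> R) t := if (0 < t < 1) then h t else 0.

Lemma measurable_on01 (h : R -> R) :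
  measurable_fun (`]0, 1[%classic : set V) (h : V -> R) -> measurable_fun (setT : set V) (on01 h : V -> R).
Proof.
move=> mh; rewrite (_ : on01 h = h \_ `]0, 1[).
  by apply/(measurable_restrictT _ _).1.
apply/funext => t; rewrite patchE /on01.
by case: ifPn => t01; [rewrite mem_set//= in_itv|
  rewrite memNset//= in_itv/=; exact/negP].
Qed.

(** On a cell of length [1 / n] a monotone function oscillates by the
difference of its values at the end points, and these differences telescope.
The first and the last cell touch the end points, where monotonicity may fail:
their oscillation is bounded by [2 * M]. *)
Lemma monotone_riemann (h : R -> R) (M : R) n : (0 < n)%N ->
  {in `]0, 1[ &, {homo h : x y / x <= y}} -> (forall t, `|h t| <= M) ->
  `|Ex U01 (on01 h) - n%:R^-1 * \sum_(i < n) on01 h (i%:R / n%:R)| <= 6 * M / n%:R.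
Proof.
move=> n0 hh hM; have M0 : 0 <= M by apply: le_trans (hM 0).
have nR0 : 0 < n%:R :> R by rewrite ltr0n.
have gM t : `|on01 h t| <= M by rewrite /on01; case: ifP => // _; rewrite normr0.
pose I (i : nat) : set V := `[i%:R / n%:R, i.+1%:R / n%:R[%classic.
have mI i : measurable (I i) by exact: measurable_itv.
have iI i : integ U01 (\1_(I i)).
  apply: (@integ_bounded _ _ _ _ _ 1); first exact: measurable_indic.
  by move=> x; rewrite indicE; case: (_ \in _); rewrite ?normr1 ?normr0.
have EI (i : 'I_n) : Ex U01 (\1_(I i)) = n%:R^-1.
  rewrite /Ex /Rintegral integral_indic// setIT.
  apply: (etrans (congr1 fine (uniform_itv _ _ _))) => /=.
  - by rewrite divr_ge0.
  - by rewrite ler_pM2r ?invr_gt0// ler_nat.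
  - by rewrite ler_pdivrMr// mul1r ler_nat.
  - by rewrite -mulrBl -natrB// subSnn mul1r.
pose D (i : nat) : R := if (i == 0)%N || (i.+1 == n)%N then 2 * M
   else on01 h (i.+1%:R / n%:R) - on01 h (i%:R / n%:R).
have DE (i : nat) : (i < n)%N -> ((i == 0%N) || (i.+1 == n)) = false ->
   ((i%:R / n%:R : R) \in `]0, 1[%R) /\ ((i.+1%:R / n%:R : R) \in `]0, 1[%R).
  move=> i_n /negbT; rewrite negb_or => /andP[i0 iSn].
  split; rewrite in_itv/=; apply/andP; split.
  - by rewrite divr_gt0// ltr0n lt0n.
  - by rewrite ltr_pdivrMr// mul1r ltr_nat.
  - by rewrite divr_gt0.
  - by rewrite ltr_pdivrMr// mul1r ltr_nat ltn_neqAle iSn.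
have onE t : t \in `]0, 1[ -> on01 h t = h t by rewrite in_itv/= /on01 => ->.
have D0 (i : 'I_n) : 0 <= D i.
  rewrite /D; case: ifPn => [_|/negbTE/(DE _ (ltn_ord i))[i1 i2]]; first lra.
  rewrite !onE// subr_ge0; apply: hh => //.
  by rewrite ler_pM2r ?invr_gt0// ler_nat.
have Dsum : \sum_(i < n) D i <= 6 * M.
  have key m : (m <= n)%N -> \sum_(i < m) D i <=
     (if (m == 0)%N then 0 else if m == n then 6 * M else
       3 * M + (on01 h (m%:R / n%:R))).
    elim: m => [_|m IH mn]; first by rewrite big_ord0.
    rewrite big_ord_recr /=; have {IH} := IH (ltnW mn).
    have g1 := gM (m%:R / n%:R); have g2 := gM (m.+1%:R / n%:R).
    move: g1 g2; rewrite !ler_norml => /andP[? ?] /andP[? ?].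
    rewrite [D m]/D; case: (m =P 0%N) => _ /=; first by case: (m.+1 =P n) => _; lra.
    by rewrite (ltn_eqF mn); case: (m.+1 =P n) => _; lra.
  have := key n (leqnn n); rewrite eqxx; case: eqP => [n00|//] _.
  by rewrite n00 in n0.
pose S t := \sum_(i < n) on01 h (i%:R / n%:R) * \1_(I i) t.
pose E t := \sum_(i < n) D i * \1_(I i) t.
have iS : integ U01 S by apply: integ_sum => i _; exact: integZ.
have iE : integ U01 E by apply: integ_sum => i _; exact: integZ.
have ih : integ U01 (on01 h).
  apply: (@integ_bounded _ _ _ _ _ M); last exact: gM.
  have mh := monotone_measurable hh.
  have mo := measurable_on01 mh.
  exact: mo.
have ES : Ex U01 S = n%:R^-1 * \sum_(i < n) on01 h (i%:R / n%:R).
  rewrite Ex_sum; last by move=> i _; exact: integZ.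
  by rewrite mulr_sumr; apply: eq_bigr => i _; rewrite ExZ// EI mulrC.
have EE : Ex U01 E = n%:R^-1 * \sum_(i < n) D i.
  rewrite Ex_sum; last by move=> i _; exact: integZ.
  by rewrite mulr_sumr; apply: eq_bigr => i _; rewrite ExZ// EI mulrC.
rewrite -ES -ExB//; apply: (@le_trans _ _ (Ex U01 E)); last first.
  by rewrite EE mulrC ler_pM2r ?invr_gt0.
apply: Ex_norm_le => //; first exact: integB.
move=> t; have [t01|t01] := boolP (0 <= t < 1); last first.
  have z (i : 'I_n) : \1_(I i) t = 0 :> R.
    rewrite indicE memNset// /I /= in_itv/= => /andP[t1 t2].
    case/negP: t01; apply/andP; split; first by apply: le_trans t1; rewrite divr_ge0.
    by apply: lt_le_trans t2 _; rewrite ler_pdivrMr// mul1r ler_nat.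
  rewrite /S /E !big1 => [|i _|i _]; try by rewrite z mulr0.
  rewrite /on01 ifF ?subrr ?normr0//; apply/negbTE; apply: contra t01 => /andP[t0 t1].
  by rewrite (ltW t0) t1.
have /andP[t0 t1] := t01.
have nt0 : 0 <= n%:R * t by rewrite mulr_ge0.
have jn : (Num.truncn (n%:R * t) < n)%N by rewrite truncn_lt_nat// gtr_pMr.
pose j := Ordinal jn.
have /andP[j1 j2] := truncn_itv nt0.
have one (i : 'I_n) : \1_(I i) t = (i == j)%:R :> R.
  rewrite indicE; congr (_%:R); apply: congr1.
  apply/idP/eqP.
    rewrite inE /I /= in_itv/= ler_pdivrMr// ltr_pdivlMr// ![t * _]mulrC => it.
    by apply/val_inj => /=; apply/esym/truncn_def.
  move=> ->; rewrite inE /I /= in_itv/= ler_pdivrMr// ltr_pdivlMr// ![t * _]mulrC.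
  by rewrite j1 j2.
have pick (F : nat -> R) : \sum_(i < n) F i * \1_(I i) t = F j.
  rewrite (bigD1 j) // one eqxx mulr1 big1; first exact: addr0.
  by move=> i /andP[_ ij]; rewrite one (negbTE ij) mulr0.
rewrite /S /E (pick (fun i => on01 h (i%:R / n%:R))) pick.
have tj1 : j%:R / n%:R <= t by rewrite ler_pdivrMr// mulrC.
have tj2 : t <= j.+1%:R / n%:R by rewrite ler_pdivlMr// mulrC ltW.
rewrite /D; case: ifPn => [_|/negbTE/(DE _ jn)[i1 i2]].
  apply: le_trans (ler_normB _ _) _; have := gM t; have := gM (j%:R / n%:R); lra.
have tin : t \in `]0, 1[.
  by move: i1 i2; rewrite !in_itv/= => /andP[? ?] /andP[? ?]; apply/andP; split; lra.
rewrite !onE// ger0_norm ?subr_ge0; last exact: hh.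
by rewrite lerD2r; exact: hh.
Qed.

End monotone_riemann.

(** * Quantile functions of finite samples *)

Section quantiles.
Variable R : realType.
Local Notation V := (measurableTypeR R).
Implicit Types (l : seq R) (g : R -> R) (t : R).

Definition avg l g := (size l)%:R^-1 * \sum_(x <- l) g x.

(** The generalized inverse of the distribution function of the sample [l],
for [t] in the open unit interval. *)
Definition quantile l t := nth 0 (sort <=%O l) (Num.truncn ((size l)%:R * t)).

Lemma avg_le l g1 g2 : (forall x, g1 x <= g2 x) -> avg l g1 <= avg l g2.
Proof. by move=> g12; rewrite ler_wpM2l ?invr_ge0//; apply: ler_sum => i _. Qed.

Lemma avgD l (a b : R) g1 g2 :
  avg l (fun x => a * g1 x + b * g2 x) = a * avg l g1 + b * avg l g2.
Proof.
rewrite /avg big_split/= mulrDr -!mulr_sumr; ring.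
Qed.

Lemma avg_norm l g : `|avg l g| <= avg l (fun x => `|g x|).
Proof.
rewrite normrM ger0_norm ?invr_ge0// ler_wpM2l ?invr_ge0//.
exact: ler_norm_sum.
Qed.

Lemma quantile_index l t : 0 < t < 1 -> (0 < size l)%N ->
  (Num.truncn ((size l)%:R * t) < size l)%N.
Proof.
move=> /andP[t0 t1] l0; rewrite truncn_lt_nat ?mulr_ge0 ?(ltW t0)//.
by rewrite gtr_pMr// ltr0n.
Qed.

Lemma quantile_le l : (0 < size l)%N ->
  {in `]0, 1[ &, {homo quantile l : x y / x <= y}}.
Proof.
move=> l0 x y; rewrite !in_itv/= => x01 y01 xy.
apply: (sorted_leq_nth le_trans le_refl); first exact: sort_le_sorted.
- by rewrite inE size_sort quantile_index.
- by rewrite inE size_sort quantile_index.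
- by apply: le_truncn; rewrite ler_wpM2l.
Qed.

Lemma sum_quantile l g :
  \sum_(i < size l) g (quantile l (i%:R / (size l)%:R)) = \sum_(x <- l) g x.
Proof.
rewrite -(perm_big _ (permEl (perm_sort <=%O l))) (big_nth 0) size_sort big_mkord.
apply: eq_bigr => i _; rewrite /quantile mulrC divfK ?natrK//.
by rewrite pnatr_eq0 -lt0n (leq_ltn_trans _ (ltn_ord i)).
Qed.

(** Chebyshev inequality for quantiles: at least a fraction [1 - t] of the
sample lies above the quantile of order [t], and at least a fraction [t] below
it; the side farther from 0 contributes to the second moment, and [t * (1 -
t)] is below both fractions. *)
Lemma quantile_square l t : 0 < t < 1 -> (0 < size l)%N ->
  t * (1 - t) * quantile l t ^+ 2 <= avg l (fun x => x ^+ 2).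
Proof.
move=> t01 l0; have idx := quantile_index t01 l0; have /andP[t0 t1] := t01.
set n := size l in l0 idx *; rewrite /avg -/n.
have n0 : 0 < n%:R :> R by rewrite ltr0n.
have nt0 : 0 <= n%:R * t by rewrite mulr_ge0// ltW.
have /andP[j1 j2] := truncn_itv nt0.
rewrite -(perm_big _ (permEl (perm_sort <=%O l))) (big_nth 0) size_sort -/n /quantile -/n.
set j := Num.truncn _ in idx j1 j2 *; set s := sort _ _.
have s_mono a b : (a < n)%N -> (b < n)%N -> (a <= b)%N -> s`_a <= s`_b.
  move=> an bn ab; apply: (sorted_leq_nth le_trans le_refl) => //.
  - exact: sort_le_sorted.
  - by rewrite inE size_sort.
  - by rewrite inE size_sort.
set v := s`_j.
have sq0 a : 0 <= s`_a ^+ 2 by exact: sqr_ge0.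
rewrite ler_pdivlMl//; have [v0|v0] := leP 0 v.
  apply: (@le_trans _ _ (\sum_(j <= i < n) s`_i ^+ 2)); last first.
    by rewrite [leRHS](@big_cat_nat _ _ _ j) ?(ltnW idx)//= lerDr sumr_ge0.
  apply: (@le_trans _ _ (\sum_(j <= i < n) v ^+ 2)).
    rewrite sumr_const_nat -[leRHS]mulr_natl natrB 1?ltnW// mulrA.
    apply: ler_wpM2r; first exact: sqr_ge0.
    have h2 : n%:R * (t * (1 - t)) <= n%:R * (1 - t) by apply: ler_wpM2l => //; nra.
    by apply: le_trans h2 _; rewrite mulrBr mulr1 lerD2l lerN2.
  rewrite !big_nat; apply: ler_sum => i /andP[ji i_n].
  by rewrite lerXn2r ?nnegrE// ?(le_trans v0)//; exact: s_mono.
apply: (@le_trans _ _ (\sum_(0 <= i < j.+1) s`_i ^+ 2)); last first.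
  by rewrite [leRHS](@big_cat_nat _ _ _ j.+1)//= lerDl sumr_ge0.
apply: (@le_trans _ _ (\sum_(0 <= i < j.+1) v ^+ 2)).
  rewrite sumr_const_nat subn0 -[leRHS]mulr_natl mulrA.
  apply: ler_wpM2r; first exact: sqr_ge0.
  have h2 : n%:R * (t * (1 - t)) <= n%:R * t by apply: ler_wpM2l => //; nra.
  exact: le_trans h2 (ltW j2).
rewrite !big_nat; apply: ler_sum => i /andP[_ ij].
have iv : s`_i <= v by apply: s_mono => //; apply: leq_trans ij _.
by rewrite -sqrrN -[leRHS]sqrrN lerXn2r ?nnegrE ?oppr_ge0 ?lerN2 ?(ltW v0)//; lra.
Qed.

(** The average over the sample is the Riemann sum of [g \o quantile l] with
[size l] cells; the extra term [B / size l] accounts for the point 0, where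
[on01] vanishes. *)
Lemma avg_quantile l g (B : R) : (0 < size l)%N -> {homo g : x y / x <= y} ->
  (forall x, `|g x| <= B) ->
  `|avg l g - Ex (U01 R) (on01 (fun t => g (quantile l t)))| <= 7 * B / (size l)%:R.
Proof.
move=> l0 gm gB.
have B0 : 0 <= B by apply: le_trans (gB 0).
have hm : {in `]0, 1[ &, {homo (fun t => g (quantile l t)) : x y / x <= y}}.
  by move=> x y x01 y01 xy; apply: gm; exact: quantile_le.
have := @monotone_riemann R _ B _ l0 hm (fun t => gB (quantile l t)).
set E := Ex _ _; set n := (size l)%:R; set S := \sum_(i < _) _ => E_S.
have n0 : 0 < n by rewrite ltr0n.
have D : `|\sum_(x <- l) g x - S| <= B.
  rewrite -sum_quantile /S -sumrB.
  case: (size l) l0 @n n0 {S E_S} => // m _ n n0.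
  rewrite big_ord_recl /= big1 ?addr0.
    by rewrite /on01 mul0r ltxx /= subr0.
  move=> i _; rewrite /on01 ifT ?subrr// divr_gt0//= ltr_pdivrMr// mul1r /n ltr_nat.
  by rewrite /bump /= add1n ltnS ltn_ord.
have -> : avg l g - E = n^-1 * (\sum_(x <- l) g x - S) - (E - n^-1 * S).
  rewrite /avg -/n; ring.
apply: le_trans (ler_normB _ _) _.
rewrite normrM gtr0_norm ?invr_gt0//.
have : n^-1 * `|\sum_(x <- l) g x - S| <= B / n by rewrite mulrC ler_pM2r ?invr_gt0.
move: E_S; lra.
Qed.

End quantiles.

Section ultrafilter_limits.
Variable R : realType.
Local Notation V := (measurableTypeR R).

Lemma ultra_bounded_cvg (U : set_system nat) (u : nat -> R) (B : R) :
  UltraFilter U -> (\forall n \near U, `|u n| <= B) ->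
  exists y : R, u n @[n --> U] --> y.
Proof.
move=> FU uB; have FF : ProperFilter U by exact: ultra_proper.
have := @segment_compact R (- B) B => /(_ (u @ U)).
case=> [|y [_ yc]].
  by apply: filterS uB => n; rewrite /= in_itv/= ler_norml.
exists y => W Wy; have [//|UW] := in_ultra_setVsetC (u @^-1` W) FU.
have [z [Az Wz]] := yc (~` W) W UW Wy.
by case: Az.
Qed.

(** Pointwise limits along an ultrafilter do not pass under an integral in
general; for monotone functions they do, because the error of a Riemann sum is
bounded uniformly and a Riemann sum only involves finitely many points. *)
Lemma ultra_limits_monotone (U : set_system nat) (h : nat -> R -> R) (h0 : R -> R)
    (B : R) : UltraFilter U ->
  (\forall n \near U, {in `]0, 1[ &, {homo h n : x y / x <= y}}) ->
  (forall n t, `|h n t| <= B) -> (forall t, `|h0 t| <= B) ->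
  (forall t, 0 < t < 1 -> h n t @[n --> U] --> h0 t) ->
  Ex (U01 R) (on01 (h n)) @[n --> U] --> Ex (U01 R) (on01 h0).
Proof.
move=> FU hm hB h0B hc; have FF : ProperFilter U by exact: ultra_proper.
have B0 : 0 <= B by apply: le_trans (h0B 0).
have h0m : {in `]0, 1[ &, {homo h0 : x y / x <= y}}.
  move=> x y; rewrite !in_itv/= => x01 y01 xy.
  apply: (ler_cvg_to (hc _ x01) (hc _ y01)).
  by apply: filterS hm => n; apply; rewrite // in_itv.
apply/cvgrPdist_le => e e0.
pose N := (Num.truncn (12 * B / (e / 2))).+1.
have N0 : 0 < N%:R :> R by rewrite ltr0n.
have NB : 12 * B / N%:R <= e / 2.
  have := truncnS_gt (12 * B / (e / 2)).
  by rewrite ltr_pdivrMr ?divr_gt0// ler_pdivrMr// [leRHS]mulrC => /ltW.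
have r0 := @monotone_riemann R h0 B N isT h0m h0B.
have cS : N%:R^-1 * \sum_(i < N) on01 (h n) (i%:R / N%:R) @[n --> U] -->
          N%:R^-1 * \sum_(i < N) on01 h0 (i%:R / N%:R).
  apply: cvgM; first exact: cvg_cst.
  apply: cvg_big => [|i _]; first exact: add_continuous.
  rewrite /on01; case: ifPn => [t01|_]; [exact: hc|exact: cvg_cst].
have e2 : 0 < e / 2 by rewrite divr_gt0.
move/cvgrPdist_le : cS => /(_ _ e2) cS.
near=> n.
have hmn : {in `]0, 1[ &, {homo h n : x y / x <= y}} by near: n.
have rn := @monotone_riemann R (h n) B N isT hmn (hB n).
have cn : `|N%:R^-1 * (\sum_(i < N) on01 h0 (i%:R / N%:R)) -
   N%:R^-1 * (\sum_(i < N) on01 (h n) (i%:R / N%:R))| <= e / 2 by near: n.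
move: r0 rn cn NB; rewrite (_ : 12 * B / N%:R = 2 * (6 * B / N%:R)); last by ring.
rewrite !ler_norml => /andP[? ?] /andP[? ?] /andP[? ?] ?.
by apply/andP; split; lra.
Unshelve. all: by end_near. Qed.

(** Powers are neither bounded nor monotone; those of the positive part cut at
the level [L] are both, and continuous. *)
Definition pospart (L x : R) := Num.min L (Num.max 0 x).

Lemma pospart_ge0 L x : 0 <= L -> 0 <= pospart L x.
Proof. by move=> L0; rewrite /pospart le_min L0 le_max lexx. Qed.

Lemma pospart_le L x y : x <= y -> pospart L x <= pospart L y.
Proof.
move=> xy; rewrite /pospart le_min ge_min lexx /= ge_min; apply/orP; right.
by rewrite ge_max !le_max lexx xy orbT.
Qed.

Lemma pospart_leL L x : pospart L x <= L.
Proof. by rewrite /pospart ge_min lexx. Qed.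

Lemma continuous_pospart L : continuous (pospart L).
Proof.
move=> x; have : {for x, continuous (pospart L)}; last by [].
rewrite /pospart; apply: continuous_min; first exact: cvg_cst.
by apply: continuous_max; [exact: cvg_cst|exact: cvg_id].
Qed.

(** A power is the combination of the powers of the cut positive and negative
parts, except where [`|x|] exceeds [L]; there the ratio of [`|x| ^+ k] to [L
^+ k] is at least 1, and a moment of twice the order dominates. *)
Lemma pospart_power L x k : 0 < L -> (0 < k)%N ->
  `|x ^+ k - (1 * pospart L x ^+ k + (-1) ^+ k * pospart L (- x) ^+ k)| <=
   x ^+ (2 * k) / L ^+ k.
Proof.
move=> L0 k0.
wlog x0 : x / 0 <= x => [wl|].
  have [x0|x0] := leP 0 x; first exact: wl.
  have := wl (- x); rewrite oppr_ge0 (ltW x0) => /(_ isT).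
  rewrite opprK exprM sqrrN -exprM.
  apply: le_trans; rewrite (exprNn x).
  have s1 : ((-1) ^+ k * (-1) ^+ k : R) = 1 by rewrite -exprMn mulrNN mulr1 expr1n.
  have s2 : `|(-1) ^+ k : R| = 1 by rewrite normrX normrN1 expr1n.
  set sg := (-1) ^+ k in s1 s2 *; set p := pospart L x; set q := pospart L (- x).
  have -> : x ^+ k - (1 * p ^+ k + sg * q ^+ k) =
      sg * (sg * x ^+ k - (1 * q ^+ k + sg * p ^+ k)).
    transitivity ((sg * sg) * x ^+ k - ((sg * sg) * p ^+ k + sg * q ^+ k)).
      by rewrite s1 !mul1r.
    by ring.
  by rewrite normrM s2 [leLHS]mul1r.
have -> : pospart L (- x) = 0.
  by rewrite /pospart max_l ?oppr_le0// min_r// ltW.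
rewrite expr0n (gtn_eqF k0) !mulr0 addr0 mul1r.
rewrite /pospart max_r//; have [Lx|xL] := leP L x.
  have Lk : L ^+ k <= x ^+ k by rewrite lerXn2r ?nnegrE// ltW.
  have Lk0 : 0 < L ^+ k by rewrite exprn_gt0.
  rewrite ger0_norm ?subr_ge0// ler_pdivlMr// mul2n -addnn exprD.
  nra.
rewrite subrr normr0 divr_ge0 ?exprn_ge0 ?(ltW L0)//.
Qed.

End ultrafilter_limits.

(** * Existence in the moment problem *)

Section existence.
Variable R : realType.
Local Notation V := (measurableTypeR R).
Local Notation law := (probability (measurableTypeR R) R).

Lemma law_of_function (Q : V -> R) : measurable_fun setT Q ->
  (forall k, integ (U01 R) (fun t => Q t ^+ k)) ->
  exists mu : law, forall k, integ mu (fun x => x ^+ k) /\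
     Ex mu (fun x => x ^+ k) = Ex (U01 R) (fun t => Q t ^+ k).
Proof.
move=> mQ iQ.
pose X : {mfun V >-> V} := @MeasurableFun.Pack _ _ V V Q
  (MeasurableFun.Class (isMeasurableFun.Build _ _ V V Q mQ)).
pose mu : law := distribution (U01 R) X.
exists mu => k; have mk := @measurable_powR_nat R k.
have mkE : measurable_fun (setT : set V) (fun x : V => (x ^+ k)%:E).
  exact/measurable_EFinP.
split.
  have := @integrable_pushforward _ _ V V R Q mQ (U01 R) setT _ mkE.
  by rewrite preimage_setT => /(_ (iQ k) measurableT).
rewrite /Ex /Rintegral; congr fine.
by rewrite (@integral_distribution _ _ V V R (U01 R) X)//; exact: iQ.
Qed.

Lemma continuous_pospartX (L : R) k : continuous (fun x => pospart L x ^+ k).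
Proof.
move=> x; apply: (@continuous_comp _ _ _ (pospart L) (fun y : R => y ^+ k)).
  exact: continuous_pospart.
exact: exprn_continuous.
Qed.

Lemma continuous_pospartNX (L : R) k : continuous (fun x => pospart L (- x) ^+ k).
Proof.
move=> x; apply: (@continuous_comp _ _ _ -%R (fun y : R => pospart L y ^+ k)).
  exact: opp_continuous.
exact: continuous_pospartX.
Qed.

(** Samples whose moments converge have quantiles that are bounded at each
point of the open unit interval, so the quantile functions have a pointwise
limit along an ultrafilter. The law of the limit, as a function on the unit
interval, has the limit moments: averages of bounded monotone continuous
functions pass to the limit, and powers are approximated by differences of
such functions. *)
Lemma moment_problem (s : nat -> seq R) (m : nat -> R) :
  (forall N, \forall n \near \oo, (N <= size (s n))%N) ->
  (forall k, avg (s n) (fun x => x ^+ k) @[n --> \oo] --> m k) ->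
  exists mu : law, forall k, integ mu (fun x => x ^+ k) /\
     Ex mu (fun x => x ^+ k) = m k.
Proof.
move=> sN cm.
have [U [FU nU]] := ultraFilterLemma (eventually_filter : ProperFilter \oo).
have FF : ProperFilter U by exact: ultra_proper.
have toU (u : nat -> R) (y : R) : u n @[n --> \oo] --> y -> u n @[n --> U] --> y.
  by move=> uy W /uy; exact: nU.
have Um k := toU _ _ (cm k).
have Us0 : \forall n \near U, (0 < size (s n))%N by apply: nU; exact: sN.
(* The limit of the quantile functions along an ultrafilter, which exists on
the open unit interval because quantiles are bounded by second moments. *)
pose q t : R := lim (quantile (s n) t @[n --> U]).
have qc t : 0 < t < 1 -> quantile (s n) t @[n --> U] --> q t.
  move=> t01; have /andP[t0 t1] := t01.
  have [|y qy] := @ultra_bounded_cvg R U (fun n => quantile (s n) t)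
     (1 + (m 2%N + 1) / (t * (1 - t))) FU; last exact: (cvgP y qy).
  have : \forall n \near U, avg (s n) (fun x => x ^+ 2) <= m 2%N + 1.
    by apply: (cvgr_le _ (Um 2%N)); rewrite ltrDl.
  apply: filterS2 Us0 => n s0 h /=.
  have := quantile_square t01 s0; set v := quantile _ _ => hv.
  have {h}hv := le_trans hv h.
  have tt : 0 < t * (1 - t) by rewrite mulr_gt0// subr_gt0.
  rewrite -ler_pdivlMl// mulrC in hv.
  apply: le_trans (_ : 1 + v ^+ 2 <= _); last by rewrite lerD2l.
  by rewrite -[v ^+ 2]real_normK ?num_real//; have := normr_ge0 v; nra.
have qm : {in `]0, 1[ &, {homo q : x y / x <= y}}.
  move=> x y; rewrite !in_itv/= => x01 y01 xy.
  apply: (ler_cvg_to (qc _ x01) (qc _ y01)).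
  by apply: filterS Us0 => n s0; apply: (quantile_le s0); rewrite ?in_itv.
pose Q : V -> R := on01 q.
have mQ : measurable_fun setT Q.
  have mq := monotone_measurable qm.
  have mo := measurable_on01 mq.
  exact: mo.
(* Averages of a bounded monotone continuous function are, up to a vanishing
error, integrals of monotone functions, to which limits along the ultrafilter
apply. *)
have key (g : R -> R) (B : R) : {homo g : x y / x <= y} -> continuous g ->
    (forall x, `|g x| <= B) ->
    avg (s n) g @[n --> U] --> Ex (U01 R) (on01 (fun t => g (q t))).
  move=> gm gc gB.
  have B0 : 0 <= B by apply: le_trans (gB 0).
  have c1 := @ultra_limits_monotone R U (fun n t => g (quantile (s n) t))
    (fun t => g (q t)) B FU.
  have {}c1 : Ex (U01 R) (on01 (fun t => g (quantile (s n) t))) @[n --> U] -->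
      Ex (U01 R) (on01 (fun t => g (q t))).
    apply: c1 => //.
      apply: filterS Us0 => n s0 x y x01 y01 xy.
      by apply: gm; exact: quantile_le.
    by move=> t t01; exact: (cvg_comp _ _ (qc t t01) (gc (q t))).
  apply/cvgrPdist_le => e e0; have e2 : 0 < e / 2 by rewrite divr_gt0.
  move/cvgrPdist_le : c1 => /(_ _ e2) c1.
  have Us : \forall n \near U, ((Num.truncn (7 * B / (e / 2))).+1 <= size (s n))%N.
    by apply: nU; exact: sN.
  near=> n.
  have s0 : (0 < size (s n))%N by near: n.
  have sn : ((Num.truncn (7 * B / (e / 2))).+1 <= size (s n))%N by near: n.
  have a1 := avg_quantile s0 gm gB.
  have a2 : `|Ex (U01 R) (on01 (fun t => g (q t))) -
     Ex (U01 R) (on01 (fun t => g (quantile (s n) t)))| <= e / 2 by near: n.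
  have a3 : 7 * B / (size (s n))%:R <= e / 2.
    rewrite ler_pdivrMr ?ltr0n// [leRHS]mulrC -ler_pdivrMr//.
    apply/ltW; apply: lt_le_trans (truncnS_gt _) _.
    by rewrite ler_nat.
  move: a1 a2 a3; rewrite !ler_norml => /andP[? ?] /andP[? ?] ?.
  by apply/andP; split; lra.
have bnd (L : R) k x : 0 <= L -> 0 <= pospart L x ^+ k <= L ^+ k.
  move=> L0; rewrite exprn_ge0 ?pospart_ge0//= lerXn2r ?nnegrE ?pospart_ge0//.
  exact: pospart_leL.
have on0 (g : R -> R) : g 0 = 0 -> on01 (fun t => g (q t)) = (fun t => g (Q t)).
  by move=> g0; apply/funext => t; rewrite /Q /on01; case: ifP.
have keyp L k (L0 : 0 < L) (k0 : (0 < k)%N) :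
    avg (s n) (fun x => pospart L x ^+ k) @[n --> U] -->
    Ex (U01 R) (fun t => pospart L (Q t) ^+ k).
  rewrite -(on0 (fun x => pospart L x ^+ k)); last first.
    by rewrite /pospart maxxx min_r ?(ltW L0)// expr0n gtn_eqF.
  apply: (key _ (L ^+ k)).
  - by move=> x y xy; rewrite lerXn2r ?nnegrE ?pospart_ge0 ?(ltW L0)//; exact: pospart_le.
  - exact: continuous_pospartX.
  - by move=> x; have /andP[b0 b1] := bnd L k x (ltW L0); rewrite ger0_norm.
have keyn L k (L0 : 0 < L) (k0 : (0 < k)%N) :
    avg (s n) (fun x => pospart L (- x) ^+ k) @[n --> U] -->
    Ex (U01 R) (fun t => pospart L (- Q t) ^+ k).
  pose g x := - (pospart L (- x) ^+ k).
  have kg : avg (s n) g @[n --> U] --> Ex (U01 R) (fun t => g (Q t)).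
    rewrite -(on0 g); last first.
      by rewrite /g oppr0 /pospart maxxx min_r ?(ltW L0)// expr0n gtn_eqF// oppr0.
    apply: (key _ (L ^+ k)).
    - move=> x y xy; rewrite lerN2 lerXn2r ?nnegrE ?pospart_ge0 ?(ltW L0)//.
      by apply: pospart_le; rewrite lerN2.
    - by move=> x; apply: cvgN; exact: continuous_pospartNX.
    - move=> x; have /andP[b0 b1] := bnd L k (- x) (ltW L0).
      by rewrite normrN ger0_norm.
  have -> : (fun n => avg (s n) (fun x => pospart L (- x) ^+ k)) =
       (fun n => - avg (s n) g).
    apply/funext => n; rewrite /avg -mulrN -sumrN; congr (_ * _).
    by apply: eq_bigr => x _; rewrite opprK.
  have -> : Ex (U01 R) (fun t => pospart L (- Q t) ^+ k) =
      - Ex (U01 R) (fun t => g (Q t)).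
    rewrite -mulN1r -ExZ.
      by apply: eq_Ex => t; rewrite mulN1r opprK.
    apply: (@integ_bounded _ _ _ _ _ (L ^+ k)).
      apply: (@measurableT_comp _ _ _ _ _ _ g) => //.
      by apply: continuous_measurableR => x; apply: cvgN; exact: continuous_pospartNX.
    move=> x; have /andP[b0 b1] := bnd L k (- Q x) (ltW L0).
    by rewrite normrN ger0_norm.
  exact: cvgN.
have mp L k : measurable_fun (setT : set V) (fun t => pospart L (Q t) ^+ k).
  apply: measurable_funX; apply: (@measurableT_comp _ _ _ _ _ _ (pospart L)) => //.
  by apply: continuous_measurableR; exact: continuous_pospart.
have mn L k : measurable_fun (setT : set V) (fun t => pospart L (- Q t) ^+ k).
  apply: measurable_funX; apply: (@measurableT_comp _ _ _ _ _ _ (pospart L)).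
    by apply: continuous_measurableR; exact: continuous_pospart.
  exact: measurableT_comp.
have ip L k : 0 <= L -> integ (U01 R) (fun t => pospart L (Q t) ^+ k).
  move=> L0; apply: (@integ_bounded _ _ _ _ _ (L ^+ k)) => // t.
  by have /andP[b0 b1] := bnd L k (Q t) L0; rewrite ger0_norm.
have in_ L k : 0 <= L -> integ (U01 R) (fun t => pospart L (- Q t) ^+ k).
  move=> L0; apply: (@integ_bounded _ _ _ _ _ (L ^+ k)) => // t.
  by have /andP[b0 b1] := bnd L k (- Q t) L0; rewrite ger0_norm.
have even_le L k x : 0 <= L -> (0 < k)%N ->
    pospart L x ^+ (2 * k) + pospart L (- x) ^+ (2 * k) <= x ^+ (2 * k).
  move=> L0 k0.
  have gen y : 0 <= y -> pospart L y ^+ (2 * k) + pospart L (- y) ^+ (2 * k) <= y ^+ (2 * k).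
    move=> y0; have -> : pospart L (- y) = 0.
      by rewrite /pospart max_l ?oppr_le0// min_r.
    rewrite expr0n muln_eq0 /= (gtn_eqF k0) addr0 lerXn2r ?nnegrE ?pospart_ge0//.
    by rewrite /pospart max_r// ge_min lexx orbT.
  have [x0|x0] := leP 0 x; first exact: gen.
  by have := gen (- x); rewrite opprK oppr_ge0 addrC [(- x) ^+ _]exprM sqrrN -exprM;
    apply; exact: ltW.
(* The even moments of the limit are bounded uniformly in the cutting level,
so they are finite by monotone convergence. *)
have even_bound L k : 0 < L -> (0 < k)%N ->
    Ex (U01 R) (fun t => pospart L (Q t) ^+ (2 * k) + pospart L (- Q t) ^+ (2 * k)) <= m (2 * k)%N.
  move=> L0 k0; have k20 : (0 < 2 * k)%N by rewrite muln_gt0.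
  rewrite ExD; [|exact/ip/ltW|exact/in_/ltW].
  have c : avg (s n) (fun x => pospart L x ^+ (2 * k)) +
      avg (s n) (fun x => pospart L (- x) ^+ (2 * k)) @[n --> U] -->
      Ex (U01 R) (fun t => pospart L (Q t) ^+ (2 * k)) +
      Ex (U01 R) (fun t => pospart L (- Q t) ^+ (2 * k)).
    by apply: cvgD; [exact: keyp|exact: keyn].
  apply: (ler_cvg_to c (Um (2 * k)%N)); apply: nearW => n.
  have := avgD (s n) 1 1 (fun x => pospart L x ^+ (2 * k)) (fun x => pospart L (- x) ^+ (2 * k)).
  rewrite !mul1r /= => <-; apply: avg_le => x; rewrite !mul1r.
  by apply: even_le => //; exact: ltW.
have iQ2 k : (0 < k)%N -> integ (U01 R) (fun t => Q t ^+ (2 * k)) /\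
    Ex (U01 R) (fun t => Q t ^+ (2 * k)) <= m (2 * k)%N.
  move=> k0.
  apply: (@integ_monotone_limit _ _ _ _ (fun n t =>
    pospart n.+1%:R (Q t) ^+ (2 * k) + pospart n.+1%:R (- Q t) ^+ (2 * k))).
  - by move=> n; apply: integD; [exact: ip|exact: in_].
  - by move=> n t; rewrite addr_ge0 ?exprn_ge0 ?pospart_ge0.
  - move=> t a b ab; apply: lerD; rewrite lerXn2r ?nnegrE ?pospart_ge0//;
      by rewrite /pospart le_min !ge_min lexx orbT andbT ler_nat ltnS ab.
  - move=> t; apply: cvg_near_cst; exists (Num.truncn `|Q t|) => // n /= nt.
    have Qn : `|Q t| <= n.+1%:R.
      by apply/ltW; apply: lt_le_trans (truncnS_gt _) _; rewrite ler_nat.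
    move: Qn; rewrite ler_norml => /andP[Q1 Q2].
    have [Q0|Q0] := leP 0 (Q t).
      rewrite /pospart max_r// min_r// max_l ?oppr_le0// min_r// expr0n muln_eq0/=.
      by rewrite (gtn_eqF k0) addr0.
    rewrite /pospart max_l ?(ltW Q0)// min_r// max_r ?oppr_ge0 ?(ltW Q0)// min_r; last lra.
    rewrite expr0n muln_eq0/= (gtn_eqF k0) add0r.
    by rewrite exprM sqrrN -exprM.
  - by move=> n; exact: even_bound.
have iQ k : integ (U01 R) (fun t => Q t ^+ k).
  case: k => [|k]; first exact: integ_cst.
  have [i2 _] := iQ2 k.+1 isT.
  apply: (@integ_le _ _ _ _ _ (fun t => 1 + Q t ^+ (2 * k.+1))).
  - exact: measurable_funX.
  - by apply: integD => //; exact: integ_cst.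
  - move=> t; rewrite mulnC exprM -[X in _ <= 1 + X]real_normK ?num_real//.
    by have := normr_ge0 (Q t ^+ k.+1); nra.
have [mu hmu] := law_of_function mQ iQ.
exists mu => k; have [imu ->] := hmu k; split=> //.
have [->|k0] := posnP k.
  have -> : Ex (U01 R) (fun t => Q t ^+ 0) = 1 by rewrite -[RHS](Ex_cst (U01 R)).
  have c1 : avg (s n) (fun x => x ^+ 0) @[n --> U] --> (1 : R).
    apply: cvg_near_cst; apply: filterS Us0 => n s0.
    rewrite /avg (eq_bigr (fun=> 1)) => [|x _]; last by rewrite expr0.
    by rewrite big_const_seq count_predT iter_addr_0 mulVf// pnatr_eq0 -lt0n.
  by apply: (cvg_unique _ c1 (Um 0%N)); exact: Rhausdorff.
have [iQ2k EQ2k] := iQ2 k k0.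
pose D := Ex (U01 R) (fun t => Q t ^+ k) - m k.
suff D0 : D = 0 by apply/eqP; rewrite -subr_eq0 -/D D0.
have M0 : 0 <= m (2 * k)%N.
  apply: le_trans EQ2k; apply: Ex_ge0 => t.
  by rewrite exprM exprn_ge0// sqr_ge0.
(* The moments agree up to twice the cutting error, which vanishes as [L]
grows. *)
have DL (L : R) : 1 <= L -> `|D| <= 2 * m (2 * k)%N / L.
  move=> L1; have L0 : 0 < L by lra.
  pose c := fun x : R => 1 * pospart L x ^+ k + (-1) ^+ k * pospart L (- x) ^+ k.
  have ic : integ (U01 R) (fun t => c (Q t)).
    by apply: integD; apply: integZ; [exact/ip/ltW|exact/in_/ltW].
  have Lk : 0 < L ^+ k by rewrite exprn_gt0.
  have b1 : `|Ex (U01 R) (fun t => Q t ^+ k) - Ex (U01 R) (fun t => c (Q t))| <= m (2 * k)%N / L ^+ k.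
    rewrite -ExB//; apply: (@le_trans _ _ (Ex (U01 R) (fun t => (L ^+ k)^-1 * Q t ^+ (2 * k)))).
      apply: Ex_norm_le; [exact: integB|exact: integZ|].
      by move=> t; rewrite mulrC; exact: pospart_power.
    by rewrite ExZ// mulrC ler_pM2r// invr_gt0.
  have cc : avg (s n) c @[n --> U] --> Ex (U01 R) (fun t => c (Q t)).
    have -> : Ex (U01 R) (fun t => c (Q t)) = 1 * Ex (U01 R) (fun t => pospart L (Q t) ^+ k)
        + (-1) ^+ k * Ex (U01 R) (fun t => pospart L (- Q t) ^+ k).
      by rewrite -!ExZ ?ExD//; try apply: integZ; try exact/ip/ltW; exact/in_/ltW.
    have -> : (fun n => avg (s n) c) = (fun n => 1 * avg (s n) (fun x => pospart L x ^+ k)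
        + (-1) ^+ k * avg (s n) (fun x => pospart L (- x) ^+ k)).
      by apply/funext => n; rewrite avgD.
    by apply: cvgD; apply: cvgM; try exact: cvg_cst; [exact: keyp|exact: keyn].
  have b2 : `|m k - Ex (U01 R) (fun t => c (Q t))| <= m (2 * k)%N / L ^+ k.
    have cl : `|avg (s n) (fun x => x ^+ k) - avg (s n) c| @[n --> U] -->
        `|m k - Ex (U01 R) (fun t => c (Q t))|.
      by apply: cvg_norm; apply: cvgB.
    have cr : avg (s n) (fun x => x ^+ (2 * k)) / L ^+ k @[n --> U] --> m (2 * k)%N / L ^+ k.
      by apply: cvgM; [exact: Um|exact: cvg_cst].
    apply: (ler_cvg_to cl cr); apply: nearW => n.
    have -> : avg (s n) (fun x => x ^+ k) - avg (s n) c = avg (s n) (fun x => x ^+ k - c x).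
      have := avgD (s n) 1 (-1) (fun x => x ^+ k) c.
      rewrite mul1r mulN1r => <-; congr avg; apply/funext => x.
      by rewrite mul1r mulN1r.
    apply: le_trans (avg_norm _ _) _.
    have -> : avg (s n) (fun x => x ^+ (2 * k)) / L ^+ k =
        avg (s n) (fun x => x ^+ (2 * k) / L ^+ k).
      by rewrite /avg -mulrA; congr (_ * _); rewrite mulr_suml.
    by apply: avg_le => x; exact: pospart_power.
  have b3 : m (2 * k)%N / L ^+ k <= m (2 * k)%N / L.
    by rewrite ler_wpM2l// lef_pV2 ?posrE//;
      case: k k0 {D iQ2k EQ2k M0 c ic Lk b1 cc b2 imu} => // k _;
        rewrite exprS ler_peMr ?(ltW L0)// exprn_ege1.
  rewrite /D; move: b1 b2 b3; rewrite !ler_norml => /andP[? ?] /andP[? ?] ?.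
  by apply/andP; split; lra.
apply/eqP; rewrite -normr_eq0 eq_le normr_ge0 andbT leNgt; apply/negP => Dgt.
(* A level at which the bound [DL] contradicts [D != 0]. *)
pose L := 1 + 2 * (2 * m (2 * k)%N) / `|D|.
have L1 : 1 <= L by rewrite lerDl divr_ge0// !mulr_ge0.
have := DL L L1; rewrite ler_pdivlMr; last lra.
rewrite /L mulrDr mulr1 mulrCA divff ?gt_eqF// mulr1; lra.
Unshelve. all: by end_near. Qed.

End existence.

(** * Eigenvalues of symmetric matrices and the Frobenius distance *)

Section trace_comparison.
Variable R : realType.
Local Notation C := (R[i]).
Local Notation toC := (real_complex R).

Lemma char_poly_conj n (P A D : 'M[C]_n) : P \in unitmx ->
  P *m A = D *m P -> char_poly A = char_poly D.
Proof.
move=> Pu PA; have detP : (\det P)%:P != 0 :> {poly C}.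
  by rewrite polyC_eq0 -unitfE -unitmxE.
apply: (mulfI detP); rewrite -det_map_mx [RHS]mulrC /char_poly -!det_mulmx.
by rewrite /char_poly_mx mulmxBr mulmxBl -!map_mxM PA scalar_mxC.
Qed.

Lemma char_poly_diag n (d : 'rV[C]_n) :
  char_poly (diag_mx d) = \prod_(i < n) ('X - (d 0 i)%:P).
Proof.
rewrite /char_poly (_ : char_poly_mx _ = diag_mx (\row_i ('X - (d 0 i)%:P))).
  by rewrite det_diag; apply: eq_bigr => i _; rewrite mxE.
apply/matrixP => i j; rewrite !mxE; case: eqP => [->|_].
  by rewrite !mulr1n.
by rewrite !mulr0n subrr.
Qed.

(** A unitary diagonalization with real eigenvalues. The unitary matrix is
complex, the entries of the diagonal are kept real. *)
Definition diagonalizes n (A Q : 'M[C]_n) (a : 'I_n -> R) :=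
  Q *m (map_mx Num.conj_op Q^T) = 1%:M /\ (map_mx Num.conj_op Q^T) *m Q = 1%:M /\
  Q *m A = diag_mx (\row_i toC (a i)) *m Q.

Lemma symmetric_diagonalizes n (M : 'M[R]_n) : M^T = M ->
  exists Q a, diagonalizes (map_mx toC M) Q a /\
    perm_eq (eigenvalues M) [seq a i | i : 'I_n].
Proof.
move=> Msym; set A := map_mx toC M.
have Aherm : A \is hermsymmx.
  apply: realsym_hermsym.
    apply/is_hermitianmxP; rewrite expr0 scale1r.
    by apply/matrixP => i j; rewrite !mxE -[in LHS]Msym mxE.
  by apply/mxOverP => i j; rewrite mxE complex_real.
have /orthomx_spectralP AE := hermitian_normalmx Aherm.
have /mxOverP Dreal := hermitian_spectral_diag_real Aherm.
have Qun := spectral_unitarymx A; have Qu := spectral_unit A.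
move: (spectralmx A) (spectral_diag A) AE Dreal Qun Qu => Q D AE Dreal Qun Qu.
pose a i := complex.Re (D 0 i).
have DE : D = \row_i toC (a i).
  by apply/rowP => i; rewrite mxE /a RRe_real.
have QA : Q *m A = diag_mx (\row_i toC (a i)) *m Q.
  have := congr1 (mulmx Q) AE; rewrite !mulmxA mulmxV// mul1mx DE.
  exact.
exists Q, a; split.
  have QQ : Q *m (map_mx Num.conj_op Q^T) = 1%:M by exact/unitarymxP.
  by split=> //; split=> //; apply: mulmx1C.
have cE := char_poly_conj Qu QA.
apply: prod_XsubC_eq; rewrite -char_poly_symmetric//.
apply: (map_poly_inj toC).
rewrite map_char_poly -/A cE char_poly_diag rmorph_prod /= big_map big_enum /=.
by apply: eq_bigr => i _; rewrite mxE map_polyXsubC.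
Qed.

Lemma sum_eigenvalues n (M : 'M[R]_n) (a : 'I_n -> R) (f : R -> R) :
  perm_eq (eigenvalues M) [seq a i | i : 'I_n] ->
  \sum_(x <- eigenvalues M) f x = \sum_i f (a i).
Proof. by move=> ea; rewrite (perm_big _ ea) /= big_map big_enum. Qed.

Lemma sum_power_diagonalizes n (M : 'M[R]_n.+1) Q a k :
  diagonalizes (map_mx toC M) Q a -> \sum_i a i ^+ k = \tr (M ^+ k).
Proof.
move=> [QQ [Q'Q QA]].
have QAk : Q *m (map_mx toC M) ^+ k = (diag_mx (\row_i toC (a i))) ^+ k *m Q.
  elim: k => [|k IH]; first by rewrite !expr0 mulmx1 mul1mx.
  by rewrite !exprS -!mulmxE mulmxA QA -mulmxA IH mulmxA.
have Dk : (diag_mx (\row_i toC (a i))) ^+ k = diag_mx (\row_i toC (a i ^+ k)).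
  elim: k {QAk} => [|k IH].
    by rewrite expr0; apply/matrixP => i j; rewrite !mxE expr0.
  rewrite exprS IH -mulmxE; apply/matrixP => i j.
  rewrite mul_diag_mx !mxE; case: eqP => [->|_]; last by rewrite !mulr0n mulr0.
  by rewrite !mulr1n exprS rmorphM.
apply: (@complexI R).
rewrite -[RHS]/(toC _) -trace_map_mx.
have -> : map_mx toC (M ^+ k) = (map_mx toC M) ^+ k by rewrite rmorphXn.
have -> : (map_mx toC M) ^+ k = map_mx Num.conj_op Q^T *m (Q *m (map_mx toC M) ^+ k).
  by rewrite mulmxA Q'Q mul1mx.
rewrite QAk Dk mxtrace_mulC -mulmxA QQ mulmx1 mxtrace_diag.
by rewrite rmorph_sum; apply: eq_bigr => i _; rewrite mxE.
Qed.

Lemma sum_eigenvalues_power n (M : 'M[R]_n.+1) k : M^T = M ->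
  \sum_(x <- eigenvalues M) x ^+ k = \tr (M ^+ k).
Proof.
move=> Msym; have [Q [a [Da ea]]] := symmetric_diagonalizes Msym.
by rewrite (sum_eigenvalues (fun x => x ^+ k) ea); exact: sum_power_diagonalizes Da.
Qed.

(** Argument of Hoffman and Wielandt. If unitary matrices diagonalize [M] and
[N] with eigenvalues [a] and [b], the squared moduli [w] of the entries of
their quotient form a doubly stochastic matrix, and the mean of [(a i - b j)
^+ 2] under [w] is the squared Frobenius distance of [M] and [N]. Since the
marginals of [w] are uniform, the difference of the two sums is the mean of [f
(a i) - f (b j)], and [2 * t <= t ^+ 2 / dl + dl] bounds the distances by
their squares. *)
Lemma trace_comparison n (M N : 'M[R]_n) (f : R -> R) (dl : R) :
  M^T = M -> N^T = N -> 0 < dl ->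
  (forall x y, `|f x - f y| <= `|x - y|) ->
  `|\sum_(x <- eigenvalues M) f x - \sum_(x <- eigenvalues N) f x| <=
    2^-1 * ((\sum_i \sum_j (M i j - N i j) ^+ 2) / dl + dl * n%:R).
Proof.
move=> Msym Nsym dl0 fL.
have [P [a [[PP [P'P PA]] ea]]] := symmetric_diagonalizes Msym.
have [Q [b [[QQ [Q'Q QB]] eb]]] := symmetric_diagonalizes Nsym.
have -> : \sum_(x <- eigenvalues M) f x - \sum_(x <- eigenvalues N) f x =
    \sum_i f (a i) - \sum_i f (b i).
  by congr (_ - _); [exact: (sum_eigenvalues f ea)|exact: (sum_eigenvalues f eb)].
clear ea eb.
pose star (X : 'M[C]_n) := map_mx Num.conj_op X^T.
have starM X Y : star (X *m Y) = star Y *m star X.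
  by rewrite /star trmx_mul map_mxM.
have starK X : star (star X) = X.
  by apply/matrixP => i j; rewrite !mxE conjCK.
pose nsq (z : C) : R := complex.Re z ^+ 2 + complex.Im z ^+ 2.
have nsqE z : toC (nsq z) = z * z^*.
  by case: z => u v; apply/eqP; rewrite /nsq eq_complex /=; apply/andP; split; apply/eqP; ring.
have nsq0 z : 0 <= nsq z by rewrite addr_ge0 ?sqr_ge0.
have rowsum (X : 'M[C]_n) i : toC (\sum_j nsq (X i j)) = (X *m star X) i i.
  by rewrite mxE rmorph_sum; apply: eq_bigr => j _; apply: (etrans (nsqE _)); rewrite !mxE.
have colsum (X : 'M[C]_n) j : toC (\sum_i nsq (X i j)) = (star X *m X) j j.
  by rewrite mxE rmorph_sum; apply: eq_bigr => i _; apply: (etrans (nsqE _));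
    rewrite !mxE mulrC.
have frob (X : 'M[C]_n) : toC (\sum_i \sum_j nsq (X i j)) = \tr (X *m star X).
  by rewrite rmorph_sum; apply: eq_bigr => i _; exact: rowsum.
(* The matrix [w] of the squared moduli of the entries of the unitary [W] is
doubly stochastic. *)
pose W := P *m star Q.
pose w i j := nsq (W i j).
have w0 i j : 0 <= w i j by exact: nsq0.
have w1 i : \sum_j w i j = 1.
  apply: (@complexI R); rewrite -[LHS]/(toC _) rowsum /W starM starK mulmxA.
  by rewrite -[X in X *m _]mulmxA Q'Q mulmx1 PP mxE eqxx.
have w2 j : \sum_i w i j = 1.
  apply: (@complexI R); rewrite -[LHS]/(toC _) colsum /W starM starK mulmxA.
  by rewrite -[X in X *m _]mulmxA P'P mulmx1 QQ mxE eqxx.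
have wsum : \sum_i \sum_j w i j = n%:R.
  by rewrite (eq_bigr (fun=> 1)) ?sumr_const ?card_ord// => i _; exact: w1.
have main : \sum_i \sum_j w i j * (a i - b j) ^+ 2 =
    \sum_i \sum_j (M i j - N i j) ^+ 2.
  pose X := P *m (map_mx toC M - map_mx toC N) *m star Q.
  have XE i j : X i j = toC (a i - b j) * W i j.
    have -> : X = diag_mx (\row_i toC (a i)) *m W - W *m diag_mx (\row_i toC (b i)).
      have BQ : map_mx toC N *m star Q = star Q *m diag_mx (\row_i toC (b i)).
        by rewrite -[LHS]mul1mx -Q'Q -mulmxA (mulmxA Q) QB -(mulmxA (diag_mx _)) QQ mulmx1.
      by rewrite /X /W mulmxBr mulmxBl PA -!mulmxA BQ.
    rewrite mul_diag_mx mul_mx_diag !mxE [X in _ - X]mulrC -mulrBl.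
    by rewrite rmorphB.
  have L : \sum_i \sum_j w i j * (a i - b j) ^+ 2 = \sum_i \sum_j nsq (X i j).
    apply: eq_bigr => i _; apply: eq_bigr => j _; rewrite XE /w /nsq.
    by case: (W i j) => u v; simpc => /=; ring.
  rewrite L; apply: (@complexI R); rewrite -[LHS]/(toC _) -[RHS]/(toC _) frob.
  rewrite /X !starM starK -!mulmxA (mulmxA (star Q)) Q'Q mul1mx.
  rewrite mxtrace_mulC -!mulmxA P'P mulmx1.
  rewrite -frob; congr (_ %:C)%C; apply: eq_bigr => i _; apply: eq_bigr => j _.
  by rewrite !mxE /nsq /=; ring.
have -> : \sum_(i < n) f (a i) - \sum_(j < n) f (b j) =
    \sum_i \sum_j w i j * (f (a i) - f (b j)).
  have -> : \sum_(i < n) f (a i) = \sum_i \sum_j w i j * f (a i).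
    by apply: eq_bigr => i _; rewrite -mulr_suml w1 mul1r.
  have -> : \sum_(j < n) f (b j) = \sum_i \sum_j w i j * f (b j).
    by rewrite exchange_big; apply: eq_bigr => j _; rewrite -mulr_suml w2 mul1r.
  rewrite -sumrB; apply: eq_bigr => i _; rewrite -sumrB.
  by apply: eq_bigr => j _; rewrite mulrBr.
rewrite -main -wsum mulr_suml mulr_sumr -big_split mulr_sumr/=.
apply: le_trans (ler_norm_sum _ _ _) _; apply: ler_sum => i _.
rewrite mulr_suml mulr_sumr -big_split mulr_sumr/=.
apply: le_trans (ler_norm_sum _ _ _) _; apply: ler_sum => j _.
rewrite normrM (ger0_norm (w0 i j)).
apply: le_trans (ler_wpM2l (w0 i j) (fL _ _)) _.
have -> : 2^-1 * (w i j * (a i - b j) ^+ 2 / dl + dl * w i j) =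
   w i j * (2^-1 * ((a i - b j) ^+ 2 / dl + dl)) by ring.
apply: ler_wpM2l => //; rewrite -(real_normK (num_real (a i - b j))).
set t := `|_|; rewrite -subr_ge0.
have -> : 2^-1 * (t ^+ 2 / dl + dl) - t = 2^-1 * ((t - dl) ^+ 2 / dl).
  by field; rewrite gt_eqF.
by rewrite mulr_ge0// divr_ge0 ?sqr_ge0 ?ltW.
Qed.

Definition pad m d (M : 'M[R]_m) : 'M[R]_(m + d) := block_mx M 0 0 0.

Lemma eigenvalues_pad m d (M : 'M[R]_m) : M^T = M ->
  perm_eq (eigenvalues (pad d M)) (eigenvalues M ++ nseq d 0).
Proof.
move=> Msym; apply: prod_XsubC_eq.
rewrite -char_poly_symmetric; last by rewrite /pad tr_block_mx !trmx0 Msym.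
rewrite /char_poly char_block_diag_mx det_ublock -/(char_poly M).
rewrite (char_poly_symmetric Msym) big_cat; congr (_ * _).
rewrite /char_poly_mx map_mx0 subr0 det_scalar big_nseq.
by rewrite subr0 iter_mulr mulr1.
Qed.

End trace_comparison.

Section esd_integral.
Variable R : realType.
Local Notation V := (measurableTypeR R).
Variables (n : nat) (M : 'M[R]_n.+1).

Lemma ge0_integral_esd (f : V -> R) : measurable_fun setT f -> (forall x, 0 <= f x) ->
  (\int[esd M]_x (f x)%:E = (avg (eigenvalues M) f)%:E)%E.
Proof.
move=> mf f0; rewrite /esd.
have mfE : measurable_fun setT (EFin \o f) by exact/measurable_EFinP.
rewrite ge0_integral_mscale//; last by move=> x _; rewrite lee_fin.
rewrite ge0_integral_measure_sum//; last by move=> x _; rewrite lee_fin.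
rewrite (eq_bigr (fun i : 'I_n.+1 => (f (nth 0 (eigenvalues M) i))%:E)).
  rewrite sumEFin -EFinM /avg size_eigenvalues; congr ((_ * _)%:E).
  by rewrite [RHS](big_nth 0) big_mkord size_eigenvalues.
by move=> i _; rewrite integral_dirac// diracT mul1e.
Qed.

Lemma integ_esd (f : V -> R) : measurable_fun setT f -> integ (esd M) f.
Proof.
move=> mf; apply/integrableP; split; first exact/measurable_EFinP.
have := @ge0_integral_esd (fun x => `|f x|) _ (fun x => normr_ge0 _).
by move=> /= ->; [exact: ltry|exact: measurableT_comp].
Qed.

Lemma Ex_esd (f : V -> R) : measurable_fun setT f ->
  Ex (esd M) f = avg (eigenvalues M) f.
Proof.
move=> mf.
have ge0 (g : V -> R) : measurable_fun setT g -> (forall x, 0 <= g x) ->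
    Ex (esd M) g = avg (eigenvalues M) g.
  by move=> mg g0; rewrite /Ex /Rintegral ge0_integral_esd.
have mn : measurable_fun setT (fun x => `|f x|) by exact: measurableT_comp.
have mp : measurable_fun setT (fun x => `|f x| + f x) by exact: measurable_funD.
have -> : f = (fun x => (`|f x| + f x) - `|f x|).
  by apply/funext => x; rewrite addrAC subrr add0r.
rewrite ExB; [|exact: integ_esd|exact: integ_esd].
rewrite !ge0//; last first.
  by move=> x; have := ler_norm (- f x); rewrite normrN; lra.
by rewrite /avg -mulrBr -sumrB.
Qed.

End esd_integral.

(** * Words, edges and the variance of traces *)

Section words.
Implicit Types (n m v : nat) (w : seq nat).

(** Index set for the expansion of the trace of a power of a matrix. Lists
allow to split off letters one at a time, and to rotate and to concatenate
words. *)
Fixpoint words n m : seq (seq nat) :=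
  if m is m'.+1 then [seq v :: w | v <- iota 0 n, w <- words n m'] else [:: [::]].

Lemma mem_words n m w : (w \in words n m) = (size w == m) && all (fun v => v < n)%N w.
Proof.
elim: m w => [|m IH] [|v w] /=; rewrite ?inE//.
  by apply/negbTE/negP => /allpairsP[[? ?] [_ _]].
apply/allpairsP/idP => /=.
  by move=> [[a u] /= [ain uin [-> ->]]]; move: ain uin;
    rewrite mem_iota /= IH => -> /andP[/eqP-> ->]; rewrite eqxx.
rewrite eqSS => /andP[sw /andP[vn aw]]; exists (v, w); rewrite /= mem_iota vn; split=> //.
by rewrite IH sw aw.
Qed.

Lemma uniq_words n m : uniq (words n m).
Proof.
elim: m => //= m IH; apply: allpairs_uniq => //; first exact: iota_uniq.
by move=> [a u] [b v] _ _ /= [-> ->].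
Qed.

Variables (U : Type) (idx : U) (op : Monoid.com_law idx).

Lemma sum_wordsS n m (F : seq nat -> U) :
  \big[op/idx]_(w <- words n m.+1) F w =
  \big[op/idx]_(v <- iota 0 n) \big[op/idx]_(w <- words n m) F (v :: w).
Proof. by rewrite big_allpairs_dep. Qed.

Lemma sum_words_cat n a b (F : seq nat -> U) :
  \big[op/idx]_(w <- words n (a + b)) F w =
  \big[op/idx]_(u <- words n a) \big[op/idx]_(v <- words n b) F (u ++ v).
Proof.
elim: a F => [|a IH] F; first by rewrite add0n big_seq1.
rewrite addSn !sum_wordsS; apply: eq_bigr => v _.
exact: IH (fun w => F (v :: w)).
Qed.

Lemma sum_words_rot n m s (F : seq nat -> U) :
  \big[op/idx]_(w <- words n m) F (rot s w) = \big[op/idx]_(w <- words n m) F w.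
Proof.
rewrite -(big_map (rot s) xpredT F); apply: perm_big; apply: uniq_perm.
- by rewrite map_inj_uniq; [exact: uniq_words|exact: rot_inj].
- exact: uniq_words.
- move=> w; apply/mapP/idP => [[u + ->]|].
    by rewrite !mem_words size_rot (perm_all _ (permEl (perm_rot s u))).
  rewrite mem_words => /andP[sw aw]; exists (rotr s w); last by rewrite rotrK.
  by rewrite mem_words size_rotr sw (perm_all _ (permEl (perm_rotr s w))).
Qed.

End words.
Arguments words : simpl never.

Lemma sum_count (T : Type) (s : seq T) (p : pred T) b :
  (count p s * b = \sum_(v <- s) p v * b)%N.
Proof.
elim: s => [|v s IH] /=; first by rewrite big_nil.
by rewrite big_cons -IH mulnDl.
Qed.

Lemma sum_seq_const (T : Type) (s : seq T) c :
  (\sum_(v <- s) c = size s * c)%N.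
Proof. by elim: s => [|v s IH]; rewrite ?big_nil// big_cons IH mulSn. Qed.

Section edges.
Variable L : nat -> nat -> nat.
Hypothesis L2 : forall n u e, (count (fun v => L v u == e) (iota 0 n) <= 2)%N.

(** The values of the link function along the cyclic word [w], the edge from
the last letter back to the first one coming first. *)
Definition cedges (w : seq nat) := pairmap L (last 0%N w) w.

Lemma size_cedges w : size (cedges w) = size w.
Proof. exact: size_pairmap. Qed.

Lemma cedges_cat_swap u v : cedges (v ++ u) = 
  drop (size u) (cedges (u ++ v)) ++ take (size u) (cedges (u ++ v)).
Proof.
rewrite /cedges !pairmap_cat.
case: u => [|a u]; first by rewrite /= !cats0 drop0 take0 ?cats0.
case: v => [|b v]; first by rewrite cats0 /= !take_oversize ?drop_oversize ?cats0 //= size_pairmap.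
rewrite drop_size_cat ?size_pairmap// take_size_cat ?size_pairmap//.
by rewrite !last_cat.
Qed.

Lemma cedges_rot s w : cedges (rot s w) = rot s (cedges w).
Proof.
have [sw|ws] := leqP s (size w); last first.
  by rewrite !rot_oversize ?size_cedges// ltnW.
rewrite /rot cedges_cat_swap cat_take_drop size_takel//.
Qed.

(** Only the open walk is considered, without the closing edge, so that
removing the first letter leaves a walk. *)
Definition few_links d (w : seq nat) :=
  (size (undup (pairmap L (head 0%N w) (behead w))) <= d)%N.

Lemma count_links n u (T : seq nat) :
  (count (fun v => L v u \in T) (iota 0 n) <= 2 * size T)%N.
Proof.
elim: T => [|e T IH]; first by rewrite (eq_count (a2 := pred0)) ?count_pred0.
apply: leq_trans (_ : count (fun v => L v u == e) (iota 0 n) +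
   count (fun v => L v u \in T) (iota 0 n) <= _)%N.
  rewrite -count_predUI; apply: leq_trans (leq_addr _ _).
  by apply: sub_count => v /=; rewrite in_cons.
by rewrite /= mulnS leq_add.
Qed.

(** A new letter in front of a word either creates a new edge value, and may
be any of the [n] vertices, or reuses one of the at most [m] previous values,
and then has at most [2 * m] choices. Hence each of the [d] distinct values,
together with the end letter, costs a factor [n], and the other letters cost
constants. *)
Lemma few_links_count n m d :
  (\sum_(w <- words n m.+1) few_links d w <= (2 * m + 1) ^ m * n ^ d.+1)%N.
Proof.
elim: m d => [|m IH] d.
  rewrite expn0 mul1n sum_wordsS; under eq_bigr do rewrite big_seq1.
  apply: (@leq_trans (\sum_(v <- iota 0 n) 1)%N); first exact: leq_sum.
  rewrite sum1_size size_iota.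
  by case: n => // n; rewrite expnS leq_pmulr// expn_gt0.
rewrite sum_wordsS exchange_big /=.
pose T (w : seq nat) := pairmap L (head 0%N w) (behead w).
pose prev w := if d is d'.+1 then (few_links d' w : nat) else 0%N.
(* [prev] counts the words with one value less, to which a new value may be
added. *)
have stp w : w \in words n m.+1 ->
   (\sum_(v <- iota 0 n) few_links d (v :: w) <=
     n * prev w + 2 * m * few_links d w)%N.
  rewrite mem_words; case: w => // u w /andP[sw _].
  have E v : few_links d (v :: u :: w) =
     (size (undup (T (u :: w))) + (L v u \notin T (u :: w)) <= d)%N.
    by rewrite /few_links /= /T /=; case: ifP => _ /=; rewrite ?addn0 ?addn1.
  apply: (@leq_trans (\sum_(v <- iota 0 n) (prev (u :: w)
      + (L v u \in T (u :: w)) * few_links d (u :: w)))%N).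
    apply: leq_sum => v _; rewrite E; case: (L v u \in _) => /=.
      by rewrite addn0 mul1n leq_addl.
    rewrite mul0n addn0 /prev; case: d {E prev} => [|d]; first by rewrite addn1.
    by rewrite addn1 ltnS /few_links /T.
  rewrite big_split /= sum_seq_const size_iota leq_add2l -sum_count leq_mul2r.
  apply/orP; right; apply: leq_trans (count_links _ _ _) _.
  by rewrite leq_mul2l /= /T size_pairmap; move: sw; rewrite /= eqSS => /eqP->.
apply: (@leq_trans (\sum_(w <- words n m.+1) (n * prev w + 2 * m * few_links d w))%N).
  by rewrite big_seq [leqRHS]big_seq; apply: leq_sum => w /stp.
rewrite big_split /= -!big_distrr /=.
have IHd := IH d.
have IHp : (\sum_(w <- words n m.+1) prev w <= (2 * m + 1) ^ m * n ^ d)%N.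
  rewrite /prev; case: d {stp prev IHd} => [|d]; last exact: IH.
  by rewrite big1_eq.
apply: (@leq_trans ((2 * m + 1) ^ m.+1 * n ^ d.+1)%N).
  apply: leq_trans (leq_add (leq_mul (leqnn n) IHp) (leq_mul (leqnn _) IHd)) _.
  rewrite !expnS; lia.
rewrite leq_mul2r; apply/orP; right; rewrite leq_exp2r//; lia.
Qed.

(** A value that occurs exactly once contributes a factor of mean 0. *)
Definition single_free (s : seq nat) := all (fun j => 2 <= count_mem j s)%N s.

Definition linked_pair (w w' : seq nat) :=
  has (mem (cedges w)) (cedges w') && single_free (cedges w ++ cedges w').

(** Linked pairs after rotations that bring a common edge value to the first
position of both words, which allows to concatenate them. *)
Definition aligned_pair (w w' : seq nat) :=
  (head 0%N (cedges w) == head 0%N (cedges w')) &&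
  single_free (cedges w ++ cedges w').

Lemma sum_count_mem (u r : seq nat) : uniq u -> {subset r <= u} ->
  (\sum_(a <- u) count_mem a r = size r)%N.
Proof.
move=> uu; elim: r => [|b r IH] ru; first by rewrite big1.
have bu : b \in u by apply: ru; rewrite mem_head.
rewrite /= big_split /= IH => [|c cr]; last by apply: ru; rewrite in_cons cr orbT.
have -> : (\sum_(i <- u) (b == i) = 1)%N; last by rewrite add1n.
rewrite (bigD1_seq b)//= eqxx big1 ?addn0// => c cb.
by rewrite eq_sym (negbTE cb).
Qed.

(** Each value other than [v] occurs twice in [r], and [v], which has been
counted twice already, may occur once in [r]: this explains the extra 1. *)
Lemma single_free_undup v (r : seq nat) : single_free (v :: v :: r) ->
  (2 * size (undup r) <= (size r).+1)%N.
Proof.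
move=> /allP sf.
have ur := undup_uniq r.
have sr : (\sum_(a <- undup r) count_mem a r = size r)%N.
  by apply: sum_count_mem => // a; rewrite mem_undup.
have cv : (\sum_(a <- undup r) (a == v) = count_mem v (undup r))%N.
  by rewrite -[RHS]muln1 sum_count; apply: eq_bigr => a _; rewrite muln1.
apply: (@leq_trans (\sum_(a <- undup r) (count_mem a r + (a == v)))%N); last first.
  rewrite big_split /= sr cv count_uniq_mem// -addn1 leq_add2l.
  exact: leq_b1.
rewrite mulnC -sum_seq_const big_seq [leqRHS]big_seq.
apply: leq_sum => a; rewrite mem_undup => ar.
have := sf a; rewrite !in_cons ar !orbT => /(_ isT) /=.
rewrite !(eq_sym v); case: eqP => av; last by rewrite !add0n addn0.
by move=> _; rewrite addn1 ltnS -has_count has_pred1.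
Qed.

Lemma undup_insert (x y : seq nat) c :
  (size (undup (x ++ c :: y)) <= (size (undup (x ++ y))).+1)%N.
Proof.
have -> : size (undup (x ++ c :: y)) = size (undup (c :: x ++ y)).
  apply/perm_size/perm_undup => a.
  by rewrite !(mem_cat, in_cons) orbCA.
by rewrite /=; case: ifP => _ //; exact: leqW.
Qed.

(** The open walk along the concatenation has the edges of both words, except
the two closing ones, and a junction. The closing edges carry the common
value, so the other [2 * k - 2] edges take at most [k - 1] values, and the
junction adds one. This leaves [k + 1] free letters, against [k + 2] for two
words without a common edge. *)
Lemma aligned_few_links k w w' : (0 < k)%N -> size w = k -> size w' = k ->
  aligned_pair w w' -> few_links k (w ++ w').
Proof.
move=> k0; case: w => [sw|a u su]; first by rewrite -sw in k0.
case: w' => [sw'|b u' su']; first by rewrite -sw' in k0.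
rewrite /aligned_pair /few_links /cedges /=.
set c := L (last a u) a; set c' := L (last b u') b => /andP[/eqP <-].
rewrite pairmap_cat /= => sf.
apply: leq_trans (undup_insert _ _ _) _.
set r := _ ++ _ in sf *.
have sf' : single_free (c :: c :: pairmap L a u ++ pairmap L b u').
  have p : perm_eq (c :: r) (c :: c :: pairmap L a u ++ pairmap L b u').
    by rewrite perm_cons /r -(cat1s c (pairmap L b u')) perm_catCA.
  rewrite /single_free -(perm_all _ p); apply: sub_all sf => j.
  by rewrite (permP p).
have := single_free_undup sf'; rewrite size_cat !size_pairmap.
move: su su' => /= /eqP + /eqP; lia.
Qed.

Lemma aligned_count n k : (0 < k)%N ->
  (\sum_(w <- words n k) \sum_(w' <- words n k) aligned_pair w w' <=
   (2 * (2 * k).-1 + 1) ^ (2 * k).-1 * n ^ k.+1)%N.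
Proof.
move=> k0; apply: leq_trans (few_links_count n (2 * k).-1 k).
have -> : (2 * k).-1.+1 = (k + k)%N by lia.
rewrite sum_words_cat big_seq [leqRHS]big_seq; apply: leq_sum => w.
rewrite mem_words => /andP[/eqP sw _].
rewrite big_seq [leqRHS]big_seq; apply: leq_sum => w'.
rewrite mem_words => /andP[/eqP sw' _].
case: (boolP (aligned_pair w w')) => // al.
by rewrite aligned_few_links.
Qed.

Lemma linked_aligned w w' : linked_pair w w' ->
  exists s t, [/\ (s < size w)%N, (t < size w')%N & aligned_pair (rot s w) (rot t w')].
Proof.
move=> /andP[/hasP[j je' je] sf].
(* Rotating by the position of the common value [j] brings it to the front of
both edge lists. *)
exists (index j (cedges w)), (index j (cedges w')).
rewrite -(size_cedges w) -(size_cedges w') !index_mem; split=> //.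
have hd e : j \in e -> head 0%N (rot (index j e) e) = j.
  by move=> /rot_index ->.
rewrite /aligned_pair !cedges_rot !hd// eqxx /=.
set r := _ ++ _; have p : perm_eq r (cedges w ++ cedges w').
  by apply: perm_cat; rewrite perm_rot.
rewrite /single_free (perm_all _ p); apply: sub_all sf => i.
by rewrite (permP p).
Qed.

(** The common edge value may sit anywhere in both words, which costs a factor
[k ^ 2]. The power [n ^ k.+1] is one less than for all pairs of words without
single values: this gain is the decay of the variance. *)
Lemma linked_count n k : (0 < k)%N ->
  (\sum_(w <- words n k) \sum_(w' <- words n k) linked_pair w w' <=
   k ^ 2 * ((2 * (2 * k).-1 + 1) ^ (2 * k).-1 * n ^ k.+1))%N.
Proof.
move=> k0.
apply: (@leq_trans (\sum_(s < k) \sum_(t < k)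
   \sum_(w <- words n k) \sum_(w' <- words n k) aligned_pair (rot s w) (rot t w'))%N).
  under [leqRHS]eq_bigr do rewrite exchange_big.
  rewrite [leqRHS]exchange_big /= big_seq [leqRHS]big_seq; apply: leq_sum => w.
  rewrite mem_words => /andP[/eqP sw _].
  under [leqRHS]eq_bigr do rewrite exchange_big.
  rewrite [leqRHS]exchange_big /= big_seq [leqRHS]big_seq; apply: leq_sum => w'.
  rewrite mem_words => /andP[/eqP sw' _].
  case: (boolP (linked_pair w w')) => // /linked_aligned[s [t [sk tk al]]].
  rewrite sw in sk; rewrite sw' in tk.
  rewrite (bigD1 (Ordinal sk))//= (bigD1 (Ordinal tk))//= al.
  by rewrite -addnA ltn_addr.
have E (s t : 'I_k) :
   (\sum_(w <- words n k) \sum_(w' <- words n k) aligned_pair (rot s w) (rot t w') =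
    \sum_(w <- words n k) \sum_(w' <- words n k) aligned_pair w w')%N.
  rewrite -[RHS](sum_words_rot addn n k s); apply: eq_bigr => w _.
  exact: (sum_words_rot addn n k t (fun w' => (aligned_pair (rot s w) w' : nat))).
rewrite (eq_bigr (fun=> k * (\sum_(w <- words n k) \sum_(w' <- words n k) aligned_pair w w'))%N); last first.
  move=> s _; rewrite (eq_bigr _ (fun t _ => E s t)).
  by rewrite sum_nat_const card_ord.
rewrite sum_nat_const card_ord mulnA mulnn leq_mul2l.
by apply/orP; right; exact: aligned_count.
Qed.

End edges.

Section trace_words.
Variables (R : realType) (L : nat -> nat -> nat).
Implicit Types (x : nat -> R) (n : nat).

(** Toeplitz and Hankel matrices are obtained from [`|i - j|] and [i + j]. The
link functions used below are symmetric and take each value at most twice in a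
column. *)
Definition link_mx x n : 'M[R]_n := \matrix_(i < n, j < n) x (L i j).

Lemma link_mxX x n k (i j : 'I_n.+1) : (link_mx x n.+1 ^+ k) i j =
  \sum_(w <- words n.+1 k)
    (last (i : nat) w == j)%:R * \prod_(e <- pairmap L i w) x e.
Proof.
elim: k i j => [|k IH] i j.
  by rewrite big_seq1 /= big_nil mulr1 expr0 mxE.
rewrite exprS -mulmxE mxE sum_wordsS -[iota 0 n.+1]/(index_iota 0 n.+1) big_mkord.
apply: eq_bigr => v _; rewrite mxE IH mulr_sumr; apply: eq_bigr => w _.
by rewrite /= big_cons mulrCA.
Qed.

Lemma trace_words x n k : (0 < k)%N -> \tr (link_mx x n.+1 ^+ k) =
  \sum_(w <- words n.+1 k) \prod_(e <- cedges L w) x e.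
Proof.
move=> k0; rewrite /mxtrace; under eq_bigr do rewrite link_mxX.
rewrite exchange_big /= big_seq [RHS]big_seq; apply: eq_bigr => w.
rewrite mem_words => /andP[/eqP sw aw].
case: w sw aw => [sw|a w sw aw]; first by rewrite -sw in k0.
have ln : (last a w < n.+1)%N.
  by apply: (allP aw); exact: mem_last.
rewrite (bigD1 (Ordinal ln))//= eqxx mul1r [X in _ + X]big1 ?addr0// => i il.
case: eqP => [e|_]; last by rewrite mul0r.
by case/eqP: il; apply/val_inj.
Qed.

End trace_words.

Section trace_variance.
Context {d : measure_display} {T : measurableType d} {R : realType}.
Variables (P : probability T R) (L : nat -> nat -> nat).
Hypothesis L2 : forall n u e, (count (fun v => L v u == e) (iota 0 n) <= 2)%N.
Variables (x : nat -> T -> R) (mo : nat -> R) (B : R).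
Hypothesis mx : forall j, measurable_fun setT (x j).
Hypothesis xB : forall j w, `|x j w| <= B.

(** The mean of the product of the inputs indexed by [s], for independent
inputs whose common moments are [mo]. *)
Definition moment_product (s : seq nat) : R := \prod_(j <- undup s) mo (count_mem j s).

Hypothesis xE : forall s, Ex P (fun w => \prod_(j <- s) x j w) = moment_product s.
Hypothesis mo1 : mo 1 = 0.

Lemma measurable_prod_inputs s : measurable_fun setT (fun w => \prod_(j <- s) x j w).
Proof.
elim: s => [|j s IH].
  rewrite (_ : (fun w => _) = (fun=> 1)); first exact: measurable_cst.
  by apply/funext => w; rewrite big_nil.
rewrite (_ : (fun w => _) = (fun w => x j w * \prod_(j <- s) x j w)).
  exact: measurable_funM.
by apply/funext => w; rewrite big_cons.
Qed.

Lemma prod_inputs_bound s w : `|\prod_(j <- s) x j w| <= B ^+ size s.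
Proof.
elim: s => [|j s IH]; first by rewrite big_nil normr1.
rewrite big_cons normrM exprS; apply: ler_pM => //.
Qed.

Lemma integ_prod_inputs s : integ P (fun w => \prod_(j <- s) x j w).
Proof.
exact: (integ_bounded P (measurable_prod_inputs s) (prod_inputs_bound s)).
Qed.

Lemma moment_product_bound s : `|moment_product s| <= B ^+ size s.
Proof.
rewrite -xE; apply: Ex_bounded; first exact: measurable_prod_inputs.
exact: prod_inputs_bound.
Qed.

Lemma moment_product_cat e e' : ~~ has (mem e) e' ->
  moment_product (e ++ e') = moment_product e * moment_product e'.
Proof.
move=> h; have dis a : a \in e -> a \notin e'.
  by move=> ae; apply: contra h => ae'; apply/hasP; exists a.
rewrite /moment_product undup_cat big_cat /=.
have -> : [seq a <- undup e | a \notin e'] = undup e.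
  by apply/all_filterP/allP => a; rewrite mem_undup; exact: dis.
congr (_ * _); rewrite big_seq [RHS]big_seq; apply: eq_bigr => a.
  rewrite mem_undup => /dis ae'.
  by rewrite count_cat (count_memPn ae') addn0.
rewrite mem_undup => ae'; have ae : a \notin e by apply/negP => /dis; rewrite ae'.
by rewrite count_cat (count_memPn ae).
Qed.

Lemma moment_product_single s j : count_mem j s = 1%N -> moment_product s = 0.
Proof.
move=> cj; have js : j \in s by rewrite -has_pred1 has_count cj.
rewrite /moment_product (bigD1_seq j) ?mem_undup ?undup_uniq//= cj mo1.
by rewrite mul0r.
Qed.

(** The products over [e] and [e'] are independent when the two lists are
disjoint, and both terms vanish when some index occurs once. *)
Lemma covariance_inputs e e' k : size e = k -> size e' = k -> 0 <= B ->
  `|moment_product (e ++ e') - moment_product e * moment_product e'| <=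
  2 * B ^+ (2 * k) * (has (mem e) e' && single_free (e ++ e'))%:R.
Proof.
move=> se se' B0; case: (boolP (has _ _)) => [h|h] /=; last first.
  by rewrite moment_product_cat// subrr normr0 mulr0.
case: (boolP (single_free _)) => [_|].
  rewrite mulr1 mulr2n mulrDl mul1r; apply: le_trans (ler_normB _ _) _.
  apply: lerD.
    by apply: le_trans (moment_product_bound _) _; rewrite size_cat se se' mul2n addnn.
  rewrite normrM mul2n -addnn exprD; apply: ler_pM => //.
    by have := moment_product_bound e; rewrite se.
  by have := moment_product_bound e'; rewrite se'.
move=> /allPn[j je]; rewrite -leqNgt => cj.
have cj1 : count_mem j (e ++ e') = 1%N.
  by apply/eqP; rewrite eqn_leq cj -has_count has_pred1 je.
rewrite (moment_product_single cj1) sub0r normrN mulr0.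
suff -> : moment_product e * moment_product e' = 0 by rewrite normr0.
move: cj1; rewrite count_cat; case ce : (count_mem j e) => [|[|c]].
- by rewrite add0n => /moment_product_single ->; rewrite mulr0.
- by rewrite (moment_product_single ce) mul0r.
- by [].
Qed.

(** The variance is the sum of the covariances of pairs of words, and only
linked pairs contribute. With the normalization by [n ^+ 2 * n ^+ k] it decays
like [1 / n]. *)
Lemma trace_variance n k : (0 < k)%N -> 0 <= B ->
  let F w := \tr (link_mx L (x^~ w) n.+1 ^+ k) in
  integ P F /\ integ P (fun w => (F w - Ex P F) ^+ 2) /\
  Ex P (fun w => (F w - Ex P F) ^+ 2) <= 2 * B ^+ (2 * k) *
    (k ^ 2 * ((2 * (2 * k).-1 + 1) ^ (2 * k).-1 * n.+1 ^ k.+1))%:R.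
Proof.
move=> k0 B0 F.
have FE : F = fun w => \sum_(u <- words n.+1 k) \prod_(e <- cedges L u) x e w.
  by apply/funext => w; rewrite /F trace_words.
have F2E : (fun w => F w * F w) = (fun w => \sum_(u <- words n.+1 k)
    \sum_(v <- words n.+1 k) \prod_(e <- cedges L u ++ cedges L v) x e w).
  apply/funext => w; rewrite FE mulr_suml; apply: eq_bigr => u _.
  by rewrite mulr_sumr; apply: eq_bigr => v _; rewrite big_cat.
have iF : integ P F by rewrite FE; apply: integ_sum => u _; exact: integ_prod_inputs.
have iF2 : integ P (fun w => F w * F w).
  rewrite F2E; apply: integ_sum => u _; apply: integ_sum => v _.
  exact: integ_prod_inputs.
have sqE (c : R) : (fun w => (F w - c) ^+ 2) = (fun w => (F w * F w - (2 * c) * F w) + c ^+ 2).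
  by apply/funext => w; ring.
have i2 (c : R) : integ P (fun w => (F w - c) ^+ 2).
  rewrite sqE; apply: integD; last exact: integ_cst.
  by apply: integB => //; exact: integZ.
split=> //; split=> //.
rewrite sqE ExD ?ExB ?ExZ ?Ex_cst//; try exact: integ_cst; try exact: integZ; last first.
  by apply: integB => //; exact: integZ.
have -> : Ex P (fun w => F w * F w) - 2 * Ex P F * Ex P F + Ex P F ^+ 2 =
    Ex P (fun w => F w * F w) - Ex P F * Ex P F by ring.
rewrite F2E.
have EF : Ex P F = \sum_(u <- words n.+1 k) moment_product (cedges L u).
  rewrite FE Ex_sum => [|u _]; last exact: integ_prod_inputs.
  by apply: eq_bigr => u _; exact: xE.
rewrite Ex_sum => [|u _]; last by apply: integ_sum => v _; exact: integ_prod_inputs.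
rewrite EF mulr_suml -sumrB.
have -> : \sum_(u <- words n.+1 k) (Ex P (fun w => \sum_(v <- words n.+1 k)
     \prod_(e <- cedges L u ++ cedges L v) x e w) -
     moment_product (cedges L u) * \sum_(v <- words n.+1 k) moment_product (cedges L v)) =
  \sum_(u <- words n.+1 k) \sum_(v <- words n.+1 k)
    (moment_product (cedges L u ++ cedges L v) -
     moment_product (cedges L u) * moment_product (cedges L v)).
  apply: eq_bigr => u _; rewrite Ex_sum => [|v _]; last exact: integ_prod_inputs.
  by rewrite mulr_sumr -sumrB; apply: eq_bigr => v _; rewrite xE.
apply: le_trans (ler_norm _) _.
apply: le_trans (ler_norm_sum _ _ _) _.
apply: (@le_trans _ _ (\sum_(u <- words n.+1 k) \sum_(v <- words n.+1 k)
   2 * B ^+ (2 * k) * (linked_pair L u v)%:R)).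
  rewrite big_seq [leRHS]big_seq; apply: ler_sum => u.
  rewrite mem_words => /andP[/eqP su _].
  apply: le_trans (ler_norm_sum _ _ _) _.
  rewrite big_seq [leRHS]big_seq; apply: ler_sum => v.
  rewrite mem_words => /andP[/eqP sv _].
  by apply: covariance_inputs; rewrite ?size_cedges.
under eq_bigr do rewrite -mulr_sumr -natr_sum.
rewrite -mulr_sumr -natr_sum; apply: ler_wpM2l.
  by rewrite mulr_ge0// exprn_ge0.
by rewrite ler_nat; exact: linked_count.
Qed.

End trace_variance.

(** * Independent inputs *)

Section independence.
Context {d : measure_display} {T : measurableType d} {R : realType}.
Variable P : probability T R.
Implicit Type y : nat -> {RV P >-> R}.

(** Finite-valued transforms suffice below, and for them independence gives
the product rule for expectations by finite sums. *)
Definition finite_valued (h : R -> R) := exists V : seq R, forall t, h t \in V.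

Lemma finite_valued_bounded h : finite_valued h -> exists2 c : R, 0 <= c & forall t, `|h t| <= c.
Proof.
move=> [V hV]; exists (\sum_(v <- V) `|v|); first by apply: sumr_ge0.
by move=> t; rewrite (big_rem (h t))//= lerDl sumr_ge0.
Qed.

Lemma finite_valuedX h c : finite_valued h -> finite_valued (fun t => h t ^+ c).
Proof. by move=> [V hV]; exists [seq v ^+ c | v <- V] => t; exact: map_f. Qed.

Lemma measurable_RV (f : R -> R) (X : {RV P >-> R}) :
  measurable_fun setT f -> measurable_fun setT (fun w => f (X w)).
Proof. by move=> mf; exact: (measurableT_comp mf (@measurable_funPT _ _ _ _ X)). Qed.

Lemma measurable_RV_preimage (X : {RV P >-> R}) (B : set R) :
  measurable B -> measurable (X @^-1` B).
Proof.
by move=> mB; rewrite -[_ @^-1` _]setTI; apply: (@measurable_funPT _ _ _ _ X).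
Qed.

Lemma Ex_indic (A : set T) : measurable A -> Ex P (\1_A : T -> R) = fine (P A).
Proof. by move=> mA; rewrite /Ex /Rintegral integral_indic// setIT. Qed.

Lemma prod_indic y (B : nat -> set R) (J : seq nat) w :
  \prod_(j <- J) (\1_(y j @^-1` B j) w : R) =
  \1_(\bigcap_(j in [set` J]) (y j @^-1` B j)) w.
Proof.
elim: J => [|j J IH].
  by rewrite big_nil indicE mem_set// => j; rewrite /= in_nil.
rewrite big_cons IH !indicE -natrM mulnb; congr (_%:R); congr nat_of_bool.
apply/andP/idP => [[/set_mem h /set_mem h']|/set_mem h].
  by apply/mem_set => i /=; rewrite in_cons => /orP[/eqP->//|iJ]; exact: h'.
split; apply/mem_set; first by apply: h => /=; exact: mem_head.
by move=> i iJ; apply: h => /=; rewrite in_cons iJ orbT.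
Qed.

(** Transforms are traded for indicators one at a time: a finite-valued
function is a combination of the indicators of its level sets, which join the
second family. When only indicators remain, the statement is the definition of
independence. *)
Lemma independent_prod_mixed y (h : nat -> R -> R) : mutually_independent y ->
  (forall j, measurable_fun setT (h j)) -> (forall j, finite_valued (h j)) ->
  forall (J K : seq nat) (B : nat -> set R), uniq (J ++ K) ->
    (forall j, measurable (B j)) ->
    Ex P (fun w => \prod_(j <- J) h j (y j w) *
                   \prod_(j <- K) \1_(y j @^-1` B j) w) =
    \prod_(j <- J) Ex P (fun w => h j (y j w)) *
    \prod_(j <- K) fine (P (y j @^-1` B j)).
Proof.
move=> iy mh fh; elim=> [|a J IH] K B.
  rewrite cat0s => uK mB; rewrite big_nil mul1r.
  under eq_Ex do rewrite big_nil mul1r prod_indic.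
  rewrite Ex_indic; last first.
    rewrite bigcap_seq; apply: bigsetI_measurable => j _.
    exact: measurable_RV_preimage.
  rewrite iy//; elim: K {uK} => [|j K IH]; first by rewrite !big_nil.
  rewrite !big_cons fineM ?IH//; last first.
    apply: prode_fin_num => i _; apply: fin_num_measure.
  exact: measurable_RV_preimage.
  by apply: fin_num_measure; exact: measurable_RV_preimage.
rewrite cat_cons => /= /andP[aJK uJK] mB.
have [V0 hV0] := fh a; pose V := undup V0.
have hV t : h a t \in V by rewrite mem_undup.
have uV : uniq V by exact: undup_uniq.
have mv v : measurable (h a @^-1` [set v]).
  by rewrite -[_ @^-1` _]setTI; apply: mh.
pose B' v j := if j == a then h a @^-1` [set v] else B j.
have mB' v j : measurable (B' v j) by rewrite /B'; case: eqP.
have hE w : h a (y a w) = \sum_(v <- V) v * \1_(y a @^-1` B' v a) w.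
  rewrite (bigD1_seq (h a (y a w)))//= indicE mem_set; last first.
    by rewrite /= /B' eqxx.
  rewrite mulr1 big1 ?addr0// => v vh; rewrite indicE memNset ?mulr0//.
  by rewrite /= /B' eqxx => /= e; rewrite e eqxx in vh.
have ind_meas v j : measurable_fun setT (\1_(y j @^-1` B' v j) : T -> R).
  by apply: measurable_indic; exact: measurable_RV_preimage.
have ind_bd A (w : T) : `|\1_A w| <= 1 :> R.
  by rewrite indicE; case: (_ \in _); rewrite ?normr1 ?normr0.
have Eha : Ex P (fun w => h a (y a w)) = \sum_(v <- V) v * fine (P (y a @^-1` B' v a)).
  under eq_Ex do rewrite hE.
  have iv v : integ P (\1_(y a @^-1` B' v a) : T -> R).
    exact: (@integ_bounded _ _ _ _ _ 1).
  rewrite Ex_sum => [|v _]; last exact: integZ.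
  apply: eq_bigr => v _; rewrite ExZ// Ex_indic//; exact: measurable_RV_preimage.
have prodK v w : \prod_(j <- K) (\1_(y j @^-1` B j) w : R) =
                 \prod_(j <- K) \1_(y j @^-1` B' v j) w.
  rewrite big_seq [RHS]big_seq; apply: eq_bigr => j jK; rewrite /B'.
  by case: eqP jK => // -> aK; move: aJK; rewrite mem_cat aK orbT.
have prodPK v : \prod_(j <- K) fine (P (y j @^-1` B j)) =
                 \prod_(j <- K) fine (P (y j @^-1` B' v j)).
  rewrite big_seq [RHS]big_seq; apply: eq_bigr => j jK; rewrite /B'.
  by case: eqP jK => // -> aK; move: aJK; rewrite mem_cat aK orbT.
rewrite big_cons Eha !mulr_suml.
have mP (I : seq nat) (f : nat -> T -> R) : (forall j, measurable_fun setT (f j)) ->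
    measurable_fun setT (fun w => \prod_(j <- I) f j w).
  move=> mf; elim: I => [|j I IHI].
    rewrite (_ : (fun w => _) = (fun=> 1)); first exact: measurable_cst.
    by apply/funext => w; rewrite big_nil.
  rewrite (_ : (fun w => _) = (fun w => f j w * \prod_(j <- I) f j w)).
    exact: measurable_funM.
  by apply/funext => w; rewrite big_cons.
have bP (I : seq nat) (f : nat -> T -> R) : (forall j, exists2 c, 0 <= c & forall w, `|f j w| <= c) ->
    exists2 c, 0 <= c & forall w, `|\prod_(j <- I) f j w| <= c.
  move=> bf; elim: I => [|j I [c c0 IHI]].
    by exists 1 => // w; rewrite big_nil normr1.
  have [c' c'0 fc] := bf j; exists (c' * c); first exact: mulr_ge0.
  by move=> w; rewrite big_cons normrM ler_pM.
have bh j : exists2 c : R, 0 <= c & forall w, `|h j (y j w)| <= c.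
  by have [c c0 hc] := finite_valued_bounded (fh j); exists c.
have [c1 c10 hc1] := bP J _ bh.
have [c2 c20 hc2] := bP (a :: K) (fun j w => \1_(y j @^-1` B j) w) (fun j => ex_intro2 _ _ 1 ler01 (ind_bd _)).
have [c3 c30 hc3] : exists2 c, 0 <= c & forall v w, `|\prod_(j <- a :: K) \1_(y j @^-1` B' v j) w| <= c :> R.
  exists 1 => // v w; elim: (a :: K) => [|j I IHI]; first by rewrite big_nil normr1.
  by rewrite big_cons normrM -[leRHS]mul1r ler_pM.
have iV v : integ P (fun w => \prod_(j <- J) h j (y j w) *
     \prod_(j <- a :: K) \1_(y j @^-1` B' v j) w).
  apply: (@integ_bounded _ _ _ _ _ (c1 * c3)).
    apply: measurable_funM; apply: mP => j //.
    by apply: measurable_RV; exact: mh.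
  by move=> w; rewrite normrM ler_pM.
rewrite (eq_Ex _ (g := fun w => \sum_(v <- V) v * (\prod_(j <- J) h j (y j w) *
     \prod_(j <- a :: K) \1_(y j @^-1` B' v j) w))); last first.
  move=> w; rewrite big_cons hE !mulr_suml; apply: eq_bigr => v _.
  rewrite big_cons (prodK v); ring.
rewrite Ex_sum => [|v _]; last exact: integZ.
apply: eq_bigr => v _; rewrite ExZ// IH//; last first.
  by rewrite uniq_catC /= mem_cat orbC -mem_cat aJK uniq_catC.
rewrite big_cons (prodPK v); ring.
Qed.

Lemma independent_prod y (h : nat -> R -> R) (J : seq nat) :
  mutually_independent y ->
  (forall j, measurable_fun setT (h j)) -> (forall j, finite_valued (h j)) ->
  uniq J ->
  Ex P (fun w => \prod_(j <- J) h j (y j w)) =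
  \prod_(j <- J) Ex P (fun w => h j (y j w)).
Proof.
move=> iy mh fh uJ.
have := @independent_prod_mixed y h iy mh fh J [::] (fun=> setT).
rewrite cats0 => /(_ uJ (fun=> measurableT)); rewrite big_nil mulr1 => <-.
by apply: eq_Ex => w; rewrite big_nil mulr1.
Qed.

Lemma same_law y (f : R -> R) i j : identically_distributed y ->
  measurable_fun setT f -> integ P (fun w => f (y i w)) ->
  integ P (fun w => f (y j w)) /\
  Ex P (fun w => f (y j w)) = Ex P (fun w => f (y i w)).
Proof.
move=> idy mf iF.
have mE : measurable_fun setT (EFin \o f) by exact/measurable_EFinP.
have mY k := @measurable_funPT _ _ _ _ (y k).
have dE (g : R -> \bar R) : (\int[distribution P (y j)]_t g t =
     \int[distribution P (y i)]_t g t)%E.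
  by apply: eq_measure_integral => A mA _; exact: idy.
have m1 k : measurable_fun setT (EFin \o (fun w => f (y k w))).
  by apply/measurable_EFinP; exact: measurable_RV.
have ij : integ P (fun w => f (y j w)).
  apply/integrableP; split; first exact: m1.
  move/integrableP : iF => [_]; apply: le_lt_trans.
  have pf k : (\int[P]_w `|(f (y k w))%:E| = \int[distribution P (y k)]_t `|(f t)%:E|)%E.
    rewrite /distribution ge0_integral_pushforward//=.
    by apply/measurable_EFinP; exact: measurableT_comp.
  by rewrite [leLHS]pf [leRHS]pf dE.
split=> //; rewrite /Ex /Rintegral.
have pf k : integ P (fun w => f (y k w)) ->
   (\int[P]_w (f (y k w))%:E = \int[distribution P (y k)]_t (f t)%:E)%E.
  by move=> ik; rewrite /distribution (@integral_pushforward _ _ _ _ _ _ (mY k) P setT (EFin \o f)).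
by rewrite !pf// dE.
Qed.

Lemma input_moments y (g : R -> R) s :
  mutually_independent y -> identically_distributed y ->
  measurable_fun setT g -> finite_valued g ->
  Ex P (fun w => \prod_(j <- s) g (y j w)) =
  moment_product (fun c => Ex P (fun w => g (y 0%N w) ^+ c)) s.
Proof.
move=> iy idy mg fg; rewrite /moment_product.
have mX c : measurable_fun setT (fun t => g t ^+ c) by exact: measurable_funX.
transitivity (Ex P (fun w => \prod_(j <- undup s) g (y j w) ^+ count_mem j s)).
  apply: eq_Ex => w; rewrite -big_undup_iterop_count.
  exact: eq_bigr.
have h1 := @independent_prod y (fun j t => g t ^+ count_mem j s) (undup s) iy.
rewrite h1 ?undup_uniq// => [|j]; last exact: finite_valuedX.
apply: eq_bigr => j _.
have [] := @same_law y (fun t => g t ^+ count_mem j s) 0%N j idy => //.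
have [c c0 hc] := finite_valued_bounded (finite_valuedX (count_mem j s) fg).
apply: (@integ_bounded _ _ _ _ _ c) => //; exact: (@measurable_RV (fun t => g t ^+ _)).
Qed.

End independence.

(** * Growth of the moments for random signs *)

Section parity_words.
Variable L : nat -> nat -> nat.
Hypothesis Lsym : forall u v, L u v = L v u.
Hypothesis L2 : forall n u e, (count (fun v => L v u == e) (iota 0 n) <= 2)%N.
Variable n : nat.

(** The set of the values met an odd number of times, updated when the value
[e] is met. *)
Definition toggle (D : seq nat) e := if e \in D then rem e D else e :: D.

Lemma toggle_uniq D e : uniq D -> uniq (toggle D e).
Proof.
by move=> uD; rewrite /toggle; case: ifP => eD; rewrite ?rem_uniq//= eD.
Qed.

Lemma mem_toggles s D j : uniq D ->
  (j \in foldl toggle D s) = (j \in D) (+) odd (count_mem j s).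
Proof.
elim: s D => [|e s IH] D uD /=; first by rewrite addbF.
rewrite IH ?toggle_uniq// oddD /= addbA; congr (_ (+) _); rewrite /toggle.
case: ifP => eD; rewrite ?mem_rem_uniq// ?inE /=.
  by case: eqP => [->|/eqP je]; rewrite ?eqxx ?eD// eq_sym (negbTE je) /= addbF.
by case: eqP => [->|/eqP je]; rewrite ?eqxx ?eD// eq_sym (negbTE je) /= addbF.
Qed.

(** A bound for the number of walks of length [m] after which every value has
been met an even number of times, when [o] values are odd at the start: a step
either makes a new value odd, with at most [n] choices, or returns to one of
the [o] odd values, with at most [2 * o] choices. *)
Fixpoint walk_bound m o : nat :=
  if m is m'.+1 then n * walk_bound m' o.+1 + 2 * o * walk_bound m' o.-1
  else (o == 0).

Lemma walk_bound_le m D u : uniq D ->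
  (\sum_(w <- words n m) (foldl toggle D (pairmap L u w) == [::]) <=
   walk_bound m (size D))%N.
Proof.
elim: m D u => [|m IH] D u uD; first by rewrite big_seq1 /= size_eq0.
rewrite sum_wordsS /=.
apply: (@leq_trans (\sum_(v <- iota 0 n) (walk_bound m (size D).+1 +
   (L v u \in D) * walk_bound m (size D).-1))%N).
  apply: leq_sum => v _ /=; have := IH _ v (toggle_uniq (L u v) uD).
  rewrite (Lsym v u) /toggle; case: ifP => eD.
    by rewrite size_rem// mul1n => /leq_trans; apply; exact: leq_addl.
  by rewrite mul0n addn0.
rewrite big_split /= sum_seq_const size_iota leq_add2l -sum_count leq_mul2r.
by rewrite count_links ?orbT.
Qed.

Lemma walk_bound0 m o : (m < o)%N -> walk_bound m o = 0%N.
Proof.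
elim: m o => [|m IH] [|o]//= mo; rewrite !IH ?muln0//; lia.
Qed.

(** For [o = 0] the bound is [(2 * j)! / j! * n ^ j]; the general case makes
the induction work, where the two kinds of steps contribute in the proportions
[2 * j] and [o], which add up to the length of the walk. *)
Lemma walk_bound_fact o j :
  (j`! * walk_bound (o + 2 * j) o <= (o + 2 * j)`! * 2 ^ o * n ^ j)%N.
Proof.
move: {2}(o + 2 * j)%N (erefl (o + 2 * j)%N) => m; elim: m o j => [|m IH] o j E.
  have -> : o = 0%N by lia.
  by have -> : j = 0%N by lia.
rewrite E /= mulnDr factS.
have h1 : (j`! * (n * walk_bound m o.+1) <= 2 * j * (m`! * 2 ^ o * n ^ j))%N.
  case: j E => [|j] E; first by rewrite walk_bound0 ?muln0//; lia.
  have := IH o.+1 j; have -> : (o.+1 + 2 * j = m)%N by lia.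
  move=> /(_ erefl) h; rewrite factS.
  apply: (@leq_trans (j.+1 * n * (j`! * walk_bound m o.+1))%N); first lia.
  apply: leq_trans (leq_mul (leqnn _) h) _.
  rewrite !expnS; lia.
have h2 : (j`! * (2 * o * walk_bound m o.-1) <= o * (m`! * 2 ^ o * n ^ j))%N.
  case: o E {h1} => [|o] E; first by rewrite muln0 mul0n muln0.
  have := IH o j; have -> : (o + 2 * j = m)%N by lia.
  move=> /(_ erefl) h /=.
  apply: (@leq_trans (2 * o.+1 * (j`! * walk_bound m o))%N); first lia.
  apply: leq_trans (leq_mul (leqnn _) h) _.
  rewrite !expnS; lia.
apply: leq_trans (leq_add h1 h2) _.
rewrite -mulnDl addnC E; lia.
Qed.

Lemma even_words_count k : (0 < k)%N ->
  (k`! * \sum_(w <- words n (2 * k)) all (fun j => ~~ odd (count_mem j (cedges L w))) (cedges L w)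
   <= (2 * k)`! * n ^ k.+1)%N.
Proof.
case: k => // k _.
apply: (@leq_trans (k.+1`! * \sum_(u <- iota 0 n) \sum_(w <- words n (2 * k.+1))
   (foldl toggle [::] (pairmap L u w) == [::]))%N).
  rewrite leq_mul2l; apply/orP; right; rewrite exchange_big /=.
  rewrite big_seq [leqRHS]big_seq; apply: leq_sum => w; rewrite mem_words => /andP[/eqP sw aw].
  case: (boolP (all _ _)) => // /allP ev.
  have ln : last 0%N w \in iota 0 n.
    rewrite mem_iota /=; case: w sw aw {ev} => // a w _ aw.
    by apply: (allP aw); exact: mem_last.
  rewrite (big_rem _ ln) /=.
  suff -> : foldl toggle [::] (pairmap L (last 0%N w) w) = [::] by rewrite eqxx.
  set D := foldl _ _ _; have DE j : j \in D = false.
    rewrite mem_toggles//= -/(cedges L w).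
    have [/ev/negbTE//|jc] := boolP (j \in cedges L w).
    by rewrite (count_memPn jc).
  by case: D DE => // a D /(_ a); rewrite mem_head.
apply: (@leq_trans (\sum_(u <- iota 0 n) (2 * k.+1)`! * n ^ k.+1)%N).
  rewrite big_distrr /=; apply: leq_sum => u _.
  have := walk_bound_fact 0 k.+1; rewrite add0n muln1; apply: leq_trans.
  by rewrite leq_mul2l (@walk_bound_le _ [::] u)// orbT.
by rewrite sum_seq_const size_iota mulnCA -expnS.
Qed.

End parity_words.

Section moment_growth.
Context {d : measure_display} {T : measurableType d} {R : realType}.
Variables (P : probability T R) (L : nat -> nat -> nat).
Hypothesis Lsym : forall u v, L u v = L v u.
Hypothesis L2 : forall n u e, (count (fun v => L v u == e) (iota 0 n) <= 2)%N.
Variables (x : nat -> T -> R).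

(** For random signs, a word contributes 1 if each of its edge values occurs
an even number of times, and 0 otherwise. *)
Lemma sign_trace_growth (B : R) n k :
  (forall j, measurable_fun setT (x j)) -> (forall j w, `|x j w| <= B) ->
  (forall s, Ex P (fun w => \prod_(j <- s) x j w) =
             moment_product (fun c => (~~ odd c)%:R) s) ->
  Ex P (fun w => \tr (link_mx L (x^~ w) n.+1 ^+ (2 * k))) <=
  (2 * k)`!%:R / k`!%:R * n.+1%:R ^+ k.+1.
Proof.
move=> mx xB xE; case: k => [|k].
  rewrite (eq_Ex _ (g := fun=> n.+1%:R)).
    by rewrite Ex_cst muln0 divr1 mul1r expr1.
  by move=> w; rewrite muln0 expr0 mxtrace1.
have -> : (fun w => \tr (link_mx L (x^~ w) n.+1 ^+ (2 * k.+1))) =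
    fun w => \sum_(u <- words n.+1 (2 * k.+1)) \prod_(e <- cedges L u) x e w.
  by apply/funext => w; rewrite trace_words.
rewrite Ex_sum => [|u _]; last exact: integ_prod_inputs mx xB _.
rewrite (eq_bigr (fun u => (all (fun j => ~~ odd (count_mem j (cedges L u))) (cedges L u) : nat)%:R)).
  rewrite -natr_sum mulrAC ler_pdivlMr ?ltr0n ?fact_gt0// -natrX -!natrM ler_nat mulnC.
  exact: even_words_count.
move=> u _; rewrite xE /moment_product; set s := cedges L u.
rewrite -[all _ s]/(all (fun j => ~~ odd (count_mem j s)) s).
have -> : all (fun j => ~~ odd (count_mem j s)) s = all (fun j => ~~ odd (count_mem j s)) (undup s).
  by apply: eq_all_r => j; rewrite mem_undup.
by elim: (undup s) => [|j r IH]; rewrite ?big_nil// big_cons IH -natrM mulnb.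
Qed.

End moment_growth.

(** * An upper law of large numbers *)

Section almost_sure.
Context {d : measure_display} {T : measurableType d} {R : realType}.
Variable P : probability T R.

(** The sum of the functions has finite expectation, hence is finite almost
everywhere, and its terms tend to 0. This replaces the lemma of Borel and
Cantelli. *)
Lemma ae_cvg0 (F : nat -> T -> R) c :
  (forall n, integ P (F n)) -> (forall n w, 0 <= F n w) ->
  (forall N, \sum_(n < N) Ex P (F n) <= c) ->
  {ae P, forall w, F n w @[n --> \oo] --> 0}.
Proof.
move=> iF F0 Fc.
pose S w := (\sum_(n <oo) (F n w)%:E)%E.
have mF n : measurable_fun setT (EFin \o F n).
  by apply/measurable_EFinP; exact: integ_meas.
have SE : (\int[P]_w S w <= c%:E)%E.
  rewrite integral_nneseries//; last by move=> n w _; rewrite lee_fin.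
  under eq_eseriesr do rewrite (ExE (iF _)).
  apply: lime_le; first by apply: is_cvg_nneseries => n _ _; rewrite lee_fin Ex_ge0.
  by apply: nearW => N; rewrite big_mkord sumEFin lee_fin.
have iS : P.-integrable setT S.
  apply/integrableP; split.
    apply: (@ge0_emeasurable_sum _ _ _ setT (fun n w => (F n w)%:E) xpredT) => //.
      by move=> n w _ _; rewrite lee_fin.
    by move=> n _; exact: mF.
  rewrite (eq_integral S) => [|w _]; first by apply: le_lt_trans SE _; exact: ltry.
  by rewrite gee0_abs// nneseries_ge0// => n _ _; rewrite lee_fin.
have := integrable_ae measurableT iS; apply: filterS => w /(_ I) Sfin.
apply: cvg_series_cvg_0; apply: nondecreasing_is_cvgn.
  apply/nondecreasing_seqP => n; rewrite /series /= big_nat_recr//= lerDl//.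
exists (fine (S w)) => _ [N _ <-]; rewrite -lee_fin fineK// /series /= -sumEFin.
by apply: nneseries_lim_ge => n _ _; rewrite lee_fin.
Qed.

End almost_sure.

Lemma measurable_truncn (R : realType) : measurable_fun setT (fun t : R => (Num.truncn t)%:R : R).
Proof. by apply: nondecreasing_measurable => // x y xy; rewrite ler_nat le_truncn. Qed.

Section dyadic_sums.
Variable R : realFieldType.

(** With [a] the value of a nonnegative variable: the sum over dyadic times of
[2 ^ k] times the probability to exceed [2 ^ k] is at most twice the mean. *)
Lemma dyadic_tail_sum (a : R) N : 0 <= a ->
  \sum_(k < N) 2 ^+ k * (2 ^+ k < a)%R%:R <= 2 * a.
Proof.
move=> a0; elim: N => [|N IH]; first by rewrite big_ord0 mulr_ge0.
rewrite big_ord_recr /=; case: ltP => aN; last by rewrite mulr0 addr0.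
apply: (@le_trans _ _ (2 ^+ N + 2 ^+ N)); last by lra.
rewrite mulr1 lerD2r; elim: N {IH aN} => [|N IH]; first by rewrite big_ord0.
rewrite big_ord_recr exprS mulr2n mulrDl !mul1r; apply: lerD => //=.
by rewrite ler_piMr ?exprn_ge0//; case: (_ < _).
Qed.

(** The variances of the averages of variables cut at the level [2 ^ k], over
blocks of [2 ^ k] variables, have a sum bounded by a multiple of the mean. The
induction carries the tail of the geometric series, [2 * 2 ^- N * a ^+ 2]. *)
Lemma dyadic_head_sum (a : R) N : 0 <= a ->
  \sum_(k < N) (2 ^+ k)^-1 * (if a <= 2 ^+ k then a ^+ 2 else 0) <= 4 * a.
Proof.
move=> a0; apply: (@le_trans _ _ (if a <= 2 ^+ N then 4 * a - 2 * (2 ^+ N)^-1 * a ^+ 2 else 0)); last first.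
  case: ifP => _; last lra.
  by rewrite gerBl mulr_ge0 ?sqr_ge0// mulr_ge0// invr_ge0 exprn_ge0.
elim: N => [|N IH].
  rewrite big_ord0 expr0 invr1; case: ifP => // a1; nra.
rewrite big_ord_recr /=; have p0 : (0 : R) < 2 ^+ N by rewrite exprn_gt0.
have e2 : 2 * (2 ^+ N.+1)^-1 = (2 ^+ N)^-1 :> R.
  by rewrite exprS invfM mulrA divff ?mul1r// pnatr_eq0.
have i0 : 0 < (2 ^+ N : R)^-1 by rewrite invr_gt0.
rewrite e2; move: IH; case: (leP a (2 ^+ N)) => aN IH.
  rewrite ifT; last by rewrite exprS; lra.
  apply: le_trans (lerD IH (lexx _)) _; lra.
rewrite mulr0 addr0; apply: (le_trans IH); case: ifP => // aN1.
have : (2 ^+ N)^-1 * a <= 2 by rewrite ler_pdivrMl// mulrC -exprS.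
move=> h; have := ler_wpM2r a0 h; rewrite -mulrA -expr2; lra.
Qed.

Lemma geometric_half_sum N : \sum_(k < N) (2 ^+ k)^-1 <= 2 :> R.
Proof.
have -> : \sum_(k < N) (2 ^+ k)^-1 = 2 - 2 * (2 ^+ N)^-1 :> R.
  elim: N => [|N IH]; first by rewrite big_ord0 expr0 invr1; ring.
  rewrite big_ord_recr /= IH exprS invfM mulrA divff ?pnatr_eq0//; lra.
by rewrite gerBl mulr_ge0// invr_ge0 exprn_ge0.
Qed.

End dyadic_sums.

Section upper_lln.
Context {d : measure_display} {T : measurableType d} {R : realType}.
Variables (P : probability T R) (y : nat -> {RV P >-> R}).
Hypotheses (iy : mutually_independent y) (idy : identically_distributed y).

Lemma integ_finite_valued (g : R -> R) j : measurable_fun setT g -> finite_valued g ->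
  integ P (fun w => g (y j w)).
Proof.
move=> mg /finite_valued_bounded[c c0 gc].
by apply: (@integ_bounded _ _ _ _ _ c) => //; exact: measurable_RV.
Qed.

Lemma finite_valuedB (g : R -> R) c : finite_valued g -> finite_valued (fun t => g t - c).
Proof. by move=> [V gV]; exists [seq v - c | v <- V] => t; exact: (map_f (fun v => v - c)). Qed.

Lemma variance_of_sum (g : R -> R) n : measurable_fun setT g -> finite_valued g ->
  Ex P (fun w => g (y 0%N w)) = 0 ->
  let S w := \sum_(j < n) g (y j w) in
  integ P (fun w => S w ^+ 2) /\
  Ex P (fun w => S w ^+ 2) = n%:R * Ex P (fun w => g (y 0%N w) ^+ 2).
Proof.
move=> mg fg g0 S.
have [c c0 gc] := finite_valued_bounded fg.
have iij i j : integ P (fun w => g (y i w) * g (y j w)).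
  apply: (@integ_bounded _ _ _ _ _ (c * c)).
    by apply: measurable_funM; exact: measurable_RV.
  by move=> w; rewrite normrM ler_pM.
have S2 w : S w ^+ 2 = \sum_(i < n) \sum_(j < n) g (y i w) * g (y j w).
  by rewrite expr2 mulr_suml; apply: eq_bigr => i _; rewrite mulr_sumr.
have -> : (fun w => S w ^+ 2) = (fun w => \sum_(i < n) \sum_(j < n) g (y i w) * g (y j w)).
  exact/funext.
have mX : measurable_fun setT (fun t => g t ^+ 2) by exact: measurable_funX.
split; first by apply: integ_sum => i _; exact: integ_sum.
rewrite Ex_sum => [|i _]; last exact: integ_sum.
rewrite (eq_bigr (fun=> Ex P (fun w => g (y 0%N w) ^+ 2))).
  by rewrite sumr_const card_ord mulr_natl.
move=> i _; rewrite Ex_sum// (bigD1 i)//= big1 ?addr0 => [|j ji].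
  rewrite -(@same_law _ _ _ P y (fun t => g t ^+ 2) 0%N i idy mX _).2//.
  exact: integ_finite_valued mX (finite_valuedX 2 fg).
have uij : uniq [:: nat_of_ord i; nat_of_ord j].
  by rewrite /= in_cons orbF andbT; apply: contra ji => /eqP ij; apply/eqP/esym/val_inj.
have := @independent_prod _ _ _ P y (fun=> g) _ iy (fun=> mg) (fun=> fg) uij.
rewrite !big_cons big_nil mulr1.
rewrite (@same_law _ _ _ P y g 0%N i idy mg _).2 ?g0 ?mul0r; last exact: integ_finite_valued.
by move=> <-; apply: eq_Ex => w; rewrite !big_cons big_nil mulr1.
Qed.


Section clipped_rounding.
Variables (phi : R -> R) (eta : R).
Hypotheses (mphi : measurable_fun setT phi) (phi0 : forall t, 0 <= phi t) (eta0 : 0 < eta).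

(** The variable [phi], cut at the level [2 ^+ k] and rounded up to a multiple
of [eta], so that it takes finitely many values. *)
Definition rounded k (t : R) : R :=
  if phi t <= 2 ^+ k then eta * (Num.truncn (phi t / eta)).+1%:R else 0.

Lemma measurable_rounded k : measurable_fun setT (rounded k).
Proof.
apply: measurable_fun_ifT.
- by apply: measurable_fun_ler => //; exact: measurable_cst.
- apply: measurable_funM; first exact: measurable_cst.
  under eq_fun do rewrite -natr1.
  apply: measurable_funD; last exact: measurable_cst.
  have h : measurable_fun setT (fun t => phi t / eta).
    by apply: measurable_funM => //; exact: measurable_cst.
  exact: (measurableT_comp (@measurable_truncn R) h).
- exact: measurable_cst.
Qed.

Lemma finite_valued_rounded k : finite_valued (rounded k).
Proof.
exists (0 :: [seq eta * i.+1%:R | i <- iota 0 (Num.truncn (2 ^+ k / eta)).+1]) => t.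
rewrite /rounded; case: ifP => pt; last exact: mem_head.
rewrite in_cons; apply/orP; right.
apply: (map_f (fun i : nat => eta * i.+1%:R)); rewrite mem_iota/= ltnS.
by apply: le_truncn; rewrite ler_pM2r ?invr_gt0.
Qed.

Lemma rounded_ge k t : phi t <= 2 ^+ k -> phi t <= rounded k t.
Proof.
move=> pt; rewrite /rounded pt mulrC -ler_pdivrMr//; apply/ltW; exact: truncnS_gt.
Qed.

Lemma rounded_le k t : rounded k t <= (if phi t <= 2 ^+ k then phi t else 0) + eta.
Proof.
rewrite /rounded; case: ifP => pt; last by rewrite add0r ltW.
rewrite -natr1 mulrDr mulr1 lerD2r mulrC -ler_pdivlMr//.
by have /truncn_itv/andP[] : 0 <= phi t / eta by rewrite divr_ge0// ltW.
Qed.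

Lemma rounded_ge0 k t : 0 <= rounded k t.
Proof. by rewrite /rounded; case: ifP => // _; rewrite mulr_ge0// ltW. Qed.

Lemma rounded_le_add k t : rounded k t <= phi t + eta.
Proof.
by apply: le_trans (rounded_le _ _) _; rewrite lerD2r; case: ifP.
Qed.

Lemma rounded_sq k t :
  rounded k t ^+ 2 <= 2 * (if phi t <= 2 ^+ k then phi t ^+ 2 else 0) + 2 * eta ^+ 2.
Proof.
have := rounded_le k t; have := rounded_ge0 k t.
have -> : (if phi t <= 2 ^+ k then phi t ^+ 2 else 0) =
    (if phi t <= 2 ^+ k then phi t else 0) ^+ 2 by case: ifP => //; rewrite expr0n.
move: (if _ then _ else _) => p r0 rp.
apply: (@le_trans _ _ ((p + eta) ^+ 2)).
  by rewrite ler_pXn2r// nnegrE//; apply: le_trans rp.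
by have := sqr_ge0 (p - eta); rewrite !expr2; lra.
Qed.

End clipped_rounding.

(** Upper half of the strong law, for nonnegative integrable transforms. Along
dyadic times, almost surely no variable exceeds the cutting level from some
time on, and the variance of the averages of the cut variables is summable.
Nonnegativity compares other times with the next dyadic one, at the cost of
the factor 2. *)
Lemma lln_upper (phi : R -> R) eta :
  measurable_fun setT phi -> (forall t, 0 <= phi t) ->
  integ P (fun w => phi (y 0%N w)) -> 0 < eta ->
  {ae P, forall w, \forall n \near \oo,
    \sum_(j < n) phi (y j w) <= 2 * (Ex P (fun w => phi (y 0%N w)) + 2 * eta) * n%:R}.
Proof.
move=> mphi phi0 iphi eta0; set m := Ex P _.
pose h := rounded phi eta.
have mh k : measurable_fun setT (h k) by exact: measurable_rounded.
have fh k : finite_valued (h k) by exact: finite_valued_rounded.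
pose mk k := Ex P (fun w => h k (y 0%N w)).
pose g k t := h k t - mk k.
have mg k : measurable_fun setT (g k).
  by apply: measurable_funB; [exact: mh|exact: measurable_cst].
have fg k : finite_valued (g k) by exact: finite_valuedB.
have ih k : integ P (fun w => h k (y 0%N w)) by exact: integ_finite_valued.
have g0 k : Ex P (fun w => g k (y 0%N w)) = 0.
  by rewrite ExB//; [rewrite Ex_cst subrr|exact: integ_cst].
have mk_le k : mk k <= m + eta.
  rewrite -[eta in leRHS](Ex_cst P) -ExD//; last exact: integ_cst.
  by apply: Ex_le => //; [apply: integD => //; exact: integ_cst|move=> w;
    exact: rounded_le_add].
(* The number of the first [2 ^ k] variables that exceed [2 ^+ k] is an
integer, with summable means: it vanishes eventually. *)
pose u k t : R := (2 ^+ k < phi t)%R%:R.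
have mu_ k : measurable_fun setT (u k).
  rewrite (_ : u k = fun t => if 2 ^+ k < phi t then 1 else 0).
    apply: measurable_fun_ifT; try exact: measurable_cst.
    by apply: measurable_fun_ltr => //; exact: measurable_cst.
  by apply/funext => t; rewrite /u; case: (_ < _).
have u01 k t : 0 <= u k t <= 1 by rewrite /u; case: (_ < _); rewrite ?lexx ?ler01.
have iu k j : integ P (fun w => u k (y j w)).
  apply: (@integ_bounded _ _ _ _ _ 1); first exact: measurable_RV.
  by move=> w; have /andP[? ?] := u01 k (y j w); rewrite ger0_norm.
have aeF : {ae P, forall w, \sum_(j < 2 ^ k) u k (y j w) @[k --> \oo] --> 0}.
  apply: (@ae_cvg0 _ _ _ P (fun k w => \sum_(j < 2 ^ k) u k (y j w)) (2 * m)).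
  - by move=> k; exact: integ_sum.
  - by move=> k w; apply: sumr_ge0 => j _; have /andP[] := u01 k (y j w).
  move=> N; rewrite -ExZ// (eq_bigr (fun k : 'I_N => Ex P (fun w => 2 ^+ k * u k (y 0%N w)))).
    rewrite -Ex_sum => [|k _]; last exact: integZ.
    apply: Ex_le; [by apply: integ_sum => k _; exact: integZ|exact: integZ|].
    by move=> w; exact: dyadic_tail_sum.
  move=> k _; rewrite Ex_sum// ExZ// (eq_bigr (fun=> Ex P (fun w => u k (y 0%N w)))).
    by rewrite sumr_const card_ord -natrX mulr_natl.
  by move=> j _; exact: (same_law j idy (mu_ k) (iu k 0%N)).2.
have aeV : {ae P, forall w, ((2 ^+ k)^-1 * \sum_(j < 2 ^ k) g k (y j w)) ^+ 2 @[k --> \oo] --> 0}.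
  have vs k := variance_of_sum (2 ^ k) (mg k) (fg k) (g0 k).
  have iV k : integ P (fun w => ((2 ^+ k)^-1 * \sum_(j < 2 ^ k) g k (y j w)) ^+ 2).
    by under eq_fun do rewrite exprMn; apply: integZ; exact: (vs k).1.
  have ih2 k : integ P (fun w => h k (y 0%N w) ^+ 2).
    exact: (integ_finite_valued 0%N (measurable_funX 2 (mh k)) (finite_valuedX 2 (fh k))).
  apply: (@ae_cvg0 _ _ _ P _ (8 * m + 4 * eta ^+ 2)) => //.
    by move=> k w; exact: sqr_ge0.
  move=> N.
  have le1 k : Ex P (fun w => ((2 ^+ k)^-1 * \sum_(j < 2 ^ k) g k (y j w)) ^+ 2) <=
      Ex P (fun w => (2 ^+ k)^-1 * h k (y 0%N w) ^+ 2).
    under eq_Ex do rewrite exprMn.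
    rewrite ExZ ?(vs k).1// (vs k).2 ExZ// natrX expr2 mulrA -(mulrA (2 ^+ k)^-1).
    rewrite mulVf ?mulr1 ?expf_neq0 ?pnatr_eq0//.
    apply: ler_wpM2l; first by rewrite invr_ge0 exprn_ge0.
    have -> : (fun w => g k (y 0%N w) ^+ 2) =
       (fun w => (h k (y 0%N w) ^+ 2 - (2 * mk k) * h k (y 0%N w)) + mk k ^+ 2).
      by apply/funext => w; rewrite /g; ring.
    rewrite ExD; [|by apply: integB => //; exact: integZ|exact: integ_cst].
    rewrite ExB; [|exact: ih2|exact: integZ].
    rewrite ExZ// Ex_cst -/(mk k); have := sqr_ge0 (mk k); lra.
  apply: le_trans (ler_sum _ (fun (k : 'I_N) _ => le1 k)) _.
  rewrite -Ex_sum => [|k _]; last exact: integZ.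
  rewrite -[4 * eta ^+ 2](Ex_cst P) -[8 * m]ExZ// -ExD; [|exact: integZ|exact: integ_cst].
  apply: Ex_le.
  - by apply: integ_sum => k _; exact: integZ.
  - by apply: integD; [exact: integZ|exact: integ_cst].
  move=> w; set t := y 0%N w.
  apply: (@le_trans _ _ (\sum_(k < N) (2 * ((2 ^+ k)^-1 * (if phi t <= 2 ^+ k then phi t ^+ 2 else 0))
      + 2 * eta ^+ 2 * (2 ^+ k)^-1))).
    apply: ler_sum => k _.
    have i0 : 0 <= (2 ^+ k : R)^-1 by rewrite invr_ge0 exprn_ge0.
    have := ler_wpM2l i0 (rounded_sq phi0 eta0 k t); rewrite -/h => /le_trans; apply.
    by rewrite le_eqVlt; apply/orP; left; apply/eqP; ring.
  rewrite big_split /= -!mulr_sumr.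
  have h1 := dyadic_head_sum N (phi0 t).
  have h2 := geometric_half_sum R N.
  have h3 : 2 * eta ^+ 2 * \sum_(k < N) (2 ^+ k)^-1 <= 2 * eta ^+ 2 * 2.
    by apply: ler_wpM2l => //; rewrite mulr_ge0// sqr_ge0.
  lra.
apply: filterS2 aeF aeV => w Fw Vw.
(* One [eta] comes from rounding up, the other one from the fluctuation of the
average. *)
have [K _ HK] : \forall k \near \oo, \sum_(j < 2 ^ k) phi (y j w) <= 2 ^+ k * (m + 2 * eta).
  near=> k.
  have F1 : \sum_(j < 2 ^ k) u k (y j w) < 1 by near: k; apply: (cvgr_lt _ Fw).
  have V1 : ((2 ^+ k)^-1 * \sum_(j < 2 ^ k) g k (y j w)) ^+ 2 < eta ^+ 2.
    by near: k; apply: (cvgr_lt _ Vw); rewrite exprn_gt0.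
  have small (j : 'I_(2 ^ k)) : phi (y j w) <= 2 ^+ k.
    rewrite leNgt; apply/negP => lt; move: F1; rewrite (bigD1 j)//= {1}/u lt.
    by rewrite ltNge lerDl sumr_ge0// => i _; have /andP[] := u01 k (y i w).
  have p0 : 0 < (2 ^+ k : R) by rewrite exprn_gt0.
  have S1 : (2 ^+ k)^-1 * \sum_(j < 2 ^ k) g k (y j w) < eta.
    by rewrite ltNge; apply/negP => ge; move: V1;
      rewrite ltNge ler_pXn2r ?ge// nnegrE ltW//; apply: lt_le_trans ge.
  apply: (@le_trans _ _ (\sum_(j < 2 ^ k) (g k (y j w) + mk k))).
    by apply: ler_sum => j _; rewrite /g subrK rounded_ge.
  rewrite big_split /= sumr_const card_ord -[mk k *+ _]mulr_natl natrX.
  have : \sum_(j < 2 ^ k) g k (y j w) <= 2 ^+ k * eta.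
    by rewrite -ler_pdivrMl//; exact: ltW.
  have := ler_wpM2l (ltW p0) (mk_le k); lra.
exists (2 ^ K)%N => // n /= Kn.
have n0 : (0 < n)%N by apply: leq_trans Kn; rewrite expn_gt0.
have /andP[k1 k2] := @trunc_log_bounds 2 n isT n0.
set k := trunc_log 2 n in k1 k2.
have Kk : (K <= k)%N by rewrite /k -(trunc_expnK K (isT : 1 < 2)%N); exact: leq_trunc_log.
apply: (@le_trans _ _ (\sum_(j < 2 ^ k.+1) phi (y j w))).
  rewrite -!(big_mkord xpredT (fun j => phi (y j w))).
  rewrite [leRHS](big_cat_nat _ (ltnW k2))//= lerDl; exact: sumr_ge0.
apply: le_trans (HK k.+1 (leqW Kk)) _.
have mm : 0 <= m + 2 * eta.
  by rewrite addr_ge0 ?mulr_ge0// ?(ltW eta0)//; apply: Ex_ge0.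
rewrite exprS mulrAC; apply: ler_wpM2l; first by rewrite mulr_ge0.
by rewrite -natrX ler_nat.
Unshelve. all: by end_near.
Qed.

End upper_lln.

(** * Approximation by standardized finite-valued variables *)

Section simple_approximation.
Context {d : measure_display} {T : measurableType d} {R : realType}.
Variable P : probability T R.

(** Rounding downwards; the shift by [n.+1] makes the argument of the
truncation nonnegative. *)
Definition grid_round n (t : R) : R :=
  if `|t| <= n.+1%:R then (Num.truncn (n.+1%:R * (t + n.+1%:R)))%:R / n.+1%:R - n.+1%:R
  else 0.

Lemma measurable_grid_round n : measurable_fun setT (grid_round n).
Proof.
apply: measurable_fun_ifT.
- by apply: measurable_fun_ler; [exact: normr_measurable|exact: measurable_cst].
- apply: measurable_funB; last exact: measurable_cst.
  apply: measurable_funM; last exact: measurable_cst.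
  have h : measurable_fun setT (fun t : R => n.+1%:R * (t + n.+1%:R)).
    apply: measurable_funM; first exact: measurable_cst.
    by apply: measurable_funD => //; exact: measurable_cst.
  exact: (measurableT_comp (@measurable_truncn R) h).
- exact: measurable_cst.
Qed.

Lemma finite_valued_grid_round n : finite_valued (grid_round n).
Proof.
exists (0 :: [seq i%:R / n.+1%:R - n.+1%:R | i <- iota 0 (2 * n.+1 ^ 2).+1]) => t.
rewrite /grid_round; case: ifP => tn; last exact: mem_head.
rewrite in_cons; apply/orP; right.
apply: (map_f (fun i : nat => i%:R / n.+1%:R - n.+1%:R)); rewrite mem_iota/= ltnS.
move: tn; rewrite ler_norml => /andP[_ tn].
rewrite -[leqRHS](@natrK R); apply: le_truncn.
rewrite natrM natrX expr2 mulrCA; apply: ler_wpM2l => //; lra.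
Qed.

Lemma grid_round_dist n t : `|t| <= n.+1%:R -> `|t - grid_round n t| <= n.+1%:R^-1.
Proof.
move=> tn; rewrite /grid_round tn; set a := n.+1%:R.
have a0 : 0 < a by rewrite ltr0n.
move: tn; rewrite ler_norml -/a => /andP[tn _].
have ta : 0 <= t + a by lra.
have /truncn_itv/andP[h1 h2] : 0 <= a * (t + a) by rewrite mulr_ge0// ltW.
set m := Num.truncn _ in h1 h2 *; rewrite -natr1 in h2.
rewrite opprB addrA ger0_norm.
  have -> : t + a = (a * (t + a)) / a by rewrite mulrC mulKf ?lt0r_neq0.
  rewrite -mulrBl -[leRHS]mul1r ler_pM2r ?invr_gt0//; lra.
by rewrite subr_ge0 ler_pdivrMr// mulrC.
Qed.

Lemma grid_round_norm n t : `|grid_round n t| <= `|t| + 1.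
Proof.
case: (lerP `|t| n.+1%:R) => tn; last first.
  by rewrite /grid_round [X in if X then _ else _]leNgt tn /= normr0 addr_ge0.
have h := grid_round_dist tn.
have -> : grid_round n t = t - (t - grid_round n t) by ring.
apply: le_trans (ler_normB _ _) _; rewrite lerD2l; apply: le_trans h _.
by rewrite invf_le1 ?ltr0n// ler1n.
Qed.

Lemma grid_round_cvg t : grid_round n t @[n --> \oo] --> t.
Proof.
apply/cvgrPdist_le => e e0; near=> n.
apply: le_trans (grid_round_dist _) _.
  apply/ltW; apply: lt_le_trans (truncnS_gt _) _; rewrite ler_nat ltnS.
  by near: n; exact: nbhs_infty_ge.
rewrite -[leRHS]invrK lef_pV2 ?posrE ?invr_gt0// ?ltr0n//.
apply/ltW; apply: lt_le_trans (truncnS_gt _) _; rewrite ler_nat ltnS.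
by near: n; exact: nbhs_infty_ge.
Unshelve. all: by end_near.
Qed.

(** Rounding converges in mean square, so centering and normalizing the
rounded variable changes it little. Since both variables are standardized, the
squared distance is twice 1 minus their covariance, which tends to 0. *)
Lemma standardized_approximation (X : {RV P >-> R}) e : 0 < e ->
  integ P X -> integ P (fun w => X w ^+ 2) -> Ex P X = 0 -> Ex P (fun w => X w ^+ 2) = 1 ->
  exists g : R -> R, [/\ measurable_fun setT g, finite_valued g,
    Ex P (fun w => g (X w)) = 0 & Ex P (fun w => g (X w) ^+ 2) = 1] /\
    integ P (fun w => (X w - g (X w)) ^+ 2) /\
    Ex P (fun w => (X w - g (X w)) ^+ 2) <= e.
Proof.
move=> e0 iX iX2 EX EX2.
pose q n w := grid_round n (X w).
have mq n : measurable_fun setT (q n) by apply: measurable_RV; exact: measurable_grid_round.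
have mX : measurable_fun setT X by exact: integ_meas iX.
have qX w : q n w @[n --> \oo] --> X w by exact: grid_round_cvg.
have bq n w : `|q n w| <= `|X w| + 1 by exact: grid_round_norm.
have i1 : integ P (fun w => `|X w| + 1).
  by apply: integD; [exact: integ_norm|exact: integ_cst].
have i2 : integ P (fun w => 2 * X w ^+ 2 + 2).
  by apply: integD; [exact: integZ|exact: integ_cst].
have [_ cq] := Ex_dominated mq qX bq i1.
have mXq n : measurable_fun setT (fun w => X w * q n w) by exact: measurable_funM.
have mq2 n : measurable_fun setT (fun w => q n w ^+ 2) by exact: measurable_funX.
have bXq n w : `|X w * q n w| <= 2 * X w ^+ 2 + 2.
  rewrite normrM; have := bq n w; have := normr_ge0 (X w); have := normr_ge0 (q n w).
  rewrite -[X w ^+ 2]real_normK ?num_real//; set a := `|X w|; set b := `|q n w|; nra.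
have bq2 n w : `|q n w ^+ 2| <= 2 * X w ^+ 2 + 2.
  rewrite normrX; have := bq n w; have := normr_ge0 (X w); have := normr_ge0 (q n w).
  rewrite -[X w ^+ 2]real_normK ?num_real//; set a := `|X w|; set b := `|q n w| => b0 a0 ba.
  apply: (@le_trans _ _ ((a + 1) ^+ 2)); first by rewrite ler_pXn2r// nnegrE// addr_ge0.
  have := sqr_ge0 (a - 1); rewrite !expr2; lra.
have [_ cXq] : integ P (fun w => X w * X w) /\ Ex P (fun w => X w * q n w) @[n --> \oo] --> Ex P (fun w => X w * X w).
  apply: Ex_dominated mXq _ bXq i2 => w.
  by apply: cvgM; [exact: cvg_cst|exact: qX].
have [_ cq2] : integ P (fun w => X w ^+ 2) /\ Ex P (fun w => q n w ^+ 2) @[n --> \oo] --> Ex P (fun w => X w ^+ 2).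
  apply: Ex_dominated mq2 _ bq2 i2 => w.
  by under eq_fun do rewrite expr2; rewrite expr2; apply: cvgM; exact: qX.
have XX : Ex P (fun w => X w * X w) = 1 by rewrite -EX2; apply: eq_Ex => w; rewrite expr2.
rewrite EX in cq; rewrite XX in cXq; rewrite EX2 in cq2.
pose m n := Ex P (q n); pose v n := Ex P (fun w => q n w ^+ 2) - m n ^+ 2.
have cv : v n @[n --> \oo] --> (1 : R).
  rewrite [X in _ --> X](_ : 1 = 1 - 0 * 0 :> R); last by rewrite mul0r subr0.
  apply: cvgB => //; under eq_fun do rewrite expr2; exact: cvgM.
have cr : Ex P (fun w => X w * q n w) / Num.sqrt (v n) @[n --> \oo] --> (1 : R).
  rewrite [X in _ --> X](_ : 1 = 1 * (Num.sqrt 1)^-1 :> R); last by rewrite sqrtr1 invr1 mulr1.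
  apply: cvgM => //; apply: cvgV; first by rewrite sqrtr1 oner_neq0.
  exact: (continuous_cvg _ (@sqrt_continuous R 1) cv).
(* With [v n] the variance of the rounded variable, a rank at which
normalization is possible and the correlation is above [1 - e / 2]. *)
have [n [v0 rn]] : exists n, 0 < v n /\ 1 - e / 2 <= Ex P (fun w => X w * q n w) / Num.sqrt (v n).
  have h1 : \forall n \near \oo, 0 < v n by apply: (cvgr_gt _ cv).
  have h2 : \forall n \near \oo, 1 - e / 2 <= Ex P (fun w => X w * q n w) / Num.sqrt (v n).
    by apply: (cvgr_ge _ cr); rewrite ltrBlDr ltrDl divr_gt0.
  by have [N _ /(_ N (leqnn N))] := filterI h1 h2; exists N.
have s0 : 0 < Num.sqrt (v n) by rewrite sqrtr_gt0.
pose s := Num.sqrt (v n); have ss : s ^+ 2 = v n by rewrite sqr_sqrtr// ltW.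
have iq : integ P (q n) := integ_le (mq n) i1 (bq n).
have iXq : integ P (fun w => X w * q n w) := integ_le (mXq n) i2 (bXq n).
have iq2 : integ P (fun w => q n w ^+ 2) := integ_le (mq2 n) i2 (bq2 n).
pose g t := s^-1 * (grid_round n t - m n).
have fg : finite_valued g.
  have [V qV] := finite_valued_grid_round n.
  by exists [seq s^-1 * (v - m n) | v <- V] => t; exact: (map_f (fun v => s^-1 * (v - m n))).
have mg : measurable_fun setT g.
  apply: measurable_funM; first exact: measurable_cst.
  by apply: measurable_funB; [exact: measurable_grid_round|exact: measurable_cst].
have Eg2 : Ex P (fun w => g (X w) ^+ 2) = 1.
  have -> : (fun w => g (X w) ^+ 2) = fun w => (v n)^-1 * ((q n w ^+ 2 - (2 * m n) * q n w) + m n ^+ 2).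
    apply/funext => w; rewrite -ss /g /q; field; exact: lt0r_neq0.
  have j1 : integ P (fun w => q n w ^+ 2 - (2 * m n) * q n w).
    by apply: integB => //; exact: integZ.
  rewrite ExZ; last by apply: integD => //; exact: integ_cst.
  rewrite ExD//; last exact: integ_cst.
  rewrite ExB//; last exact: integZ.
  rewrite ExZ// Ex_cst -/(m n).
  rewrite (_ : _ + _ = v n) ?mulVf ?lt0r_neq0//; rewrite /v; ring.
have XgE : (fun w => X w * g (X w)) = fun w => s^-1 * (X w * q n w - m n * X w).
  by apply/funext => w; rewrite /g /q; ring.
have iXg : integ P (fun w => X w * g (X w)).
  by rewrite XgE; apply: integZ; apply: integB => //; exact: integZ.
have EXg : Ex P (fun w => X w * g (X w)) = Ex P (fun w => X w * q n w) / s.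
  rewrite XgE ExZ; last by apply: integB => //; exact: integZ.
  rewrite ExB//; last exact: integZ.
  by rewrite ExZ// EX mulr0 subr0 mulrC.
have ig2 : integ P (fun w => g (X w) ^+ 2).
  have [c c0 gc] := finite_valued_bounded (finite_valuedX 2 fg).
  apply: (@integ_bounded _ _ _ _ _ c) => //.
  by apply: measurable_funX; exact: measurable_RV.
have dE : (fun w => (X w - g (X w)) ^+ 2) =
    fun w => (X w ^+ 2 - 2 * (X w * g (X w))) + g (X w) ^+ 2.
  by apply/funext => w; ring.
have j2 : integ P (fun w => X w ^+ 2 - 2 * (X w * g (X w))).
  by apply: integB => //; exact: integZ.
exists g; split; [split=> //|split].
- rewrite ExZ; last by apply: integB => //; exact: integ_cst.
  by rewrite ExB//; [rewrite Ex_cst subrr mulr0|exact: integ_cst].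
- by rewrite dE; exact: integD.
- rewrite dE ExD// ExB//; last exact: integZ.
  rewrite ExZ// EX2 Eg2 EXg -/s; lra.
Unshelve. all: by end_near.
Qed.

End simple_approximation.

(** * Independent signs on the unit interval *)

Section standardization.
Context {d : measure_display} {T : measurableType d} {R : realType}.
Variables (P : probability T R) (X : {RV P >-> R}).

Lemma variance_centered : ('E_P[X] = 0)%E ->
  ('V_P[X] = \int[P]_w (X w ^+ 2)%:E)%E.
Proof.
move=> E0; rewrite /variance unlock E0 /= unlock.
apply: eq_integral => w _.
by rewrite -[(_ * _) w]/((X w - 0) * (X w - 0)) subr0 expr2.
Qed.

(** The second moment, as an integral of a nonnegative function, is the
variance; its finiteness makes the variable integrable. *)
Lemma standardized_moments : ('E_P[X] = 0)%E -> ('V_P[X] = 1)%E ->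
  [/\ integ P X, integ P (fun w => X w ^+ 2), Ex P X = 0 &
      Ex P (fun w => X w ^+ 2) = 1].
Proof.
move=> E0; rewrite variance_centered// => V1.
have mX : measurable_fun setT X by exact: measurable_funPT.
have iX2 : integ P (fun w => X w ^+ 2).
  apply/integrableP; split; first by apply/measurable_EFinP; exact: measurable_funX.
  rewrite (eq_integral (fun w => (X w ^+ 2)%:E)); first by rewrite V1 ltry.
  by move=> w _ /=; rewrite ger0_norm// sqr_ge0.
split=> //.
- apply: (@integ_le _ _ _ _ _ (fun w => X w ^+ 2 + 1)) => //.
    by apply: integD => //; exact: integ_cst.
  move=> w; rewrite -[X w ^+ 2]real_normK ?num_real//; have := normr_ge0 (X w).
  set a := `|X w|; have := sqr_ge0 (a - 1); rewrite !expr2; lra.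
- by move: E0; rewrite unlock /Ex /Rintegral => ->.
- by rewrite /Ex /Rintegral V1.
Qed.

Lemma standardizedP : integ P X -> integ P (fun w => X w ^+ 2) ->
  Ex P X = 0 -> Ex P (fun w => X w ^+ 2) = 1 -> ('E_P[X] = 0)%E /\ ('V_P[X] = 1)%E.
Proof.
move=> iX iX2 EX EX2.
have E0 : ('E_P[X] = 0)%E by rewrite unlock ExE// EX.
by split=> //; rewrite variance_centered// ExE// EX2.
Qed.

End standardization.

(** The difference is bounded by a multiple of the indicator of the
complement, which is null. *)
Lemma Ex_full_set {d : measure_display} {T : measurableType d} {R : realType}
  (P : probability T R) (A : set T) (f : T -> R) c :
  measurable A -> P A = 1%E -> measurable_fun setT f -> (forall t, `|f t| <= c) ->
  Ex P (fun t => \1_A t * f t) = Ex P f.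
Proof.
move=> mA PA mf fc.
have mi : measurable_fun setT (\1_A : T -> R) by exact: measurable_indic.
have i01 t : 0 <= (\1_A t : R) <= 1 by rewrite indicE; case: (_ \in _); rewrite /= ?lexx ?ler01.
have iA : integ P (\1_A : T -> R).
  apply: (@integ_bounded _ _ _ _ _ 1) => // t; have /andP[? ?] := i01 t.
  by rewrite ger0_norm.
have If : integ P f by exact: integ_bounded mf fc.
have IAf : integ P (fun t => \1_A t * f t).
  apply: (@integ_bounded _ _ _ _ _ c); first exact: measurable_funM.
  move=> t; have /andP[a0 a1] := i01 t; rewrite normrM (ger0_norm a0).
  by apply: le_trans (fc t); rewrite ler_piMl.
apply/eqP; rewrite -subr_eq0 -normr_le0 -ExB//.
have -> : 0 = Ex P (fun t => c * (1 - \1_A t)) :> R.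
  rewrite ExZ; last by apply: integB => //; exact: integ_cst.
  rewrite ExB//; last exact: integ_cst.
  by rewrite Ex_cst Ex_indic// PA /= subrr mulr0.
apply: Ex_norm_le => [||t]; first exact: integB.
  by apply: integZ; apply: integB => //; exact: integ_cst.
have /andP[a0 a1] := i01 t.
have -> : \1_A t * f t - f t = - ((1 - \1_A t) * f t) by ring.
by rewrite normrN normrM ger0_norm ?subr_ge0// mulrC ler_wpM2r// subr_ge0.
Qed.

Section rademacher.
Variable R : realType.
Local Notation U := (U01 R).
Local Notation V := (measurableTypeR R).

Definition dyadic k M : set V := `[k%:R / 2 ^+ M, k.+1%:R / 2 ^+ M[%classic.

(** The sign given by the binary digit number [j + 1] of [t]: the difference
of the two truncations is that digit. *)
Definition rademacher j (t : V) : R :=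
  1 - 2 * ((Num.truncn (2 ^+ j.+1 * t))%:R - 2 * (Num.truncn (2 ^+ j * t))%:R).

Lemma measurable_rademacher j : measurable_fun setT (rademacher j).
Proof.
have h i : measurable_fun setT (fun t : R => (Num.truncn (2 ^+ i * t))%:R : R).
  have h' : measurable_fun setT (fun t : R => 2 ^+ i * t).
    by apply: measurable_funM => //; exact: measurable_cst.
  exact: (measurableT_comp (@measurable_truncn R) h').
apply: measurable_funB; first exact: measurable_cst.
apply: measurable_funM; first exact: measurable_cst.
apply: measurable_funB; first exact: h.
apply: measurable_funM; [exact: measurable_cst|exact: h].
Qed.

Lemma rademacher_sign j t : rademacher j t = 1 \/ rademacher j t = -1.
Proof.
rewrite /rademacher; have [t0|t0] := ltP t 0.
  have h i : Num.truncn (2 ^+ i * t) = 0%N.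
    by apply/truncn0Pn; rewrite -ltNge; apply: lt_trans ltr01; rewrite pmulr_rlt0 ?exprn_gt0.
  by rewrite !h; left; ring.
have /truncn_itv/andP[h1 h2] : 0 <= 2 ^+ j * t by rewrite mulr_ge0// exprn_ge0.
have /truncn_itv/andP[h3 h4] : 0 <= 2 ^+ j.+1 * t by rewrite mulr_ge0// exprn_ge0.
set m := Num.truncn (2 ^+ j * t) in h1 h2 *; set m' := Num.truncn _ in h3 h4 *.
have : (2 * m <= m' < 2 * m + 2)%N.
  rewrite exprS -mulrA in h3 h4; apply/andP; split.
    by rewrite -ltnS -(ltr_nat R) natrM; apply: le_lt_trans h4; rewrite ler_pM2l.
  rewrite -(ltr_nat R) natrD natrM; apply: le_lt_trans h3 _.
  by rewrite -natr1 in h2; lra.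
move=> /andP[m1 m2]; have : (m' = 2 * m)%N \/ (m' = (2 * m).+1)%N by lia.
by move=> [->|->]; [left|right]; rewrite -?natr1 natrM; ring.
Qed.

Lemma dyadic_truncn k M t : dyadic k M t -> Num.truncn (2 ^+ M * t) = k.
Proof.
rewrite /dyadic /= in_itv/= => /andP[h1 h2]; apply: truncn_def.
have p : 0 < (2 ^+ M : R) by rewrite exprn_gt0.
by rewrite mulrC -ler_pdivrMr// h1 -ltr_pdivlMr.
Qed.

Lemma dyadic_split k M t : (\1_(dyadic k M) t : R) =
  \1_(dyadic (2 * k) M.+1) t + \1_(dyadic (2 * k).+1 M.+1) t.
Proof.
have p : (2 ^+ M : R) != 0 by rewrite expf_neq0 ?pnatr_eq0.
have e1 : (2 * k)%:R / 2 ^+ M.+1 = k%:R / 2 ^+ M :> R.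
  by rewrite natrM exprS; field.
have e2 : (2 * k).+2%:R / 2 ^+ M.+1 = k.+1%:R / 2 ^+ M :> R.
  have -> : (2 * k).+2 = (2 * k.+1)%N by lia.
  by rewrite natrM exprS; field.
have lt1 : (2 * k)%:R / 2 ^+ M.+1 < (2 * k).+1%:R / 2 ^+ M.+1 :> R.
  by rewrite ltr_pM2r ?invr_gt0 ?exprn_gt0// ltr_nat.
have lt2 : (2 * k).+1%:R / 2 ^+ M.+1 < (2 * k).+2%:R / 2 ^+ M.+1 :> R.
  by rewrite ltr_pM2r ?invr_gt0 ?exprn_gt0// ltr_nat.
rewrite !indicE /dyadic !mem_setE !in_itv /= e2 -e1.
set a := _ / _ in lt1 *; set b := _ / _ in lt1 lt2 *; set c := k.+1%:R / _ in e2 *.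
rewrite e2 in lt2.
case: (lerP a t) => ta /=; case: (ltrP t b) => tb /=; case: (ltrP t c) => tc /=;
  rewrite ?addr0 ?add0r//; lra.
Qed.

Lemma Ex_dyadic k M : (k < 2 ^ M)%N -> Ex U (\1_(dyadic k M)) = (2 ^+ M)^-1.
Proof.
move=> kM; rewrite Ex_indic; last exact: measurable_itv.
have p : 0 < (2 ^+ M : R) by rewrite exprn_gt0.
rewrite uniform_itv /=.
- by rewrite -mulrBl -natrB// subSnn mul1r.
- by rewrite divr_ge0// ltW.
- by rewrite ler_pM2r ?invr_gt0// ler_nat.
- by rewrite ler_pdivrMr// mul1r -natrX ler_nat.
Qed.

(** The mean of [f] at a random sign. *)
Definition sign_mean (f : R -> R) : R := (f 1 + f (-1)) / 2.

Lemma measurable_sign_prod (f : nat -> R -> R) (s : seq nat) :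
  (forall j, measurable_fun setT (f j)) ->
  measurable_fun setT (fun t => \prod_(j <- s) f j (rademacher j t)).
Proof.
move=> mf; elim: s => [|j s IH].
  rewrite (_ : (fun t => _) = (fun=> 1)); first exact: measurable_cst.
  by apply/funext => t; rewrite big_nil.
rewrite (_ : (fun t => _) = (fun t => f j (rademacher j t) * \prod_(j <- s) f j (rademacher j t))).
  apply: measurable_funM => //.
  exact: (measurableT_comp (mf j) (measurable_rademacher j)).
by apply/funext => t; rewrite big_cons.
Qed.

Lemma sign_prod_bound (f : nat -> R -> R) (s : seq nat) t :
  `|\prod_(j <- s) f j (rademacher j t)| <= \prod_(j <- s) (`|f j 1| + `|f j (-1)|).
Proof.
rewrite normr_prod; apply: ler_prod => j _; rewrite normr_ge0 /=.
by case: (rademacher_sign j t) => ->; rewrite ?lerDl ?lerDr.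
Qed.

Lemma integ_dyadic_prod (f : nat -> R -> R) (s : seq nat) k M :
  (forall j, measurable_fun setT (f j)) ->
  integ U (fun t => \1_(dyadic k M) t * \prod_(j <- s) f j (rademacher j t)).
Proof.
move=> mf; apply: (@integ_bounded _ _ _ _ _ (\prod_(j <- s) (`|f j 1| + `|f j (-1)|))).
  apply: measurable_funM; last exact: measurable_sign_prod.
  by apply: measurable_indic; exact: measurable_itv.
move=> t; rewrite normrM -[leRHS]mul1r; apply: ler_pM => //; last exact: sign_prod_bound.
by rewrite indicE; case: (_ \in _); rewrite ?normr1 ?normr0.
Qed.

(** A dyadic interval of level [M] splits into halves of level [M.+1], on
which the sign number [M] is constant with opposite values; induction on the
number of signs. *)
Lemma Ex_dyadic_prod (f : nat -> R -> R) n M k :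
  (forall j, measurable_fun setT (f j)) -> (k < 2 ^ M)%N ->
  Ex U (fun t => \1_(dyadic k M) t * \prod_(j <- iota M n) f j (rademacher j t)) =
  (2 ^+ M)^-1 * \prod_(j <- iota M n) sign_mean (f j).
Proof.
move=> mf; elim: n M k => [|n IH] M k kM.
  rewrite big_nil mulr1 -(Ex_dyadic kM).
  by apply: eq_Ex => t; rewrite big_nil mulr1.
have E t : \1_(dyadic k M) t * \prod_(j <- iota M n.+1) f j (rademacher j t) =
   f M 1 * (\1_(dyadic (2 * k) M.+1) t * \prod_(j <- iota M.+1 n) f j (rademacher j t)) +
   f M (-1) * (\1_(dyadic (2 * k).+1 M.+1) t * \prod_(j <- iota M.+1 n) f j (rademacher j t)).
  rewrite /= big_cons; set G := \prod_(j <- _) _.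
  have h1 : \1_(dyadic (2 * k) M.+1) t * f M (rademacher M t) = f M 1 * \1_(dyadic (2 * k) M.+1) t.
    rewrite indicE; case: (boolP (t \in _)) => [/set_mem td|_]; last by rewrite mulr0 mul0r.
    have tk : dyadic k M t.
      by apply/set_mem; have := dyadic_split k M t; rewrite !indicE (mem_set td);
        case: (t \in dyadic k M) => // /eqP; rewrite eq_sym /= gt_eqF// ltr_pwDl.
    by rewrite /rademacher (dyadic_truncn td) (dyadic_truncn tk) natrM subrr mulr0 subr0 mul1r mulr1.
  have h2 : \1_(dyadic (2 * k).+1 M.+1) t * f M (rademacher M t) = f M (-1) * \1_(dyadic (2 * k).+1 M.+1) t.
    rewrite indicE; case: (boolP (t \in _)) => [/set_mem td|_]; last by rewrite mulr0 mul0r.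
    have tk : dyadic k M t.
      by apply/set_mem; have := dyadic_split k M t; rewrite !indicE (mem_set td);
        case: (t \in dyadic k M) => // /eqP; rewrite eq_sym /= gt_eqF// ltr_wpDl.
    have -> : rademacher M t = -1; last by rewrite mul1r mulr1.
    by rewrite /rademacher (dyadic_truncn td) (dyadic_truncn tk) -(addn1 (2 * k)) natrD natrM; ring.
  rewrite dyadic_split mulrDl !mulrA [_ * f M _]mulrC mulrC.
  by rewrite h1 h2.
under eq_Ex do rewrite E.
have iD k' : integ U (fun t => \1_(dyadic k' M.+1) t * \prod_(j <- iota M.+1 n) f j (rademacher j t)).
  exact: integ_dyadic_prod.
rewrite ExD; [|exact: integZ|exact: integZ].
have k2 : (k.*2.+1 < 2 ^ M.+1)%N by rewrite expnS; lia.
rewrite !ExZ// !IH; [|by move: k2; lia|by move: k2; lia].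
have p : (2 ^+ M : R) != 0 by rewrite expf_neq0 ?pnatr_eq0.
rewrite /= big_cons; set Q := \prod_(_ <- _) _.
by rewrite /sign_mean exprS; field; rewrite ?p.
Qed.

Lemma U01_dyadic0 : U (dyadic 0 0) = 1%E.
Proof. by rewrite uniform_itv ?expr0 ?divr1 ?subr0. Qed.

(** The signs missing from [J] are inserted with the constant function 1, to
reach a full initial segment of signs. *)
Lemma Ex_sign_prod (f : nat -> R -> R) (J : seq nat) :
  (forall j, measurable_fun setT (f j)) -> uniq J ->
  Ex U (fun t => \prod_(j <- J) f j (rademacher j t)) =
  \prod_(j <- J) sign_mean (f j).
Proof.
move=> mf uJ; pose N := (\max_(j <- J) j).+1.
have JN j : j \in J -> (j < N)%N by move=> jJ; rewrite ltnS /N (big_rem j)//= leq_maxl.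
pose f' j := if j \in J then f j else fun=> 1.
have mf' j : measurable_fun setT (f' j).
  by rewrite /f'; case: ifP => // _; exact: measurable_cst.
have perm_J : perm_eq [seq j <- iota 0 N | j \in J] J.
  apply: uniq_perm => //; first by rewrite filter_uniq// iota_uniq.
  move=> j; rewrite mem_filter mem_iota /= add0n.
  by apply/andP/idP => [[]//|jJ]; rewrite JN.
have EJ (F : nat -> R) : \prod_(j <- iota 0 N) (if j \in J then F j else 1) = \prod_(j <- J) F j.
  by rewrite -big_mkcond /= -big_filter; exact: perm_big.
have := @Ex_dyadic_prod f' N 0 0 mf' isT; rewrite expr0 invr1 mul1r.
rewrite [X in _ = X -> _](_ : _ = \prod_(j <- J) sign_mean (f j)); last first.
  rewrite -EJ; apply: eq_bigr => j _; rewrite /f'; case: ifP => //.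
  by rewrite /sign_mean divff ?pnatr_eq0.
move=> <-.
have G t : \prod_(j <- iota 0 N) f' j (rademacher j t) = \prod_(j <- J) f j (rademacher j t).
  by rewrite -EJ; apply: eq_bigr => j _; rewrite /f'; case: ifP.
have m0 : measurable (dyadic 0 0) by exact: measurable_itv.
have iG : integ U (fun t => \prod_(j <- J) f j (rademacher j t)).
  exact: (integ_bounded U (measurable_sign_prod J mf) (sign_prod_bound f J)).
rewrite -(@Ex_full_set _ _ _ U (dyadic 0 0) _ (\prod_(j <- J) (`|f j 1| + `|f j (-1)|)) m0 U01_dyadic0).
- by apply: eq_Ex => t; rewrite G.
- exact: measurable_sign_prod.
- exact: sign_prod_bound.
Qed.

HB.instance Definition _ j :=
  isMeasurableFun.Build _ _ V R (rademacher j) (measurable_rademacher j).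

Definition rademacher_rv j : {RV U >-> R} := rademacher j.

Lemma rademacher_independent : mutually_independent rademacher_rv.
Proof.
move=> J B uJ mB.
have mJ j : measurable (rademacher_rv j @^-1` B j) by exact: measurable_RV_preimage.
have mI : measurable (\bigcap_(j in [set` J]) (rademacher_rv j @^-1` B j)).
  by rewrite bigcap_seq; apply: bigsetI_measurable => j _.
have mf j : measurable_fun setT (\1_(B j) : R -> R) by exact: measurable_indic.
have fin_P A : measurable A -> (U A = (Ex U (\1_A))%:E)%E.
  by move=> mA; rewrite Ex_indic// fineK// fin_num_measure.
rewrite fin_P// (eq_bigr (fun j => (Ex U (\1_(rademacher_rv j @^-1` B j)))%:E)); last first.
  by move=> j _; exact: fin_P.
rewrite prodEFin; congr EFin.
under eq_Ex do rewrite -prod_indic.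
transitivity (\prod_(j <- J) sign_mean (\1_(B j))).
  rewrite -(Ex_sign_prod (f := fun j => \1_(B j)) mf uJ).
  by apply: eq_Ex => t; apply: eq_bigr => j _; rewrite !indicE.
apply: eq_bigr => j _.
have := @Ex_sign_prod (fun j => \1_(B j)) [:: j] mf isT; rewrite big_seq1 => <-.
by apply: eq_Ex => t; rewrite big_seq1 !indicE.
Qed.

Lemma Ex_rademacher (f : R -> R) j : measurable_fun setT f ->
  Ex U (fun t => f (rademacher j t)) = sign_mean f.
Proof.
move=> mf; have := @Ex_sign_prod (fun=> f) [:: j] (fun=> mf) isT.
by rewrite big_seq1 => <-; apply: eq_Ex => t; rewrite big_seq1.
Qed.

Lemma rademacher_norm j t : `|rademacher j t| = 1.
Proof. by case: (rademacher_sign j t) => ->; rewrite ?normrN normr1. Qed.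

Lemma rademacher_sqr j t : rademacher j t ^+ 2 = 1.
Proof. by rewrite -real_normK ?num_real// rademacher_norm expr1n. Qed.

Lemma rademacher_standardized : standardized rademacher_rv.
Proof.
move=> j; apply: standardizedP.
- by apply: (@integ_bounded _ _ _ _ _ 1) => // t; rewrite rademacher_norm.
- rewrite (_ : (fun w => _) = fun=> 1); first exact: integ_cst.
  by apply/funext => t; exact: rademacher_sqr.
- have := @Ex_rademacher id j (@measurable_id _ _ setT); rewrite /sign_mean subrr mul0r => <-.
  exact: eq_Ex.
- by rewrite -[RHS](Ex_cst U); apply: eq_Ex => t; exact: rademacher_sqr.
Qed.

Lemma rademacher_bounded_moments : uniformly_bounded_moments rademacher_rv.
Proof.
move=> k; exists 1 => j; rewrite unlock (eq_integral (fun=> 1%:E)).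
  by rewrite integral_cst//= probability_setT mule1.
by move=> t _; rewrite rademacher_norm expr1n.
Qed.

Lemma rademacher_word_moment s :
  Ex U (fun t => \prod_(j <- s) rademacher j t) =
  moment_product (fun c => (~~ odd c)%:R) s.
Proof.
rewrite /moment_product.
transitivity (Ex U (fun t => \prod_(j <- undup s) rademacher j t ^+ count_mem j s)).
  by apply: eq_Ex => t; rewrite -big_undup_iterop_count; exact: eq_bigr.
rewrite (@Ex_sign_prod (fun j u => u ^+ count_mem j s)) ?undup_uniq//.
apply: eq_bigr => j _; rewrite /sign_mean expr1n -signr_odd.
by case: odd; rewrite /= ?expr1 ?expr0 ?subrr ?mul0r// divff ?pnatr_eq0.
Qed.

End rademacher.

(** * Matrices of different sizes *)

Section link_sums.
Variables (R : realType) (L : nat -> nat -> nat).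
Hypothesis Lsym : forall u v, L u v = L v u.
Hypothesis L2 : forall n u e, (count (fun v => L v u == e) (iota 0 n) <= 2)%N.
Hypothesis Llt : forall u v n, (u < n)%N -> (v < n)%N -> (L u v < 2 * n)%N.
Variables (h : nat -> R) (N : nat).
Hypothesis h0 : forall l, 0 <= h l.

(** In a column each value of the link function occurs at most twice. *)
Lemma link_row_sum a d u : (a + d <= N)%N -> (u < N)%N ->
  \sum_(i < d) h (L (a + i)%N u) <= 2 * \sum_(l < 2 * N) h l.
Proof.
move=> adN uN.
have -> : \sum_(i < d) h (L (a + i)%N u) = \sum_(a <= v < a + d) h (L v u).
  have := @big_addn R 0 +%R 0%N (a + d)%N a xpredT (fun v => h (L v u)).
  by rewrite add0n => ->; rewrite addKn big_mkord; apply: eq_bigr => i _; rewrite addnC.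
apply: (@le_trans _ _ (\sum_(0 <= v < N) h (L v u))).
  rewrite [leRHS](big_cat_nat (leq0n a) _)/=; last by apply: leq_trans adN; exact: leq_addr.
  rewrite [X in _ <= _ + X](big_cat_nat (leq_addr d a) adN)/=.
  by rewrite addrCA lerDl addr_ge0// sumr_ge0.
have E v : v \in iota 0 N -> h (L v u) = \sum_(l < 2 * N) (L v u == l :> nat)%:R * h l.
  rewrite mem_iota add0n => /andP[_ vN].
  rewrite (bigD1 (Ordinal (Llt vN uN)))//= eqxx mul1r big1 ?addr0// => l lv.
  have -> : (L v u == l :> nat) = false; last by rewrite mul0r.
  by apply/negbTE; apply: contra lv => /eqP e; apply/eqP/val_inj.
rewrite /index_iota subn0 (eq_big_seq _ E) exchange_big /= mulr_sumr.
apply: ler_sum => l _; rewrite -mulr_suml; apply: ler_wpM2r => //.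
rewrite -natr_sum ler_nat; apply: leq_trans (L2 N u l).
by rewrite -[leqRHS]muln1 sum_count leq_sum// => v _; rewrite muln1.
Qed.

Lemma link_block_sum a d b c : (a + d <= N)%N -> (b + c <= N)%N ->
  \sum_(i < d) \sum_(j < c) h (L (a + i)%N (b + j)%N) <=
  c%:R * (2 * \sum_(l < 2 * N) h l).
Proof.
move=> ad bc; rewrite exchange_big /=.
apply: (@le_trans _ _ (\sum_(j < c) 2 * \sum_(l < 2 * N) h l)).
  apply: ler_sum => j _; apply: link_row_sum => //.
  by apply: leq_trans bc; rewrite ltn_add2l.
by rewrite sumr_const card_ord -[_ *+ c]mulr_natl.
Qed.

End link_sums.

Section size_comparison.
Variables (R : realType) (L : nat -> nat -> nat).
Hypothesis Lsym : forall u v, L u v = L v u.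
Hypothesis L2 : forall n u e, (count (fun v => L v u == e) (iota 0 n) <= 2)%N.
Hypothesis Llt : forall u v n, (u < n)%N -> (v < n)%N -> (L u v < 2 * n)%N.

Lemma link_mx_sym (x : nat -> R) n : (normalized (link_mx L x n))^T = normalized (link_mx L x n).
Proof. by apply/matrixP => i j; rewrite !mxE Lsym. Qed.

(** The sum of the squares of the eigenvalues is the sum of the squares of the
entries. *)
Lemma link_second_moment (y : nat -> R) n :
  avg (eigenvalues (normalized (link_mx L y n.+1))) (fun x => x ^+ 2) <=
  2 * (n.+1%:R^-1 * \sum_(l < 2 * n.+1) y l ^+ 2).
Proof.
set M := normalized _.
rewrite /avg size_eigenvalues sum_eigenvalues_power ?link_mx_sym//.
rewrite mulrCA; apply: ler_wpM2l; first by rewrite invr_ge0.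
have -> : \tr (M ^+ 2) = n.+1%:R^-1 * \sum_(i < n.+1) \sum_(j < n.+1) y (L (0 + i)%N (0 + j)%N) ^+ 2.
  rewrite expr2 -mulmxE /mxtrace mulr_sumr; apply: eq_bigr => i _.
  rewrite !mxE mulr_sumr; apply: eq_bigr => j _; rewrite !mxE (Lsym j) !add0n.
  by rewrite mulrACA -expr2 exprVn sqr_sqrtr// expr2.
rewrite ler_pdivrMl ?ltr0n//.
exact: (@link_block_sum R L L2 Llt (fun l => y l ^+ 2) n.+1 (fun l => sqr_ge0 _)
  0 n.+1 0 n.+1 (leqnn _) (leqnn _)).
Qed.

Lemma sqrt_ratio_dist (a b : R) : 0 < a -> a <= b ->
  (Num.sqrt b)^-1 <= (Num.sqrt a)^-1 /\
  a * ((Num.sqrt a)^-1 - (Num.sqrt b)^-1) ^+ 2 <= ((b - a) / b) ^+ 2.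
Proof.
move=> a0 ab; have b0 := lt_le_trans a0 ab.
have sa : 0 < Num.sqrt a by rewrite sqrtr_gt0.
have sb : 0 < Num.sqrt b by rewrite sqrtr_gt0.
have sab : Num.sqrt a <= Num.sqrt b by rewrite ler_sqrt// ltW.
split; first by rewrite lef_pV2.
have aE : a = Num.sqrt a ^+ 2 by rewrite sqr_sqrtr// ltW.
have bE : b = Num.sqrt b ^+ 2 by rewrite sqr_sqrtr// ltW.
move: sa sb sab aE bE; set p := Num.sqrt a; set q := Num.sqrt b => p0 q0 pq -> ->.
have -> : p ^+ 2 * (p^-1 - q^-1) ^+ 2 = ((q - p) / q) ^+ 2.
  by field; rewrite !lt0r_neq0.
have h1 : 0 <= (q - p) / q by rewrite divr_ge0 ?subr_ge0// ltW.
have h2 : (q - p) / q <= (q ^+ 2 - p ^+ 2) / q ^+ 2.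
  have -> : (q ^+ 2 - p ^+ 2) / q ^+ 2 = (q - p) / q * ((q + p) / q).
    by field; exact: lt0r_neq0.
  by rewrite ler_peMr// ler_pdivlMr// mul1r lerDl ltW.
by rewrite ler_pXn2r// nnegrE//; exact: le_trans h2.
Qed.

Definition pad_sqdist (y x : nat -> R) p d : R :=
  \sum_i \sum_j (normalized (link_mx L y (p.+1 + d)) i j -
                 pad d (normalized (link_mx L x p.+1)) i j) ^+ 2.

(** The common block gives the mean square difference of the inputs and the
effect of the two normalizations, of relative size [d / N]; the added rows and
columns give at most [4 * d] times the sum of the squares of the inputs. *)
Lemma link_pad_dist (y x : nat -> R) (c : R) p d : (forall l, `|x l| <= c) ->
  pad_sqdist y x p d / (p.+1 + d)%:R <= 4 * ((p.+1 + d)%:R^-1 * \sum_(l < 2 * (p.+1 + d)) (y l - x l) ^+ 2)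
    + 2 * c ^+ 2 * (d%:R / (p.+1 + d)%:R) ^+ 2
    + 4 * (d%:R / (p.+1 + d)%:R) * ((p.+1 + d)%:R^-1 * \sum_(l < 2 * (p.+1 + d)) y l ^+ 2).
Proof.
move=> xc; set N := (p.+1 + d)%N; set S := pad_sqdist _ _ _ _.
pose Y := \sum_(l < 2 * N) y l ^+ 2.
pose D := \sum_(l < 2 * N) (y l - x l) ^+ 2.
have N0 : 0 < N%:R :> R by rewrite ltr0n.
have p0 : 0 < p.+1%:R :> R by rewrite ltr0n.
have pN : p.+1%:R <= N%:R :> R by rewrite ler_nat leq_addr.
have [_ rat] := sqrt_ratio_dist p0 pN.
have NpE : N%:R - p.+1%:R = d%:R :> R by rewrite natrD addrC addKr.
rewrite NpE in rat.
set sp := (Num.sqrt p.+1%:R)^-1 in rat; set sN := (Num.sqrt N%:R)^-1 in rat.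
have sN2 : sN ^+ 2 = N%:R^-1 by rewrite /sN exprVn sqr_sqrtr// ltW.
have c0 : 0 <= c by exact: le_trans (normr_ge0 _) (xc 0%N).
(* The common block, the added columns, the added rows. *)
have S_split : S = (\sum_(i < p.+1) \sum_(j < p.+1) (sN * y (L i j) - sp * x (L i j)) ^+ 2
    + \sum_(i < p.+1) \sum_(j < d) (sN * y (L i (p.+1 + j)%N)) ^+ 2)
    + \sum_(i < d) \sum_(j < p.+1 + d) (sN * y (L (p.+1 + i)%N j)) ^+ 2.
  rewrite /S /pad_sqdist big_split_ord /=; congr (_ + _).
    rewrite -big_split /=; apply: eq_bigr => i _; rewrite big_split_ord /=; congr (_ + _).
      by apply: eq_bigr => j _; rewrite /pad block_mxEul !mxE.
    by apply: eq_bigr => j _; rewrite /pad block_mxEur !mxE subr0.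
  apply: eq_bigr => i _; rewrite big_split_ord [RHS]big_split_ord /=; congr (_ + _).
    by apply: eq_bigr => j _; rewrite /pad block_mxEdl !mxE subr0.
  by apply: eq_bigr => j _; rewrite /pad block_mxEdr !mxE subr0.
have y0 l : 0 <= y l ^+ 2 by exact: sqr_ge0.
have B1 : \sum_(i < p.+1) \sum_(j < p.+1) (sN * y (L i j) - sp * x (L i j)) ^+ 2 <=
    4 * D + 2 * c ^+ 2 * ((d%:R / N%:R) ^+ 2 * N%:R).
  apply: (@le_trans _ _ (\sum_(i < p.+1) \sum_(j < p.+1)
     (2 * N%:R^-1 * (y (L (0 + i)%N (0 + j)%N) - x (L (0 + i)%N (0 + j)%N)) ^+ 2 + 2 * ((sp - sN) ^+ 2 * c ^+ 2)))).
    apply: ler_sum => i _; apply: ler_sum => j _; rewrite !add0n; set l := L i j.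
    have xl : x l ^+ 2 <= c ^+ 2.
      by rewrite -real_normK ?num_real// ler_pXn2r// nnegrE.
    have := ler_wpM2l (sqr_ge0 (sp - sN)) xl; rewrite -sN2.
    have := sqr_ge0 (sN * (y l - x l) + (sp - sN) * x l).
    rewrite !expr2; lra.
  have -> : \sum_(i < p.+1) \sum_(j < p.+1)
     (2 * N%:R^-1 * (y (L (0 + i)%N (0 + j)%N) - x (L (0 + i)%N (0 + j)%N)) ^+ 2 + 2 * ((sp - sN) ^+ 2 * c ^+ 2)) =
     2 * N%:R^-1 * \sum_(i < p.+1) \sum_(j < p.+1) (y (L (0 + i)%N (0 + j)%N) - x (L (0 + i)%N (0 + j)%N)) ^+ 2
     + p.+1%:R * (p.+1%:R * (2 * ((sp - sN) ^+ 2 * c ^+ 2))).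
    under eq_bigr do rewrite big_split /= -mulr_sumr sumr_const card_ord -[_ *+ p.+1]mulr_natl.
    by rewrite big_split /= -mulr_sumr sumr_const card_ord -[_ *+ p.+1]mulr_natl.
  apply: lerD.
    have := @link_block_sum R L L2 Llt (fun l => (y l - x l) ^+ 2) N (fun l => sqr_ge0 _) 0 p.+1 0 p.+1 (leq_addr _ _) (leq_addr _ _).
    rewrite -/D => h.
    have D0 : 0 <= D by apply: sumr_ge0 => l _; exact: sqr_ge0.
    have h2 : p.+1%:R * (2 * D) <= N%:R * (2 * D) by apply: ler_wpM2r => //; rewrite mulr_ge0.
    have h3 := le_trans h h2.
    apply: (@le_trans _ _ (2 * N%:R^-1 * (N%:R * (2 * D)))).
      by apply: ler_wpM2l => //; rewrite mulr_ge0// invr_ge0 ltW.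
    by rewrite -mulrA mulKf ?lt0r_neq0// mulrA -natrM.
  have -> : p.+1%:R * (p.+1%:R * (2 * ((sp - sN) ^+ 2 * c ^+ 2))) =
     2 * c ^+ 2 * ((p.+1%:R * (sp - sN) ^+ 2) * p.+1%:R) by ring.
  apply: ler_wpM2l; first by rewrite mulr_ge0// sqr_ge0.
  apply: ler_pM => //; first by rewrite mulr_ge0// ?sqr_ge0// ltW.
have B2 : \sum_(i < p.+1) \sum_(j < d) (sN * y (L i (p.+1 + j)%N)) ^+ 2 <=
    N%:R^-1 * (d%:R * (2 * Y)).
  under eq_bigr do under eq_bigr do rewrite exprMn sN2.
  under eq_bigr do rewrite -mulr_sumr.
  rewrite -mulr_sumr; apply: ler_wpM2l; first by rewrite invr_ge0 ltW.
  exact: (@link_block_sum R L L2 Llt (fun l => y l ^+ 2) N y0 0 p.+1 p.+1 d (leq_addr _ _) (leqnn _)).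
have B3 : \sum_(i < d) \sum_(j < p.+1 + d) (sN * y (L (p.+1 + i)%N j)) ^+ 2 <=
    N%:R^-1 * (d%:R * (2 * Y)).
  under eq_bigr do under eq_bigr do rewrite exprMn sN2 Lsym.
  under eq_bigr do rewrite -mulr_sumr.
  rewrite -mulr_sumr; apply: ler_wpM2l; first by rewrite invr_ge0 ltW.
  rewrite exchange_big /=.
  exact: (@link_block_sum R L L2 Llt (fun l => y l ^+ 2) N y0 0 N p.+1 d (leqnn _) (leqnn _)).
rewrite ler_pdivrMr// S_split.
apply: le_trans (lerD (lerD B1 B2) B3) _.
rewrite -/D -/Y le_eqVlt; apply/orP; left; apply/eqP; field; exact: lt0r_neq0.
Qed.

Lemma dist_sums_scale (l1 l2 : seq R) (f : R -> R) (A B : R) : 0 < A ->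
  `|\sum_(t <- l1) f t / A - \sum_(t <- l2) f t / A| <= B ->
  `|\sum_(t <- l1) f t - \sum_(t <- l2) f t| <= B * A.
Proof.
move=> A0; rewrite -!mulr_suml -mulrBl normrM normfV (gtr0_norm A0).
by rewrite ler_pdivrMr.
Qed.

(** Completing by [d] zero rows and columns adds [d] zero eigenvalues, which
together with the change of the weights of the average cost [2 * (d / N)]. *)
Lemma avg_pad_dist (y x : nat -> R) (f : R -> R) p d (A dl : R) :
  0 < A -> 0 < dl -> (forall s t, `|f s - f t| <= A * `|s - t|) -> (forall t, `|f t| <= 1) ->
  `|avg (eigenvalues (normalized (link_mx L y (p.+1 + d)))) f -
    avg (eigenvalues (normalized (link_mx L x p.+1))) f| <=
  A * (2^-1 * (pad_sqdist y x p d / (p.+1 + d)%:R / dl + dl)) + 2 * (d%:R / (p.+1 + d)%:R).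
Proof.
move=> A0 dl0 fA f1; set N := (p.+1 + d)%N; set S := pad_sqdist _ _ _ _.
set MM := normalized (link_mx L y N); set XX := normalized (link_mx L x p.+1).
have N0 : 0 < N%:R :> R by rewrite ltr0n.
have p0 : 0 < p.+1%:R :> R by rewrite ltr0n.
have NpE : N%:R = p.+1%:R + d%:R :> R by rewrite natrD.
have symX : XX^T = XX by exact: link_mx_sym.
have tc := @trace_comparison R N MM (pad d XX) (fun t => f t / A) dl (link_mx_sym y N) _ dl0 _.
have {}tc : `|\sum_(t <- eigenvalues MM) f t / A - \sum_(t <- eigenvalues (pad d XX)) f t / A|
   <= 2^-1 * (S / dl + dl * N%:R).
  apply: tc; first by rewrite /pad tr_block_mx !trmx0 symX.
  move=> s t; rewrite -mulrBl normrM normfV (gtr0_norm A0) ler_pdivrMr// mulrC; exact: fA.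
have padE : \sum_(t <- eigenvalues (pad d XX)) f t = \sum_(t <- eigenvalues XX) f t + d%:R * f 0.
  rewrite (perm_big _ (eigenvalues_pad d symX)) big_cat /=; congr (_ + _).
  by rewrite big_nseq iter_addr addr0 mulr_natl.
have {}tc := dist_sums_scale A0 tc.
rewrite padE in tc.
rewrite /avg !size_eigenvalues.
move: tc; set SM := \sum_(t <- eigenvalues MM) f t;
  set SX := \sum_(t <- eigenvalues XX) f t => tc.
have SXb : `|SX| <= p.+1%:R.
  apply: le_trans (ler_norm_sum _ _ _) _.
  have e := size_eigenvalues XX; rewrite -[X in _ <= X%:R]e -sum1_size natr_sum.
  exact: ler_sum.
have -> : N%:R^-1 * SM - p.+1%:R^-1 * SX =
   N%:R^-1 * (SM - (SX + d%:R * f 0)) + (N%:R^-1 * (d%:R * f 0) - d%:R / N%:R * (p.+1%:R^-1 * SX)).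
  by rewrite NpE; field; rewrite lt0r_neq0//= -?NpE ?lt0r_neq0.
apply: le_trans (ler_normD _ _) _; apply: lerD.
  rewrite normrM normfV (gtr0_norm N0).
  apply: le_trans (ler_wpM2l _ tc) _; first by rewrite invr_ge0 ltW.
  by rewrite le_eqVlt; apply/orP; left; apply/eqP; field; rewrite !lt0r_neq0.
apply: le_trans (ler_normB _ _) _; rewrite mulr2n mulrDl mul1r.
have dN0 : 0 <= d%:R / N%:R :> R by rewrite divr_ge0.
apply: lerD.
  by rewrite mulrA [N%:R^-1 * _]mulrC normrM (ger0_norm dN0) ler_piMr.
rewrite normrM (ger0_norm dN0) ler_piMr// normrM normfV (gtr0_norm p0).
by rewrite ler_pdivrMl// mulr1.
Qed.

End size_comparison.

(** * Almost sure convergence of moments along squares *)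

(** The matrix of index [square_index j] has the square size [(j + 1) ^ 2]:
along these sizes the variances, of order the inverse of the size, are
summable. *)
Definition square_index j := (j.+1 ^ 2).-1.

Lemma square_indexS j : (square_index j).+1 = (j.+1 ^ 2)%N.
Proof. by rewrite /square_index prednK// expn_gt0. Qed.

Lemma inverse_square_sum (R : realFieldType) N :
  \sum_(j < N) (j.+1%:R ^+ 2)^-1 <= 2 :> R.
Proof.
case: N => [|N]; first by rewrite big_ord0.
suff h : \sum_(i < N) (i.+2%:R ^+ 2)^-1 <= 1 - N.+1%:R^-1 :> R.
  rewrite big_ord_recl expr1n invr1; apply: le_trans (lerD (lexx 1) h) _.
  have : 0 <= N.+1%:R^-1 :> R by rewrite invr_ge0.
  by move: (N.+1%:R^-1) => v v0; lra.
elim: N => [|N IH]; first by rewrite big_ord0 invr1 subrr.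
rewrite big_ord_recr /=; apply: le_trans (lerD IH (lexx _)) _.
have a0 : 0 < N.+1%:R :> R by rewrite ltr0n.
have -> : N.+2%:R = N.+1%:R + 1 :> R by rewrite natr1.
set a := N.+1%:R in a0 *; have b0 : 0 < a + 1 by lra.
rewrite -subr_ge0.
have -> : 1 - (a + 1)^-1 - (1 - a^-1 + ((a + 1) ^+ 2)^-1) = (a * (a + 1) ^+ 2)^-1.
  by field; rewrite !lt0r_neq0.
by rewrite invr_ge0 mulr_ge0 ?sqr_ge0// ltW.
Qed.

Section link_moments.
Context {d : measure_display} {T : measurableType d} {R : realType}.
Variables (P : probability T R) (L : nat -> nat -> nat).
Hypothesis Lsym : forall u v, L u v = L v u.
Hypothesis L2 : forall n u e, (count (fun v => L v u == e) (iota 0 n) <= 2)%N.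
Variables (x : nat -> T -> R) (mo : nat -> R) (B : R).
Hypothesis mx : forall j, measurable_fun setT (x j).
Hypothesis B0 : 0 <= B.
Hypothesis xB : forall j w, `|x j w| <= B.
Hypothesis xE : forall s, Ex P (fun w => \prod_(j <- s) x j w) = moment_product mo s.
Hypothesis mo1 : mo 1 = 0.

Definition link_moment n k w : R :=
  n.+1%:R^-1 * \tr (normalized (link_mx L (x^~ w) n.+1) ^+ k).

Lemma link_momentE n k w :
  link_moment n k w = avg (eigenvalues (normalized (link_mx L (x^~ w) n.+1))) (fun t => t ^+ k).
Proof.
by rewrite /avg size_eigenvalues sum_eigenvalues_power// link_mx_sym.
Qed.

Lemma link_moment_scale n k w : link_moment n k w =
  n.+1%:R^-1 * (Num.sqrt n.+1%:R)^-1 ^+ k * \tr (link_mx L (x^~ w) n.+1 ^+ k).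
Proof. by rewrite /link_moment /normalized exprZn mxtraceZ mulrA. Qed.

(** The normalization divides the variance of the trace by [n ^+ (k + 2)],
against [n ^+ (k + 1)] pairs of words. *)
Lemma link_moment_variance k : exists2 C : R, 0 <= C & forall n,
  integ P (link_moment n k) /\
  integ P (fun w => (link_moment n k w - Ex P (link_moment n k)) ^+ 2) /\
  Ex P (fun w => (link_moment n k w - Ex P (link_moment n k)) ^+ 2) <= C / n.+1%:R.
Proof.
case: k => [|k].
  exists 0 => // n'; have -> : link_moment n' 0 = fun=> 1.
    by apply/funext => w; rewrite /link_moment expr0 mxtrace1 mulVf// pnatr_eq0.
  rewrite Ex_cst subrr expr0n /= mul0r; split; first exact: integ_cst.
  by split; [exact: integ_cst|rewrite Ex_cst].
pose K := (2 * B ^+ (2 * k.+1) * (k.+1 ^ 2 * (2 * (2 * k.+1).-1 + 1) ^ (2 * k.+1).-1)%:R).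
have K0 : 0 <= K by rewrite mulr_ge0// mulr_ge0// exprn_ge0.
exists K => // n'.
have [iF [iV V]] := @trace_variance _ _ _ P L L2 x mo B mx xB xE mo1 n' k.+1 isT B0.
set F := fun w => \tr _ in iF iV V.
pose c : R := n'.+1%:R^-1 * (Num.sqrt n'.+1%:R)^-1 ^+ k.+1.
have FE : link_moment n' k.+1 = fun w => c * F w.
  by apply/funext => w; rewrite link_moment_scale.
have dE : (fun w => (link_moment n' k.+1 w - Ex P (link_moment n' k.+1)) ^+ 2) =
          fun w => c ^+ 2 * (F w - Ex P F) ^+ 2.
  by apply/funext => w; rewrite FE ExZ// -mulrBr exprMn.
rewrite dE FE; split; first exact: integZ.
split; first exact: integZ.
rewrite ExZ//.
have n0 : 0 < n'.+1%:R :> R by rewrite ltr0n.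
have c2 : c ^+ 2 = (n'.+1%:R ^+ k.+3)^-1.
  rewrite /c exprMn -exprM mulnC exprM [X in _ * X ^+ _]exprVn sqr_sqrtr; last exact: ltW.
  by rewrite -!exprVn -exprD.
apply: le_trans (ler_wpM2l _ V) _; first exact: sqr_ge0.
rewrite c2 mulnA natrM natrX mulrA -/K mulrCA; apply: ler_wpM2l => //.
rewrite [_ ^+ k.+3]exprSr invfM -mulrA mulrCA mulVf ?mulr1//.
Qed.

(** The centered moments tend to 0 almost surely since their variances are
summable, and the means converge. *)
Lemma ae_link_moments (m : nat -> R) :
  (forall k, Ex P (link_moment n k) @[n --> \oo] --> m k) ->
  {ae P, forall w, forall k,
    avg (eigenvalues (normalized (link_mx L (x^~ w) (square_index j).+1))) (fun t => t ^+ k)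
      @[j --> \oo] --> m k}.
Proof.
move=> cm; apply: ae_foralln => k.
have [C C0 HC] := link_moment_variance k.
pose V n w := (link_moment n k w - Ex P (link_moment n k)) ^+ 2.
have : {ae P, forall w, V (square_index j) w @[j --> \oo] --> 0}.
  apply: (@ae_cvg0 _ _ _ P (fun j => V (square_index j)) (C * 2)).
  - by move=> j; exact: (HC _).2.1.
  - by move=> j w; exact: sqr_ge0.
  move=> N; apply: (@le_trans _ _ (\sum_(j < N) C * (j.+1%:R ^+ 2)^-1)).
    apply: ler_sum => j _; apply: le_trans (HC _).2.2 _.
    by rewrite square_indexS natrX.
  by rewrite -mulr_sumr; apply: ler_wpM2l => //; exact: inverse_square_sum.
apply: filterS => w Vw.
have sub : Ex P (link_moment (square_index j) k) @[j --> \oo] --> m k.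
  apply: cvg_comp (cm k) => A [N _ HA]; exists N => // j /= Nj; apply: HA => /=.
  by apply: leq_trans Nj _; rewrite -ltnS square_indexS expnS expn1 leq_pmull.
have -> : (fun j => avg (eigenvalues (normalized (link_mx L (x^~ w) (square_index j).+1)))
    (fun t => t ^+ k)) = (fun j => (link_moment (square_index j) k w -
       Ex P (link_moment (square_index j) k)) + Ex P (link_moment (square_index j) k)).
  by apply/funext => j; rewrite subrK link_momentE.
rewrite -[m k]add0r; apply: cvgD => //.
apply/cvgrPdist_lt => e e0.
have e20 : 0 < e ^+ 2 by rewrite exprn_gt0.
near=> j.
have : V (square_index j) w < e ^+ 2 by near: j; exact: (cvgr_lt _ Vw).
rewrite /V -real_normK ?num_real// ltr_pXn2r ?nnegrE// ?(ltW e0)//.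
by rewrite sub0r normrN.
Unshelve. all: by end_near.
Qed.

End link_moments.

(** * From moments along squares to weak convergence *)

(** A size exceeds the largest square below it by at most twice the root, so
that few rows have to be completed. *)
Lemma square_decomposition n : exists j d,
  [/\ n = (square_index j + d)%N, (d <= 2 * j.+1)%N, (j.+1 * j.+1 <= n.+1)%N &
      (n.+1 < j.+2 * j.+2)%N].
Proof.
suff [j [d [-> dj]]] : exists j d, n = (square_index j + d)%N /\ (d <= 2 * j.+1)%N.
  exists j, d; split=> //; rewrite -addSn square_indexS expnS expn1; first exact: leq_addr.
  nia.
elim: n => [|n [j [d [-> dj]]]]; first by exists 0%N, 0%N.
have [dj'|jd] := ltnP d (2 * j.+1)%N; first by exists j, d.+1; rewrite addnS.
exists j.+1, 0%N; split=> //.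
have := square_indexS j; have := square_indexS j.+1; rewrite !expnS !expn0; nia.
Qed.

Lemma cos_affine_lipschitz (R : realType) (a b s t : R) :
  `|cos (a * s + b) - cos (a * t + b)| <= (`|a| + 1) * `|s - t|.
Proof.
have lip (u v : R) : `|cos u - cos v| <= `|u - v|.
  wlog uv : u v / u <= v.
    by move=> h; have [/h//|/ltW/h] := leP u v; rewrite distrC (distrC v).
  have [|c _ E] := @MVT_segment R cos (fun x => - sin x) u v uv (fun x _ => is_derive_cos x).
    by apply: continuous_subspaceT => x; exact: continuous_cos.
  rewrite distrC E normrM normrN (distrC u); apply: ler_piMl => //; exact: sin_max.
apply: le_trans (lip _ _) _.
have -> : a * s + b - (a * t + b) = a * (s - t) by ring.
by rewrite normrM; apply: ler_wpM2r => //; rewrite lerDl.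
Qed.

Lemma mean_double_le (R : realFieldType) (S C : R) n :
  S <= C * (2 * n.+1)%:R -> n.+1%:R^-1 * S <= 2 * C.
Proof.
move=> h; rewrite ler_pdivrMl ?ltr0n//; apply: le_trans h _.
by rewrite natrM mulrA [C * _]mulrC [leRHS]mulrC.
Qed.

Section weak_limit.
Variables (R : realType) (L : nat -> nat -> nat).
Hypothesis Lsym : forall u v, L u v = L v u.
Hypothesis L2 : forall n u e, (count (fun v => L v u == e) (iota 0 n) <= 2)%N.
Hypothesis Llt : forall u v n, (u < n)%N -> (v < n)%N -> (L u v < 2 * n)%N.
Variable mu : probability (measurableTypeR R) R.
Hypothesis imu : forall k, integ mu (fun t => t ^+ k).
Hypothesis growth : forall k, Ex mu (fun t => t ^+ (2 * k)) <= (2 * k)`!%:R / k`!%:R.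

Definition moments_along_squares (x : nat -> R) := forall k,
  avg (eigenvalues (normalized (link_mx L x (square_index j).+1))) (fun t => t ^+ k)
    @[j --> \oo] --> Ex mu (fun t => t ^+ k).

(** What truncation and the law of large numbers provide for almost every
realization of the inputs. *)
Definition approximable (y : nat -> R) := forall e, 0 < e -> exists (x : nat -> R) (c : R),
  [/\ forall l, `|x l| <= c, moments_along_squares x &
      \forall n \near \oo, \sum_(l < n) (y l - x l) ^+ 2 <= e * n%:R].

Lemma cvg_cos_along_squares x : moments_along_squares x ->
  cvg_cos (fun j => esd (normalized (link_mx L x (square_index j).+1))) mu.
Proof.
move=> mx; apply: cvg_cos_moments => //.
  by move=> n k; apply: integ_esd; exact: measurable_powR_nat.
move=> k; rewrite (_ : (fun n => _) = fun j =>
    avg (eigenvalues (normalized (link_mx L x (square_index j).+1))) (fun t => t ^+ k)) //.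
by apply/funext => j; rewrite Ex_esd//; exact: measurable_powR_nat.
Qed.

(** A deterministic statement about one realization. For a cosine, the average
over the eigenvalues for the inputs [y] is compared with the one for the
bounded inputs [x] at the largest square size below; the error is small
because the inputs are close and because the number of completed rows is
negligible. The second moments stay bounded, so cosines suffice. *)
Lemma link_weak_cvg (y : nat -> R) (C : R) :
  approximable y -> (\forall n \near \oo, \sum_(l < n) y l ^+ 2 <= C * n%:R) ->
  weak_cvg (fun n => esd (normalized (link_mx L y n.+1))) mu.
Proof.
move=> yx [N1 _ yC].
apply: (@weak_cvg_cos _ _ _ (4 * C)); last exact: imu; last first.
  exists N1 => // n /= N1n; split; first by apply: integ_esd; exact: measurable_powR_nat.
  rewrite Ex_esd; last exact: measurable_powR_nat.
  apply: le_trans (link_second_moment Lsym L2 Llt y n) _.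
  have n0 : 0 < n.+1%:R :> R by rewrite ltr0n.
  have := yC (2 * n.+1)%N; rewrite /= => /(_ _) h.
  have {}h : \sum_(l < 2 * n.+1) y l ^+ 2 <= C * (2 * n.+1)%:R by apply: h; lia.
  rewrite (_ : 4 * C = 2 * (2 * C)); last by ring.
  apply: ler_wpM2l => //; exact: mean_double_le h.
move=> a b; apply/cvgrPdist_lt => eps eps0.
pose f t := cos (a * t + b); pose A := `|a| + 1.
have A0 : 0 < A by rewrite ltr_wpDl.
have fA s t : `|f s - f t| <= A * `|s - t| by exact: cos_affine_lipschitz.
have f1 t : `|f t| <= 1 by exact: cos_max.
have mf : measurable_fun setT f by exact: measurable_cos_affine.
(* Choices that make the first error term at most [eps / 8 + eps / 16], with
[9 * e] as a bound for the mean square distance of the matrices; [tau] bounds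
the proportion of completed rows. *)
pose dl := eps / (4 * A); have dl0 : 0 < dl by rewrite divr_gt0// mulr_gt0.
pose e := dl * eps / (72 * A).
have e0 : 0 < e by rewrite divr_gt0// mulr_gt0.
have [x [c [xc xm [N2 _ yxe]]]] := yx e e0.
have c0 : 0 <= c by exact: le_trans (normr_ge0 _) (xc 0%N).
have eps2 : 0 < eps / 2 by rewrite divr_gt0.
have /cvgrPdist_lt /(_ _ eps2) [J1 _ HJ1] := @cvg_cos_along_squares x xm a b.
have C0 : 0 <= C.
  have := yC N1.+1 => /= /(_ _) h; have {}h := h (leqnSn _).
  have : 0 <= C * N1.+1%:R by apply: le_trans h; apply: sumr_ge0 => l _; exact: sqr_ge0.
  by rewrite pmulr_lge0 ?ltr0n.
pose K := 2 * c ^+ 2 + 8 * C + 1.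
have K0 : 0 < K.
  have := sqr_ge0 c; rewrite /K; lra.
pose tau := Num.min 1 (Num.min (eps / 16) (e / K)).
have tau0 : 0 < tau by rewrite !lt_min ltr01 (divr_gt0 eps0)// (divr_gt0 e0 K0).
pose J := maxn J1 (maxn (maxn N1 N2) (Num.truncn (2 / tau)).+1).
exists ((J + 2) ^ 2)%N => // n /= Jn.
have [j [d [nE dj jn nj]]] := square_decomposition n.
have Jj : (J <= j)%N.
  rewrite leqNgt; apply/negP => jJ; move: nj; rewrite ltnNge => /negP; apply.
  apply: leq_trans (leqW Jn); rewrite expnS expn1; by apply: leq_mul; rewrite addn2 !ltnS ltnW.
have [J1j N1j N2j tj] : [/\ (J1 <= j)%N, (N1 <= j)%N, (N2 <= j)%N & ((Num.truncn (2 / tau)).+1 <= j)%N].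
  by move: Jj; rewrite /J !geq_max => /andP[-> /andP[/andP[-> ->] ->]].
have j2n M : (M <= j)%N -> (M <= 2 * n.+1)%N.
  move=> Mj; rewrite mul2n -addnn; apply: leq_trans (leq_addr _ _).
  by apply: leq_trans jn; apply: leq_trans Mj _; apply: leq_trans (leqnSn _) (leq_pmull _ _).
have N0 : 0 < n.+1%:R :> R by rewrite ltr0n.
have DE : n.+1%:R^-1 * \sum_(l < 2 * n.+1) (y l - x l) ^+ 2 <= 2 * e.
  by apply: mean_double_le; apply: yxe; exact: j2n.
have YE : n.+1%:R^-1 * \sum_(l < 2 * n.+1) y l ^+ 2 <= 2 * C.
  by apply: mean_double_le; apply: yC; exact: j2n.
have Y0 : 0 <= n.+1%:R^-1 * \sum_(l < 2 * n.+1) y l ^+ 2.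
  by rewrite mulr_ge0 ?invr_ge0// sumr_ge0// => l _; exact: sqr_ge0.
have t0 : 0 <= d%:R / n.+1%:R :> R by rewrite divr_ge0.
have tt : d%:R / n.+1%:R <= tau.
  have j0 : 0 < j.+1%:R :> R by rewrite ltr0n.
  have h2 : 2 / tau <= j.+1%:R.
    by apply/ltW; apply: lt_le_trans (truncnS_gt _) _; rewrite ler_nat; exact: leqW.
  rewrite ler_pdivrMr//; apply: (@le_trans _ _ (2 * j.+1%:R)).
    by rewrite -natrM ler_nat.
  rewrite ler_pdivrMr// mulrC in h2.
  apply: (@le_trans _ _ (tau * j.+1%:R * j.+1%:R)); first by rewrite ler_pM2r.
  by rewrite -mulrA ler_pM2l// -natrM ler_nat.
rewrite nE in DE YE Y0 t0 tt *.
have := link_pad_dist Lsym L2 Llt y (square_index j) d xc.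
rewrite -[((square_index j).+1 + d)%N]/((square_index j + d).+1).
set S := pad_sqdist _ _ _ _ _; set N := (square_index j + d).+1 in DE YE Y0 t0 tt *.
set D := N%:R^-1 * _ in DE *; set Y := N%:R^-1 * _ in YE Y0 *;
  set t := d%:R / N%:R in t0 tt * => HS.
have := @avg_pad_dist R L Lsym y x f (square_index j) d A dl A0 dl0 fA f1.
rewrite -[((square_index j).+1 + d)%N]/((square_index j + d).+1) -/N -/S -/t => HD.
have [tt1 tt2 tt3] : [/\ t <= 1, t <= eps / 16 & t * K <= e].
  by rewrite -(ler_pdivlMr _ _ K0); move: tt; rewrite /tau !le_min => /andP[-> /andP[-> ->]].
have SE : S / N%:R <= 9 * e.
  have t2 : t ^+ 2 <= t by rewrite expr2 ler_piMr.
  have h1 := ler_wpM2l (sqr_ge0 c) t2.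
  have h2 := ler_wpM2l t0 YE.
  apply: le_trans HS _; move: tt3; rewrite /K; nra.
have fin : A * (2^-1 * (S / N%:R / dl + dl)) <= eps / 16 + eps / 8.
  have h : S / N%:R / dl <= eps / (8 * A).
    rewrite ler_pdivrMr//; apply: le_trans SE _; rewrite /e le_eqVlt; apply/orP; left;
      apply/eqP; field; exact: lt0r_neq0.
  have -> : eps / 16 + eps / 8 = A * (2^-1 * (eps / (8 * A) + dl)).
    by rewrite /dl; field; exact: lt0r_neq0.
  by apply: ler_wpM2l; [exact: ltW|apply: ler_wpM2l; [rewrite invr_ge0|rewrite lerD2r]].
have := HJ1 j J1j; rewrite /= !Ex_esd// -/f => HX.
have E3 : `|avg (eigenvalues (normalized (link_mx L y N))) f -
   avg (eigenvalues (normalized (link_mx L x (square_index j).+1))) f| < eps / 2.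
  apply: le_lt_trans HD _; lra.
rewrite -(subrK (avg (eigenvalues (normalized (link_mx L x (square_index j).+1))) f) (Ex mu f)).
rewrite -addrA; apply: le_lt_trans (ler_normD _ _) _; rewrite [eps]splitr.
by apply: ltrD => //; rewrite distrC.
Qed.

End weak_limit.

(** * Spectral limits of link matrices *)

Section transformed_variables.
Context {d : measure_display} {T : measurableType d} {R : realType}.
Variables (P : probability T R) (g : R -> R).
Hypothesis mg : measurable_fun setT g.

Definition comp_RV (X : {RV P >-> R}) : {RV P >-> R} :=
  HB.pack (fun w => g (X w)) (isMeasurableFun.Build _ _ _ _ _ (measurable_RV X mg)).

Lemma comp_RV_independent (y : nat -> {RV P >-> R}) :
  mutually_independent y -> mutually_independent (fun j => comp_RV (y j)).
Proof.
move=> iy J B uJ mB; apply: (iy J (fun j => g @^-1` B j)) => // j.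
by rewrite -[_ @^-1` _]setTI; exact: mg.
Qed.

End transformed_variables.

Section link_theorem.
Variables (R : realType) (L : nat -> nat -> nat).
Hypothesis Lsym : forall u v, L u v = L v u.
Hypothesis L2 : forall n u e, (count (fun v => L v u == e) (iota 0 n) <= 2)%N.
Hypothesis Llt : forall u v n, (u < n)%N -> (v < n)%N -> (L u v < 2 * n)%N.

(** What [toeplitz_limit] and [hankel_limit] say about the moments, in terms
of real numbers. *)
Definition link_limit (m : nat -> R) :=
  forall (d : measure_display) (T : measurableType d) (P : probability T R)
    (x : nat -> {RV P >-> R}),
    uniformly_bounded_moments x -> mutually_independent x -> standardized x ->
    forall k, Ex P (link_moment L x n k) @[n --> \oo] --> m k.

Variable m : nat -> R.
Hypothesis Hlim : link_limit m.

(** The limit is the same for all inputs, so it may be computed with random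
signs. *)
Lemma limit_growth k : m (2 * k)%N <= (2 * k)`!%:R / k`!%:R.
Proof.
have /(_ (2 * k)%N) cm := Hlim (rademacher_bounded_moments R)
  (@rademacher_independent R) (@rademacher_standardized R).
apply: (cvgr_to_le cm); apply: nearW => n.
under eq_Ex do rewrite link_moment_scale.
have iF : integ (U01 R) (fun w => \tr (link_mx L (fun j => rademacher_rv R j w) n.+1 ^+ (2 * k))).
  case: k {cm} => [|k].
    rewrite (_ : (fun w => _) = fun=> n.+1%:R); first exact: integ_cst.
    by apply/funext => w; rewrite muln0 expr0 mxtrace1.
  have [] := @trace_variance _ _ _ (U01 R) L L2 (rademacher (R := R)) (fun c => (~~ odd c)%:R) 1
    (@measurable_rademacher R) _ (@rademacher_word_moment R) _ n (2 * k.+1)%N _ ler01 => //.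
  by move=> j w; rewrite rademacher_norm.
rewrite ExZ//.
have bd j (w : measurableTypeR R) : `|rademacher j w| <= 1 by rewrite rademacher_norm.
have := @sign_trace_growth _ _ _ (U01 R) L Lsym L2 (rademacher (R := R)) 1 n k
  (@measurable_rademacher R) _ (@rademacher_word_moment R) => /(_ _) h0.
have {h0} := h0 bd.
set E := Ex _ _ => h.
have n0 : 0 < n.+1%:R :> R by rewrite ltr0n.
rewrite exprM exprVn sqr_sqrtr ?(ltW n0)// exprVn -invfM -exprS.
by rewrite ler_pdivrMl ?exprn_gt0// mulrC.
Qed.

(** Almost sure convergence yields at least one realization for which all
moments converge. *)
Lemma rademacher_moments : exists w : measurableTypeR R, forall k,
  avg (eigenvalues (normalized (link_mx L (fun j => rademacher j w) (square_index j).+1)))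
    (fun t => t ^+ k) @[j --> \oo] --> m k.
Proof.
have lim := Hlim (rademacher_bounded_moments R) (@rademacher_independent R) (@rademacher_standardized R).
have bd j (w : measurableTypeR R) : `|rademacher j w| <= 1 by rewrite rademacher_norm.
have := @ae_link_moments _ _ _ (U01 R) L Lsym L2 (rademacher (R := R)) (fun c => (~~ odd c)%:R) 1
  (@measurable_rademacher R) ler01 bd (@rademacher_word_moment R) erefl m lim.
move=> [N [mN N0 hN]]; apply: contrapT => hw.
have : U01 R setT = 0%E.
  apply/eqP; rewrite eq_le measure_ge0 andbT -N0; apply: le_measure; rewrite ?inE//.
  by move=> w _; apply: hN => /= hk; apply: hw; exists w.
by rewrite probability_setT => /eqP; rewrite onee_eq0.
Qed.

Lemma link_law_exists : exists mu : probability (measurableTypeR R) R,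
  forall k, integ mu (fun t => t ^+ k) /\ Ex mu (fun t => t ^+ k) = m k.
Proof.
have [w hw] := rademacher_moments.
apply: (moment_problem _ hw) => N; exists N => // j /= Nj.
rewrite size_eigenvalues square_indexS expnS expn1.
by apply: leq_trans (leqW Nj) _; exact: leq_pmulr.
Qed.

Variable mu : probability (measurableTypeR R) R.
Hypothesis imu : forall k, integ mu (fun t => t ^+ k).
Hypothesis Emu : forall k, Ex mu (fun t => t ^+ k) = m k.

Lemma link_law_growth k : Ex mu (fun t => t ^+ (2 * k)) <= (2 * k)`!%:R / k`!%:R.
Proof. by rewrite Emu; exact: limit_growth. Qed.

Section iid_inputs.
Context {d : measure_display} {T : measurableType d}.
Variables (P : probability T R) (y : nat -> {RV P >-> R}).
Hypotheses (iy : mutually_independent y) (idy : identically_distributed y).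
Hypothesis sy : standardized y.

(** Finite-valued transforms of the inputs are bounded, so the limit of the
expected moments is known for them, and the variance estimate applies. *)
Lemma transformed_moments (g : R -> R) : measurable_fun setT g -> finite_valued g ->
  Ex P (fun w => g (y 0%N w)) = 0 -> Ex P (fun w => g (y 0%N w) ^+ 2) = 1 ->
  {ae P, forall w, moments_along_squares L mu (fun j => g (y j w))}.
Proof.
move=> mg fg g0 g2.
have [c c0 gc] := finite_valued_bounded fg.
pose x j := comp_RV mg (y j).
have bx : uniformly_bounded_moments x.
  move=> k; exists (c ^+ k) => j; rewrite unlock.
  apply: (@le_trans _ _ (\int[P]_w (c ^+ k)%:E)%E); last first.
    by rewrite integral_cst//= probability_setT mule1.
  apply: ge0_le_integral => //.
  - apply/measurable_EFinP; apply: measurable_funX; exact: measurableT_comp.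
  - by move=> w _; rewrite lee_fin; apply: lerXn2r; rewrite ?nnegrE//; exact: gc.
have sx : standardized x.
  move=> j.
  have ig : integ P (fun w => g (y j w)) by exact: (@integ_finite_valued _ _ _ P y _ j mg fg).
  have mg2 : measurable_fun setT (fun t => g t ^+ 2) by exact: measurable_funX.
  have ig2 i : integ P (fun w => g (y i w) ^+ 2).
    exact: (@integ_finite_valued _ _ _ P y _ i mg2 (finite_valuedX 2 fg)).
  apply: standardizedP; [exact: ig|exact: (ig2 j)| |].
    have [_ E] := @same_law _ _ _ P y g 0%N j idy mg (@integ_finite_valued _ _ _ P y _ 0%N mg fg).
    by rewrite -g0 -E.
  have [_ E] := @same_law _ _ _ P y (fun t => g t ^+ 2) 0%N j idy mg2 (ig2 0%N).
  by rewrite -g2 -E.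
have lim := Hlim bx (comp_RV_independent mg iy) sx.
have mx j : measurable_fun setT (fun w => g (y j w)) by exact: measurable_RV.
have := @ae_link_moments _ _ _ P L Lsym L2 (fun j w => g (y j w))
  (fun k => Ex P (fun w => g (y 0%N w) ^+ k)) c mx c0 (fun j w => gc _)
  (fun s => input_moments s iy idy mg fg) _ m lim.
move=> H; have {}H := H g0.
by apply: filterS H => w hw k; rewrite Emu.
Qed.

(** The inputs are approximated by transforms at distance [1 / K.+1] in mean
square, for all [K] at once; the law of large numbers turns the mean square
distances into bounds for almost every realization. *)
Lemma iid_weak_cvg :
  {ae P, forall w, weak_cvg (fun n => esd (normalized (link_mx L (fun j => y j w) n.+1))) mu}.
Proof.
have [iy0 iy2 Ey Ey2] := standardized_moments (sy 0%N).1 (sy 0%N).2.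
have invK K : 0 < K.+1%:R^-1 :> R by rewrite invr_gt0.
have [g Hg] := choice (fun K => standardized_approximation (invK K) iy0 iy2 Ey Ey2).
have ae1 : {ae P, forall w, forall K, moments_along_squares L mu (fun j => g K (y j w))}.
  apply: ae_foralln => K; have [[mg fg g0 g2] _] := Hg K.
  exact: transformed_moments.
have ae2 : {ae P, forall w, forall K, \forall n \near \oo,
    \sum_(j < n) (y j w - g K (y j w)) ^+ 2 <= 6 * K.+1%:R^-1 * n%:R}.
  apply: ae_foralln => K; have [[mg fg g0 g2] [ig Eg]] := Hg K.
  have mphi : measurable_fun setT (fun t : R => (t - g K t) ^+ 2).
    by apply: measurable_funX; apply: measurable_funB.
  have := lln_upper iy idy mphi (fun t => sqr_ge0 _) ig (invK K).
  apply: filterS => w; apply: filterS => n /le_trans; apply.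
  apply: ler_wpM2r => //; move: Eg; move: (Ex P _) (K.+1%:R^-1) => E v; lra.
have ae3 : {ae P, forall w, \forall n \near \oo, \sum_(j < n) y j w ^+ 2 <= 6 * n%:R}.
  have mphi : measurable_fun setT (fun t : R => t ^+ 2) by exact: measurable_funX.
  have := lln_upper iy idy mphi (fun t => sqr_ge0 _) iy2 ltr01.
  by rewrite Ey2; apply: filterS => w; apply: filterS => n /le_trans; apply;
    apply: ler_wpM2r => //; lra.
apply: filterS3 ae1 ae2 ae3 => w w1 w2 w3.
apply: (link_weak_cvg Lsym L2 Llt imu link_law_growth _ w3) => e e0.
(* Then [6 / K.+1 <= e]. *)
pose K := Num.truncn (6 / e).
exists (fun j => g K (y j w)); have [[mg fg _ _] _] := Hg K.
have [c c0 gc] := finite_valued_bounded fg; exists c; split=> //.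
apply: filterS (w2 K) => n /le_trans; apply; apply: ler_wpM2r => //.
rewrite ler_pdivrMr// -ler_pdivrMl// mulrC; apply/ltW; exact: truncnS_gt.
Qed.

End iid_inputs.

End link_theorem.

(** * Toeplitz and Hankel matrices *)

Local Notation Re := complex.Re.
Local Notation Im := complex.Im.
Local Open Scope complex_scope.

(** Both the real and the imaginary part of the difference are bounded by its
modulus. *)
Lemma cvg_real_complex (R : realType) (u : nat -> R) (z : R[i]) :
  (fun n => (u n)%:C : R[i]^o) @ \oo --> (z : R[i]^o) ->
  u n @[n --> \oo] --> Re z /\ Im z = 0.
Proof.
move=> cu.
have near_e (e : R) : 0 < e -> \forall n \near \oo, `|z - (u n)%:C| < e%:C.
  move=> e0; have eC : 0 < e%:C by rewrite ltcR.
  by move/cvgrPdist_lt : cu => /(_ _ eC).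
split.
  apply/cvgrPdist_lt => e e0; apply: filterS (near_e e e0) => n.
  rewrite -ltcR; apply: le_lt_trans.
  apply: le_trans (normc_ge_Re _); rewrite lecR.
  by case: z {cu near_e}.
apply/eqP; rewrite -normr_le0; apply/ler_addgt0Pl => e e0; rewrite addr0.
have [N _ /(_ N (leqnn N)) h] := near_e e e0.
rewrite -lecR; apply: le_trans (ltW h).
apply: le_trans (_ : `|Im (z - (u N)%:C)|%:C <= _).
  by rewrite lecR; case: z {cu near_e h} => p q /=; rewrite oppr0 addr0.
by rewrite {2}/Num.norm /= lecR; exact: normc_Im.
Qed.

Lemma monomial_power (R : realType) (A : ncp R) (a : A) k :
  monomial (nseq k false) a = a ^+ k.
Proof. by rewrite /monomial big_nseq; elim: k => //= k ->; rewrite exprS. Qed.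

Section link_elements.
Context {d : measure_display} {T : measurableType d} {R : realType}.
Variables (P : probability T R) (L : nat -> nat -> nat) (x : nat -> T -> R) (n : nat).
Hypothesis Lsym : forall u v, L u v = L v u.

(** The state is the normalized expected trace, and the powers of a real
matrix are real. *)
Lemma phi_link_power (M : random_mx_ncp P n) k :
  val (M : random_mx P n) =
    (fun w => map_mx (real_complex R) (normalized (link_mx L (x^~ w) n.+1))) ->
  ncp_phi (random_mx_ncp P n) (monomial (nseq k false) M) = (Ex P (link_moment L x n k))%:C.
Proof.
move=> ME; rewrite monomial_power.
have vE w : val (M ^+ k : random_mx P n) w =
    map_mx (real_complex R) (normalized (link_mx L (x^~ w) n.+1) ^+ k).
  elim: k => [|k IH]; first by rewrite !expr0 map_mx1.
  rewrite [in RHS]exprS map_mxM -IH exprS.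
  by rewrite -[LHS]/(val (M : random_mx P n) w * val (M ^+ k : random_mx P n) w) ME.
have -> : ncp_phi (random_mx_ncp P n) (M ^+ k) =
   n.+1%:R^-1 * complex_expectation P (fun w => \tr (val (M ^+ k : random_mx P n) w)) by [].
have -> : (fun w => \tr (val (M ^+ k : random_mx P n) w)) =
    (fun w => (\tr (normalized (link_mx L (x^~ w) n.+1) ^+ k))%:C).
  by apply/funext => w; rewrite vE trace_map_mx.
rewrite /complex_expectation /=.
rewrite -/(Ex P _) -/(Ex P (fun=> 0)) Ex_cst.
have iT : integ P (fun w => \tr (normalized (link_mx L (x^~ w) n.+1) ^+ k)).
  have /finite_moments_mxP fM := valP (M ^+ k : random_mx P n).
  have := finite_moments_Re (finite_moments_sum (index_enum 'I_n.+1) (fun i => fM i i)).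
  congr (integrable _ _ _); apply/funext => w /=; congr EFin.
  by rewrite -[X in Re X]/(\tr (val (M ^+ k : random_mx P n) w)) vE trace_map_mx.
have -> : link_moment L x n k = fun w => n.+1%:R^-1 * \tr (normalized (link_mx L (x^~ w) n.+1) ^+ k).
  by [].
rewrite ExZ// rmorphM /= fmorphV rmorph_nat.
by [].
Qed.
End link_elements.

Section link_functions.

Definition toeplitz_link (i j : nat) := `|i%:Z - j%:Z|%N.

Definition hankel_link (i j : nat) := (i + j)%N.

Lemma count_iota_le1 e n : (count (fun v => v == e) (iota 0 n) <= 1)%N.
Proof. by rewrite count_uniq_mem ?iota_uniq// leq_b1. Qed.

Lemma toeplitz_link_sym u v : toeplitz_link u v = toeplitz_link v u.
Proof. exact: distnC. Qed.

(** The only vertices at distance [e] from [u] are [u + e] and [u - e]. *)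
Lemma toeplitz_link_count n u e :
  (count (fun v => toeplitz_link v u == e) (iota 0 n) <= 2)%N.
Proof.
apply: leq_trans (leq_add (count_iota_le1 (u + e)%N n) (count_iota_le1 (u - e)%N n)).
rewrite -count_predUI; apply: leq_trans (leq_addr _ _); apply: sub_count => v /=.
rewrite /toeplitz_link; lia.
Qed.

Lemma toeplitz_link_lt u v n : (u < n)%N -> (v < n)%N -> (toeplitz_link u v < 2 * n)%N.
Proof. rewrite /toeplitz_link; lia. Qed.

Lemma hankel_link_sym u v : hankel_link u v = hankel_link v u.
Proof. exact: addnC. Qed.

Lemma hankel_link_count n u e :
  (count (fun v => hankel_link v u == e) (iota 0 n) <= 2)%N.
Proof.
apply: leq_trans (leqW (count_iota_le1 (e - u)%N n)).
apply: sub_count => v /=; rewrite /hankel_link; lia.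
Qed.

Lemma hankel_link_lt u v n : (u < n)%N -> (v < n)%N -> (hankel_link u v < 2 * n)%N.
Proof. rewrite /hankel_link; lia. Qed.

End link_functions.

Section spectral_limit.
Variables (R : realType) (L : nat -> nat -> nat).
Hypothesis Lsym : forall u v, L u v = L v u.
Hypothesis L2 : forall n u e, (count (fun v => L v u == e) (iota 0 n) <= 2)%N.
Hypothesis Llt : forall u v n, (u < n)%N -> (v < n)%N -> (L u v < 2 * n)%N.
Variables (A : ncp R) (a : A).
Hypothesis lim : forall (d : measure_display) (T : measurableType d) (P : probability T R)
    (x : nat -> {RV P >-> R}),
  uniformly_bounded_moments x -> mutually_independent x -> standardized x ->
  forall k, (fun n => (Ex P (link_moment L x n k))%:C : R[i]^o) @ \oo -->
            (ncp_phi A (a ^+ k) : R[i]^o).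

(** Independent signs show that the limit moments are real, so that the
results on real limits of expected moments apply. *)
Lemma link_spectral_limit :
  exists mu : probability (measurableTypeR R) R,
    determined_by_moments mu (fun k => ncp_phi A (a ^+ k)) /\
    forall (d : measure_display) (T : measurableType d) (P : probability T R)
      (x : nat -> {RV P >-> R}),
      mutually_independent x -> identically_distributed x -> standardized x ->
      {ae P, forall w,
        weak_cvg (fun n => esd (normalized (link_mx L (fun j => x j w) n.+1))) mu}.
Proof.
pose m k := Re (ncp_phi A (a ^+ k)).
have Hlim : link_limit L m.
  by move=> d T P x bx ix sx k; exact: (cvg_real_complex (lim bx ix sx (k := k))).1.
have mE k : ncp_phi A (a ^+ k) = (m k)%:C.
  have := (cvg_real_complex (lim (rademacher_bounded_moments R)
    (@rademacher_independent R) (@rademacher_standardized R) (k := k))).2.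
  by rewrite /m; case: (ncp_phi A _) => p q /= ->.
have [mu mum] := link_law_exists Lsym L2 Hlim.
have imu k := (mum k).1; have Emu k := (mum k).2.
exists mu; split.
  split; first by move=> k; split; [exact: imu|rewrite -/(Ex mu _) Emu mE].
  move=> nu num; apply: (moments_unique imu (fun k => (num k).1)).
    move=> k; rewrite Emu; have := (num k).2; rewrite mE; by move/(congr1 (@complex.Re R)).
  exact: (link_law_growth Lsym L2 Hlim Emu).
move=> d T P x ix idx sx; exact: (iid_weak_cvg Lsym L2 Llt Hlim imu Emu).
Qed.

End spectral_limit.


Theorem theorem4p5 (R : realType) :
  (forall (A : ncp R) (Z Z' : A),
     standard_gaussian Z -> standard_gaussian Z' ->
     toeplitz_limit (normalized_sum Z Z') ->
     exists mu : probability (measurableTypeR R) R,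
       determined_by_moments mu (fun k => ncp_phi A (normalized_sum Z Z' ^+ k)) /\
       forall (d : measure_display) (T : measurableType d)
         (P : probability T R) (x : nat -> {RV P >-> R}),
         mutually_independent x -> identically_distributed x ->
         standardized x ->
         {ae P, forall w,
           weak_cvg
             (fun n => esd (normalized (symm_toeplitz (fun j => x j w) n.+1)))
             mu}) /\
  (forall (A : ncp R) (Y1 Y2 : A),
     standard_symm_rayleigh Y1 -> standard_symm_rayleigh Y2 ->
     hankel_limit (normalized_sum Y1 Y2) ->
     exists mu : probability (measurableTypeR R) R,
       determined_by_moments mu (fun k => ncp_phi A (normalized_sum Y1 Y2 ^+ k)) /\
       forall (d : measure_display) (T : measurableType d)
         (P : probability T R) (h : nat -> {RV P >-> R}),
         mutually_independent h -> identically_distributed h ->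
         standardized h ->
         {ae P, forall w,
           weak_cvg
             (fun n => esd (normalized (hankel (fun j => h j w) n.+1)))
             mu}).
Proof.
split=> [A Z Z' _ _ lim|A Y1 Y2 _ _ lim].
- apply: (link_spectral_limit toeplitz_link_sym toeplitz_link_count toeplitz_link_lt).
  move=> d T P x bx ix sx k; have := lim d T P x bx ix sx (nseq k false).
  rewrite (_ : (fun n => ncp_phi _ _) =
     (fun n => (Ex P (link_moment toeplitz_link (fun j => x j) n k))%:C)) ?monomial_power//.
  by apply/funext => n; exact: phi_link_power.
- apply: (link_spectral_limit hankel_link_sym hankel_link_count hankel_link_lt).
  move=> d T P x bx ix sx k; have := lim d T P x bx ix sx (nseq k false).
  rewrite (_ : (fun n => ncp_phi _ _) =
     (fun n => (Ex P (link_moment hankel_link (fun j => x j) n k))%:C)) ?monomial_power//.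
  by apply/funext => n; exact: phi_link_power.
Qed.
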